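(* Let $\nu>0$ be fixed, let $\overline\theta$ be the static Néel wall phase, let $\mathcal L$ be the linearized operator with domain $H^2$, $$\mathcal L u=-\partial_x^2u+\sin\overline\theta\,(1+(-\Delta)^{1/2})(u\sin\overline\theta)-c_\theta u,\qquad c_\theta=\cos\overline\theta\,(1+(-\Delta)^{1/2})\cos\overline\theta,$$ and let $\Lambda_0>0$ be its coercivity constant on the orthogonal complement of $\partial_x\overline\theta$ (see context). Define $\mathcal A:H^1\times L^2\to H^1\times L^2$ with domain $D(\mathcal A)=H^2\times H^1$ by $$\mathcal A=\begin{pmatrix}0&I\\-\mathcal L&-\nu I\end{pmatrix},\qquad\text{i.e. } \mathcal A(u,v)=(v,-\mathcal Lu-\nu v).$$ Then $$\sigma(\mathcal A)\subset\{0\}\cup\{\lambda\in\mathbb C:\ \Re\lambda\le-\zeta_0(\nu)<0\},$$ where $$\zeta_0(\nu)=\tfrac12\nu-\max\Big\{\tfrac12\mathbf 1_{[2,\infty)}(\nu)\sqrt{\nu^2-4},\ \tfrac12\mathbf 1_{[2\sqrt{\Lambda_0},\infty)}(\nu)\sqrt{\nu^2-4\Lambda_0}\Big\}.$$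
   Context: $L^2$ and $H^k$ denote $L^2(\mathbb R,\mathbb C)$ and $H^k(\mathbb R,\mathbb C)$. The half-Laplacian is $(-\Delta)^{1/2}u=(|\xi|\hat u)^\vee$ and $\|u\|_{\dot H^{1/2}}=\||\xi|^{1/2}\hat u\|_{L^2}$ (unitary Fourier transform). $\mathbf 1_\Omega$ is the indicator function of $\Omega\subset\mathbb R$; the indicator terms are read as zero off $\Omega$. The static Néel wall phase $\overline\theta:\mathbb R\to(-\pi/2,\pi/2)$ is the minimizer of $\mathcal E(\theta)=\frac12\big(\|\theta'\|_{L^2}^2+\|\cos\theta\|_{\dot H^{1/2}}^2+\|\cos\theta\|_{L^2}^2\big)$ among $\theta:\mathbb R\to(-\pi/2,\pi/2)$ with $\theta(\pm\infty)=\pm\pi/2$, normalized by $\overline\theta(0)=0$. It is known (earlier work) that $\overline\theta$ exists, that minimizers are unique up to translation, that $\overline\theta$ is smooth, $\partial_x\overline\theta>0$ on $\mathbb R$, $\partial_x\overline\theta\in H^2$, and $\partial_x^2\overline\theta+\sin\overline\theta\,(1+(-\Delta)^{1/2})\cos\overline\theta=0$. $\Lambda_0>0$ denotes a fixed constant (known to exist from earlier work) such that $\langle\mathcal Lu,u\rangle_{L^2}\ge\Lambda_0\|u\|_{L^2}^2$ for all $u\in H^1$ with $\langle u,\partial_x\overline\theta\rangle_{L^2}=0$, where for $u\in H^1$ the left side means $\|\partial_xu\|_{L^2}^2+\int_{\mathbb R}(1+|\xi|)\,|\widehat{u\sin\overline\theta}|^2d\xi-\int_{\mathbb R}c_\theta|u|^2dx$.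 *)

(* Defs.v *)
From HB Require Import structures.
From mathcomp Require Import all_boot all_order all_algebra.
From mathcomp Require Import complex.
From mathcomp Require Import all_classical all_reals all_analysis.

Set Implicit Arguments.
Unset Strict Implicit.
Unset Printing Implicit Defensive.

Import Order.TTheory GRing.Theory Num.Theory.
Import numFieldNormedType.Exports.

Local Open Scope classical_set_scope.
Local Open Scope ring_scope.
Local Open Scope complex_scope.

(* Functions are taken as representatives of their a.e. classes.
   The codomain is R[i]^o, i.e. R[i] as a vector space over itself. *)
Notation Cfun R := (Real.sort R -> GRing.regular (complex (Real.sort R))).

Section Fourier.
Variable R : realType.
Local Notation mu := (@lebesgue_measure R).

Definition normc2 (z : R[i]) : R := complex.Re z ^+ 2 + complex.Im z ^+ 2.

Definition Cintegral (D : set R) (f : Cfun R) : R[i] :=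
  (\int[mu]_(x in D) complex.Re (f x))%R +i* (\int[mu]_(x in D) complex.Im (f x))%R.

Definition ofreal (f : R -> R) : Cfun R := fun x => (f x)%:C.

(* Squared norms are valued in [0, +oo]; wnorm2 m has the weight m. *)
Definition wnorm2 (m : R -> R) (u : Cfun R) : \bar R :=
  (\int[mu]_x (m x * normc2 (u x))%:E)%E.

Definition norm2 (u : Cfun R) : \bar R := wnorm2 (fun=> 1) u.

Definition L2 (u : Cfun R) : Prop :=
  [/\ measurable_fun setT (fun x => complex.Re (u x)),
      measurable_fun setT (fun x => complex.Im (u x)) &
      (norm2 u < +oo)%E].

Definition inner (u v : Cfun R) : R[i] :=
  Cintegral setT (fun x => u x * (v x)^*).

Definition expNi (t : R) : R[i] := cos t -i* sin t.

Definition fourier_trunc (u : Cfun R) (n : nat) : Cfun R := fun xi =>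
  (Num.sqrt (2 * pi))^-1%:C *
  Cintegral `[- n%:R, n%:R] (fun x => u x * expNi (x * xi)).

(* The unitary Fourier transform of u in L^2, as a limit in mean. *)
Definition is_fourier (u w : Cfun R) : Prop :=
  L2 w /\ norm2 (fourier_trunc u n - w) @[n --> \oo] --> 0%E.

Definition fourier (u : Cfun R) : Cfun R := xget 0 [set w | is_fourier u w].

Definition ifourier (w : Cfun R) : Cfun R := fun x => fourier w (- x).

Definition multiplier (m : R -> R[i]) (u : Cfun R) : Cfun R :=
  ifourier (fun xi => m xi * fourier u xi).

Definition halflap : Cfun R -> Cfun R := multiplier (fun xi => `|xi|%:C).

(* The k-th weak derivative of u in H^k, as (i xi)^k on the Fourier side. *)
Definition Dx (k : nat) : Cfun R -> Cfun R :=
  multiplier (fun xi => (xi *i) ^+ k).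

Definition Hnorm2 (k : nat) (u : Cfun R) : \bar R :=
  wnorm2 (fun xi => (1 + xi ^+ 2) ^+ k) (fourier u).

Definition H (k : nat) : set (Cfun R) :=
  [set u | L2 u /\ (Hnorm2 k u < +oo)%E].

End Fourier.

Section NeelWall.
Variable R : realType.
Local Notation mu := (@lebesgue_measure R).

Definition smooth (f : R -> R) : Prop :=
  forall (n : nat) (x : R), derivable (derive1n n f) x 1.

Definition test_function (phi : R -> R) : Prop :=
  smooth phi /\ exists M : R, forall x, M < `|x| -> phi x = 0.

Definition weak_derivative (f g : R -> R) : Prop :=
  locally_integrable setT g /\
  forall phi, test_function phi ->
    (\int[mu]_x (f x * derive1 phi x) = - \int[mu]_x (g x * phi x))%R.

(* The squared L^2 norm of the weak derivative of f, which is unique a.e.;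
   it is +oo if there is none, as the infimum is then over the empty set. *)
Definition dirichlet (f : R -> R) : \bar R :=
  ereal_inf [set (\int[mu]_x (g x ^+ 2)%:E)%E | g in weak_derivative f].

(* If cos theta is not in L^2, its Fourier transform is meaningless, but the
   last term is then +oo. *)
Definition energy (theta : R -> R) : \bar R :=
  let w := ofreal (fun x => cos (theta x)) in
  ((2^-1)%:E *
   (dirichlet theta + wnorm2 (fun xi => `|xi|%R) (fourier w) + norm2 w))%E.

Definition admissible (theta : R -> R) : Prop :=
  [/\ measurable_fun setT theta,
      forall x, - (pi / 2) < theta x < pi / 2,
      theta x @[x --> +oo] --> pi / 2 &
      theta x @[x --> -oo] --> - (pi / 2)].

Definition static_neel_wall (theta : R -> R) : Prop :=
  [/\ admissible theta, (energy theta < +oo)%E,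
      forall phi, admissible phi -> (energy theta <= energy phi)%E &
      theta 0 = 0].

Variable theta : R -> R.

Definition sin_wall : Cfun R := ofreal (fun x => sin (theta x)).
Definition cos_wall : Cfun R := ofreal (fun x => cos (theta x)).

Definition euler_lagrange : Prop :=
  {ae mu, forall x,
    (derive1n 2 theta x)%:C + sin_wall x * (cos_wall x + halflap cos_wall x) = 0}.

Definition c_theta : Cfun R := fun x => cos_wall x * (cos_wall x + halflap cos_wall x).

Definition linop (u : Cfun R) : Cfun R :=
  let w := (fun x => sin_wall x * u x) : Cfun R in
  fun x => - Dx 2 u x + sin_wall x * (w x + halflap w x) - c_theta x * u x.

(* The quadratic form <L u, u> extended to H^1; c_theta is real a.e. *)
Definition linform (u : Cfun R) : R :=
  let w := (fun x => sin_wall x * u x) : Cfun R in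
  fine (norm2 (Dx 1 u)) + fine (wnorm2 (fun xi => 1 + `|xi|) (fourier w))
  - (\int[mu]_x (complex.Re (c_theta x) * normc2 (u x)))%R.

Definition coercivity_constant (Lambda0 : R) : Prop :=
  0 < Lambda0 /\
  forall u : Cfun R, H 1 u -> inner u (ofreal (derive1 theta)) = 0 ->
    Lambda0 * fine (norm2 u) <= linform u.

End NeelWall.

Section Spectrum.
Variables (R : realType) (V : lmodType R[i]).

(* N is a seminorm on the subspace X, which stands for the normed space
   X / {N = 0}; A is an unbounded operator on it with domain D. *)
Definition resolvent_set (X : set V) (N : V -> R) (D : set V) (A : V -> V)
    : set R[i] :=
  [set lambda |
    [/\ forall u, D u -> N (A u - lambda *: u) = 0 -> N u = 0,
        forall f, X f -> exists2 u, D u & N (A u - lambda *: u - f) = 0 &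
        exists K : R, forall u, D u -> N u <= K * N (A u - lambda *: u)]].

Definition spectrum (X : set V) (N : V -> R) (D : set V) (A : V -> V)
    : set R[i] := ~` resolvent_set X N D A.

End Spectrum.

Section Generator.
Variable R : realType.

(* The phase space H^1 x L^2. *)
Definition phase : set ((Cfun R) * (Cfun R)) :=
  [set p | H 1 p.1 /\ L2 p.2].

Definition phase_norm (p : (Cfun R) * (Cfun R)) : R :=
  Num.sqrt (fine (Hnorm2 1 p.1) + fine (norm2 p.2)).

Definition dom_generator : set ((Cfun R) * (Cfun R)) :=
  [set p | H 2 p.1 /\ H 1 p.2].

Definition generator (theta : R -> R) (nu : R) (p : (Cfun R) * (Cfun R))
    : (Cfun R) * (Cfun R) :=
  (p.2, - linop theta p.1 - nu%:C *: p.2).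

Definition zeta0 (Lambda0 nu : R) : R :=
  nu / 2 -
  Num.max
    (2^-1 * \1_`[2, +oo[ nu * Num.sqrt (nu ^+ 2 - 4))
    (2^-1 * \1_`[2 * Num.sqrt Lambda0, +oo[ nu *
       Num.sqrt (nu ^+ 2 - 4 * Lambda0)).

End Generator.

(* Main.v *)
Require Import Defs.
From mathcomp Require Import all_boot all_order all_algebra.
From mathcomp Require Import complex.
From mathcomp Require Import all_classical all_reals all_analysis.
From mathcomp Require Import measurable_realfun.
From mathcomp Require Import ring lra.

(** Write L for the linearized operator. Solving A(u, v) - lambda (u, v) =
    (f1, f2) means v = f1 + lambda u and (L - z) u = - f2 - (lambda + nu) f1,
    where z = - lambda (lambda + nu). So lambda is in the resolvent set of A
    as soon as L - z maps H^2 onto L^2 and its L^2 norm controls the H^1 norm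
    of u ([generator_resolvent]). The rate zeta_0 is made so that lambda <> 0
    and Re lambda > - zeta_0 keep z away from {0} union [Lambda_0, +oo); this
    is the algebra of [dispersion]: a number lambda off the real axis and to
    the right of - nu / 2 gives a nonreal z, and a real nonzero lambda there
    gives a real nonzero z, which is below Lambda_0 by comparison of lambda
    with the larger root of the quadratic equation z = Lambda_0, when that
    root is real.

    It remains that such z are in the resolvent set of L ([linop_resolvent]).
    The operator L is symmetric, kills theta' and is bounded below by Lambda_0
    on the complement of theta'. Decompose u = a theta' + w with w orthogonal
    to theta'; then (L - z) u = - z a theta' + (L - z) w is again an
    orthogonal decomposition, with |(L - z) w| >= d |w| for d = Lambda_0 - Re
    z or d = |Im z|, because the numbers <(L - z) w, w> have real part at
    least (Lambda_0 - Re z) |w|^2 and imaginary part - Im z |w|^2. Since |z| >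
    0 takes care of theta', this bounds L - z from below
    ([minus_spectral_bound]). Surjectivity holds for z = - M with M large, as
    L - z is then a small perturbation of - d^2/dx^2 + M ([surj_base]); it is
    an open condition, with a radius given by the lower bound ([surj_step]),
    hence it propagates along segments where the lower bound is uniform
    ([surj_line]): first vertically from - M, then horizontally to any nonreal
    z ([surj_nonreal]), finally from there down to a real z by one step.

    The remaining hypotheses on L come from the wall. Its kernel contains
    theta' because the Euler-Lagrange equation can be differentiated
    ([linop_dtheta]); it is symmetric because c_theta is real almost
    everywhere, which is again read off the Euler-Lagrange equation, as sin
    theta vanishes only at 0 ([c_theta_real]). The differentiation is
    justified because cos theta is in H^2, which follows from theta' in H^2
    ([H2_cos]).

    All this rests on the L^2 theory of the Fourier transform and of the
    spaces H^k. Plancherel's identity ([plancherel_real], [plancherel_fint])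
    is proved by inserting the weight exp(- e |xi|): the weighted integral of
    the squared transform of f is the integral of the autocorrelation of f
    against the Poisson kernel, and tends to 2 pi |f|^2 because translations
    are continuous in L^2 ([L2_tau_cont]). With the completeness of L^2 this
    defines the transform on L^2 as a limit in mean ([fourierP]). The
    inversion formula [ifourierK] holds because the adjoint of an isometry is
    a left inverse of it: [fourier_adjoint] computes the adjoint from the
    multiplication formula [fourier_mult]. Elements of H^1 are recognized by
    their bounded difference quotients ([diffq_cvg], [H1_of_diffq]), which
    gives the product rule ([H1_pmulr], [Dx_pmulr]); classical derivatives are
    related to the Fourier side by integration by parts ([H1_C1]); and H^1
    functions are bounded ([sobolev_sup]). *)

Set Implicit Arguments.
Unset Strict Implicit.
Unset Printing Implicit Defensive.

Import Order.TTheory GRing.Theory Num.Theory.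
Import numFieldNormedType.Exports.

Local Open Scope classical_set_scope.
Local Open Scope ring_scope.
Local Open Scope complex_scope.

Notation Re := complex.Re.
Notation Im := complex.Im.

(** * Complex numbers in coordinates *)

Section ComplexNumbers.
Variable R : realType.
Implicit Types z w : R[i].

Lemma cReD z w : Re (z + w) = Re z + Re w. Proof. by case: z w => [a b] [c d]. Qed.
Lemma cImD z w : Im (z + w) = Im z + Im w. Proof. by case: z w => [a b] [c d]. Qed.
Lemma cReN z : Re (- z) = - Re z. Proof. by case: z. Qed.
Lemma cImN z : Im (- z) = - Im z. Proof. by case: z. Qed.
Lemma cReM z w : Re (z * w) = Re z * Re w - Im z * Im w.
Proof. by case: z w => [a b] [c d]. Qed.
Lemma cImM z w : Im (z * w) = Re z * Im w + Im z * Re w.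
Proof. by case: z w => [a b] [c d]. Qed.
Lemma cReJ z : Re z^* = Re z. Proof. by case: z. Qed.
Lemma cImJ z : Im z^* = - Im z. Proof. by case: z. Qed.

Definition ReImE := (cReD, cImD, cReN, cImN, cReM, cImM, cReJ, cImJ).

Lemma complexP z w : Re z = Re w -> Im z = Im w -> z = w.
Proof. by case: z w => [a b] [c d] /= -> ->. Qed.

Lemma normc2_ge0 z : 0 <= normc2 z.
Proof. by rewrite addr_ge0 // sqr_ge0. Qed.

Lemma normc2M z w : normc2 (z * w) = normc2 z * normc2 w.
Proof. rewrite /normc2 !ReImE; ring. Qed.

Lemma normc2J z : normc2 z^* = normc2 z.
Proof. by rewrite /normc2 !ReImE sqrrN. Qed.

Lemma normc2N z : normc2 (- z) = normc2 z.
Proof. by rewrite /normc2 !ReImE !sqrrN. Qed.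

Lemma normc2_0 : normc2 (0 : R[i]) = 0.
Proof. by rewrite /normc2 /= expr0n addr0. Qed.

Lemma normc2_real (r : R) : normc2 r%:C = r ^+ 2.
Proof. by rewrite /normc2 /= expr0n addr0. Qed.

Lemma normc2_eq0 z : normc2 z = 0 -> z = 0.
Proof.
move/eqP; rewrite paddr_eq0 ?sqr_ge0 // !sqrf_eq0 => /andP[/eqP a /eqP b].
exact: complexP.
Qed.

Lemma normc2_mulJ z : z * z^* = (normc2 z)%:C.
Proof. by apply: complexP; rewrite !ReImE /normc2 /=; ring. Qed.

Lemma normc2D_le z w : normc2 (z + w) <= 2 * normc2 z + 2 * normc2 w.
Proof.
rewrite /normc2 !ReImE.
have h1 := sqr_ge0 (Re z - Re w); have h2 := sqr_ge0 (Im z - Im w); nra.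
Qed.

Lemma normc2B_le z w : normc2 (z - w) <= 2 * normc2 z + 2 * normc2 w.
Proof. by apply: le_trans (normc2D_le _ _) _; rewrite normc2N. Qed.

Lemma absRe_le z : `|Re z| <= Num.sqrt (normc2 z).
Proof. by rewrite -sqrtr_sqr ler_wsqrtr // lerDl sqr_ge0. Qed.

Lemma absIm_le z : `|Im z| <= Num.sqrt (normc2 z).
Proof. by rewrite -sqrtr_sqr ler_wsqrtr // lerDr sqr_ge0. Qed.

Lemma abs_ReM z w : `|Re (z * w)| <= normc2 z + normc2 w.
Proof.
rewrite cReM ler_norml /normc2.
have := (sqr_ge0 (Re z + Re w), sqr_ge0 (Re z - Re w),
  sqr_ge0 (Im z + Im w), sqr_ge0 (Im z - Im w)).
by move=> [[[h1 h2] h3] h4]; apply/andP; split; nra.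
Qed.

Lemma abs_ImM z w : `|Im (z * w)| <= normc2 z + normc2 w.
Proof.
rewrite cImM ler_norml /normc2.
have := (sqr_ge0 (Re z + Im w), sqr_ge0 (Re z - Im w),
  sqr_ge0 (Im z + Re w), sqr_ge0 (Im z - Re w)).
by move=> [[[h1 h2] h3] h4]; apply/andP; split; nra.
Qed.

End ComplexNumbers.

(** * Integrable real functions on the line *)

Section RealIntegrals.
Variable R : realType.
Local Notation mu := (@lebesgue_measure R).
Implicit Types f g : R -> R.

Definition integr f := mu.-integrable setT (EFin \o f).
Definition meas f := measurable_fun setT f.

Lemma integr_meas f : integr f -> meas f.
Proof. by move=> /integrableP[/measurable_EFinP]. Qed.

Lemma integrD f g : integr f -> integr g -> integr (fun x => f x + g x).
Proof. by move=> hf hg; exact: (integrableD measurableT hf hg). Qed.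

Lemma integrB f g : integr f -> integr g -> integr (fun x => f x - g x).
Proof. by move=> hf hg; exact: (integrableB measurableT hf hg). Qed.

Lemma integrZ r f : integr f -> integr (fun x => r * f x).
Proof. by move=> hf; exact: (integrableZl measurableT r hf). Qed.

Lemma integr_le f g : meas f -> integr g -> (forall x, `|f x| <= g x) -> integr f.
Proof.
move=> mf ig h; apply: (le_integrable measurableT _ _ ig).
  exact/measurable_EFinP.
by move=> x _ /=; rewrite lee_fin (le_trans (h x)) // ler_norm.
Qed.

Lemma integr_norm f : integr f -> integr (fun x => `|f x|).
Proof. by move=> hf; exact: (integrable_abse hf). Qed.

Lemma integrN f : integr f -> integr (fun x => - f x).
Proof. by move=> /(integrZ (-1)); under eq_fun do rewrite mulN1r. Qed.

Lemma RintE f : integr f -> (\int[mu]_x (f x)%:E = (\int[mu]_x f x)%:E)%E.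
Proof. by move=> hf; rewrite fineK // integrable_fin_num. Qed.

Lemma integr_ge0P f : meas f -> (forall x, 0 <= f x) ->
  (\int[mu]_x (f x)%:E < +oo)%E -> integr f.
Proof.
move=> mf f0 foo; apply/integrableP; split; first exact/measurable_EFinP.
by under eq_integral do rewrite /= ger0_norm //.
Qed.

Lemma integr_fin f : integr f -> (\int[mu]_x (f x)%:E < +oo)%E.
Proof. by move=> hf; rewrite RintE // ltry. Qed.

Lemma RintD f g : integr f -> integr g ->
  \int[mu]_x (f x + g x) = \int[mu]_x f x + \int[mu]_x g x.
Proof. by move=> hf hg; rewrite RintegralD. Qed.

Lemma RintB f g : integr f -> integr g ->
  \int[mu]_x (f x - g x) = \int[mu]_x f x - \int[mu]_x g x.
Proof. by move=> hf hg; rewrite RintegralB. Qed.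

Lemma RintZ r f : integr f -> \int[mu]_x (r * f x) = r * \int[mu]_x f x.
Proof. by move=> hf; rewrite RintegralZl. Qed.

Lemma RintN f : integr f -> \int[mu]_x (- f x) = - \int[mu]_x f x.
Proof.
move=> hf; rewrite -mulN1r -RintZ //; apply: eq_Rintegral => x _.
by rewrite mulN1r.
Qed.

Lemma Rint_le f g : integr f -> integr g -> (forall x, f x <= g x) ->
  \int[mu]_x f x <= \int[mu]_x g x.
Proof. by move=> hf hg h; apply: le_Rintegral. Qed.

Lemma aeS (P Q : R -> Prop) : (forall x, P x -> Q x) ->
  {ae mu, forall x, P x} -> {ae mu, forall x, Q x}.
Proof. exact: (@filterS _ _ (ae_filter_ringOfSetsType mu)). Qed.

Lemma aeS2 (P Q S : R -> Prop) : (forall x, P x -> Q x -> S x) ->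
  {ae mu, forall x, P x} -> {ae mu, forall x, Q x} -> {ae mu, forall x, S x}.
Proof. exact: (@filterS2 _ _ (ae_filter_ringOfSetsType mu)). Qed.

Lemma eq_Rint_ae f g : meas f -> meas g -> {ae mu, forall x, f x = g x} ->
  \int[mu]_x f x = \int[mu]_x g x.
Proof.
move=> mf mg h; rewrite /Rintegral; congr fine.
apply: ae_eq_integral => //; [exact/measurable_EFinP|exact/measurable_EFinP|].
by apply: aeS h => x -> _.
Qed.

Lemma Rint_ge0_eq0 f : integr f -> (forall x, 0 <= f x) ->
  \int[mu]_x f x = 0 -> {ae mu, forall x, f x = 0}.
Proof.
move=> hf f0 h0.
have mf : measurable_fun setT (EFin \o f) by apply/measurable_EFinP; exact: integr_meas.
have : (\int[mu]_x `|(EFin \o f) x| = 0)%E.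
  under eq_integral do rewrite /= ger0_norm //.
  by rewrite RintE // h0.
move/(ae_eq_integral_abs mu measurableT mf).
by apply: aeS => x /(_ I) [].
Qed.

Lemma Rint_abs_le f : integr f -> `|\int[mu]_x f x| <= \int[mu]_x `|f x|.
Proof. by move=> hf; apply: le_normr_Rintegral. Qed.

End RealIntegrals.

(** * The pre-Hilbert structure of L^2 *)

Section L2space.
Variable R : realType.
Local Notation mu := (@lebesgue_measure R).
Implicit Types u v w : Cfun R.
Implicit Types z : R[i].

Definition cmeas u := meas (fun x => Re (u x)) /\ meas (fun x => Im (u x)).

Lemma cmeasD u v : cmeas u -> cmeas v -> cmeas (u + v).
Proof.
move=> [a b] [c d]; split; rewrite /meas;
  [under eq_fun do rewrite cReD | under eq_fun do rewrite cImD];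
  exact: measurable_funD.
Qed.

Lemma cmeasN u : cmeas u -> cmeas (- u).
Proof.
move=> [a b]; split; rewrite /meas;
  [under eq_fun do rewrite cReN | under eq_fun do rewrite cImN];
  exact: measurableT_comp.
Qed.

Lemma cmeasB u v : cmeas u -> cmeas v -> cmeas (u - v).
Proof. by move=> a b; apply: cmeasD => //; apply: cmeasN. Qed.

Lemma cmeasM u v : cmeas u -> cmeas v -> cmeas (fun x => u x * v x).
Proof.
move=> [a b] [c d]; split; rewrite /meas;
  [under eq_fun do rewrite cReM | under eq_fun do rewrite cImM].
  by apply: measurable_funB; apply: measurable_funM.
by apply: measurable_funD; apply: measurable_funM.
Qed.

Lemma cmeasJ u : cmeas u -> cmeas (fun x => (u x)^*).
Proof.
move=> [a b]; split; rewrite /meas;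
  [under eq_fun do rewrite cReJ | under eq_fun do rewrite cImJ] => //.
exact: measurableT_comp.
Qed.

Lemma cmeas_cst z : cmeas (fun=> z).
Proof. by split; exact: measurable_cst. Qed.

Lemma cmeasZ z u : cmeas u -> cmeas (z *: u).
Proof. by move=> h; apply: (cmeasM (cmeas_cst z) h). Qed.

Lemma cmeas_real (f : R -> R) : meas f -> cmeas (fun x => (f x)%:C).
Proof. by move=> h; split => //; exact: measurable_cst. Qed.

Lemma meas_normc2 u : cmeas u -> meas (fun x => normc2 (u x)).
Proof. by move=> [a b]; apply: measurable_funD; apply: measurable_funX. Qed.

Lemma norm2E u : norm2 u = (\int[mu]_x (normc2 (u x))%:E)%E.
Proof. by apply: eq_integral => x _; rewrite mul1r. Qed.

Lemma L2P u : L2 u <-> cmeas u /\ integr (fun x => normc2 (u x)).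
Proof.
split=> [[a b h]|[[a b] h]].
  split; first by split.
  apply: integr_ge0P; [exact: meas_normc2|by move=> x; exact: normc2_ge0|].
  by rewrite -norm2E.
by split => //; rewrite norm2E; exact: integr_fin.
Qed.

Lemma L2_cmeas u : L2 u -> cmeas u. Proof. by case/L2P. Qed.
Lemma L2_integr u : L2 u -> integr (fun x => normc2 (u x)). Proof. by case/L2P. Qed.

Definition n2 u : R := \int[mu]_x normc2 (u x).
Definition nrm u : R := Num.sqrt (n2 u).

Lemma fine_norm2 u : fine (norm2 u) = n2 u.
Proof. by rewrite norm2E. Qed.

Lemma norm2_n2 u : L2 u -> norm2 u = (n2 u)%:E.
Proof. by move=> h; rewrite norm2E RintE //; exact: L2_integr. Qed.

Lemma n2_ge0 u : 0 <= n2 u.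
Proof. by apply: Rintegral_ge0 => x _; exact: normc2_ge0. Qed.

Lemma nrm_ge0 u : 0 <= nrm u. Proof. exact: sqrtr_ge0. Qed.

Lemma nrm_sqr u : nrm u ^+ 2 = n2 u. Proof. by rewrite sqr_sqrtr // n2_ge0. Qed.

Hint Resolve nrm_ge0 n2_ge0 normc2_ge0 : core.

Lemma L2_dom K u v : cmeas u -> L2 v ->
  (forall x, normc2 (u x) <= K * normc2 (v x)) -> L2 u.
Proof.
move=> mu_ /L2P[mv iv] h; apply/L2P; split => //.
apply: (integr_le (meas_normc2 mu_) (integrZ K iv)) => x.
by rewrite ger0_norm ?normc2_ge0 ?h.
Qed.

Lemma n2_dom K u v : cmeas u -> L2 v ->
  (forall x, normc2 (u x) <= K * normc2 (v x)) -> n2 u <= K * n2 v.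
Proof.
move=> mu_ Lv h; have Lu := L2_dom mu_ Lv h.
rewrite -RintZ; last exact: L2_integr.
by apply: Rint_le => //; [exact: L2_integr|apply/integrZ/L2_integr].
Qed.

Lemma L2D u v : L2 u -> L2 v -> L2 (u + v).
Proof.
move=> /L2P[mu_ iu] /L2P[mv iv]; apply/L2P; split; first exact: cmeasD.
apply: (integr_le _ (integrD (integrZ 2 iu) (integrZ 2 iv))).
  by apply: meas_normc2; exact: cmeasD.
by move=> x; rewrite ger0_norm; [exact: normc2D_le|exact: normc2_ge0].
Qed.

Lemma L2M B (m : Cfun R) u : cmeas m -> L2 u ->
  (forall x, normc2 (m x) <= B) -> L2 (fun x => m x * u x).
Proof.
move=> mm Lu h; apply: (L2_dom _ Lu (K := B)).
  by apply: cmeasM => //; exact: L2_cmeas.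
by move=> x; rewrite normc2M ler_wpM2r ?normc2_ge0 ?h.
Qed.

Lemma L2Z z u : L2 u -> L2 (z *: u).
Proof. by move=> h; apply: (L2M (cmeas_cst z) h (B := normc2 z)). Qed.

Lemma L2N u : L2 u -> L2 (- u).
Proof. by rewrite -scaleN1r; exact: L2Z. Qed.

Lemma L2B u v : L2 u -> L2 v -> L2 (u - v).
Proof. by move=> a b; apply: L2D => //; exact: L2N. Qed.

Lemma L2J u : L2 u -> L2 (fun x => (u x)^*).
Proof.
move=> Lu; apply: (L2_dom _ Lu (K := 1)).
  by apply: cmeasJ; exact: L2_cmeas.
by move=> x; rewrite normc2J mul1r.
Qed.

Lemma n2J u : n2 (fun x => (u x)^*) = n2 u.
Proof. by apply: eq_Rintegral => x _; rewrite normc2J. Qed.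

Lemma L2_0 : L2 (0 : Cfun R).
Proof.
apply/L2P; split; first exact: cmeas_cst.
rewrite /integr; under [X in EFin \o X]eq_fun do rewrite normc2_0.
exact: integrable0.
Qed.

Lemma n2_0 : n2 (0 : Cfun R) = 0.
Proof.
rewrite /n2 /Rintegral; under eq_integral do rewrite normc2_0.
by rewrite integral0.
Qed.

Lemma nrm_0 : nrm (0 : Cfun R) = 0.
Proof. by rewrite /nrm n2_0 sqrtr0. Qed.

Lemma L2_ae u v : cmeas v -> L2 u -> {ae mu, forall x, u x = v x} -> L2 v.
Proof.
move=> mv Lu h; apply/L2P; split => //.
apply: integr_ge0P => //; first exact: meas_normc2.
rewrite (_ : (\int[mu]_x _)%E = norm2 u); first by case: Lu.
rewrite norm2E; apply: ge0_ae_eq_integral => //.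
- by apply/measurable_EFinP; exact: meas_normc2.
- by apply/measurable_EFinP; apply: meas_normc2; exact: L2_cmeas.
- by move=> x _; rewrite lee_fin normc2_ge0.
- by move=> x _; rewrite lee_fin normc2_ge0.
by apply: aeS h => x -> _.
Qed.

Lemma n2_ae u v : cmeas u -> cmeas v -> {ae mu, forall x, u x = v x} ->
  n2 u = n2 v.
Proof.
move=> a b h; apply: eq_Rint_ae; [exact: meas_normc2|exact: meas_normc2|].
by apply: aeS h => x ->.
Qed.

Lemma n2_eq0_ae u : L2 u -> n2 u = 0 -> {ae mu, forall x, u x = 0}.
Proof.
move=> Lu h; have : {ae mu, forall x, normc2 (u x) = 0}.
  by apply: Rint_ge0_eq0 => //; exact: L2_integr.
by apply: aeS => x /normc2_eq0.
Qed.

Lemma ae_n2_eq0 u : cmeas u -> {ae mu, forall x, u x = 0} -> n2 u = 0.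
Proof. by move=> mu_ h; rewrite -n2_0; apply: n2_ae => //; exact: cmeas_cst. Qed.

Lemma nrm_eq0_ae u v : L2 u -> L2 v -> nrm (u - v) = 0 ->
  {ae mu, forall x, u x = v x}.
Proof.
move=> Lu Lv h; have : {ae mu, forall x, (u - v) x = 0}.
  by apply: n2_eq0_ae; [exact: L2B|rewrite -nrm_sqr h expr0n].
by apply: aeS => x /eqP; rewrite subr_eq0 => /eqP.
Qed.

Lemma integr_ReM u v : L2 u -> L2 v -> integr (fun x => Re (u x * v x)).
Proof.
move=> /L2P[mu_ iu] /L2P[mv iv]; apply: (integr_le _ (integrD iu iv)).
  by case: (cmeasM mu_ mv).
by move=> x; exact: abs_ReM.
Qed.

Lemma integr_ImM u v : L2 u -> L2 v -> integr (fun x => Im (u x * v x)).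
Proof.
move=> /L2P[mu_ iu] /L2P[mv iv]; apply: (integr_le _ (integrD iu iv)).
  by case: (cmeasM mu_ mv).
by move=> x; exact: abs_ImM.
Qed.

Lemma innerDl u v w : L2 u -> L2 v -> L2 w ->
  inner (u + v) w = inner u w + inner v w.
Proof.
move=> Lu Lv Lw; have LJ := L2J Lw.
apply: complexP; rewrite ?cReD ?cImD /= -?RintD; try exact: integr_ReM;
  try exact: integr_ImM; by apply: eq_Rintegral => x _; rewrite mulrDl ?cReD ?cImD.
Qed.

Lemma innerZl z u w : L2 u -> L2 w -> inner (z *: u) w = z * inner u w.
Proof.
move=> Lu Lw; have LJ := L2J Lw.
have hr := integr_ReM Lu LJ; have hi := integr_ImM Lu LJ.
apply: complexP; rewrite ?cReM ?cImM /= -?RintZ // -?RintB -?RintD //;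
  try exact: integrZ.
  by apply: eq_Rintegral => x _; rewrite -[(z *: u) x]/(z * u x) -mulrA cReM.
by apply: eq_Rintegral => x _; rewrite -[(z *: u) x]/(z * u x) -mulrA cImM.
Qed.

Lemma inner_sym u w : L2 u -> L2 w -> inner w u = (inner u w)^*.
Proof.
move=> Lu Lw; have LJ := L2J Lw.
apply: complexP; rewrite ?cReJ ?cImJ /= -?RintN; try exact: integr_ImM;
  apply: eq_Rintegral => x _; rewrite !ReImE; ring.
Qed.

Lemma inner_self u : inner u u = (n2 u)%:C.
Proof.
apply: complexP => /=; first by apply: eq_Rintegral => x _; rewrite normc2_mulJ.
rewrite /Rintegral (eq_integral (cst 0%E)); first by rewrite integral0.
by move=> x _; rewrite normc2_mulJ.
Qed.

Lemma innerDr u v w : L2 u -> L2 v -> L2 w ->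
  inner w (u + v) = inner w u + inner w v.
Proof.
move=> Lu Lv Lw; rewrite (inner_sym (L2D Lu Lv) Lw) innerDl // rmorphD.
by rewrite (inner_sym Lu Lw) (inner_sym Lv Lw).
Qed.

Lemma innerZr z u w : L2 u -> L2 w -> inner w (z *: u) = z^* * inner w u.
Proof.
move=> Lu Lw; rewrite (inner_sym (L2Z z Lu) Lw) innerZl // rmorphM.
by rewrite (inner_sym Lu Lw).
Qed.

Lemma innerNl u w : L2 u -> L2 w -> inner (- u) w = - inner u w.
Proof. by move=> a b; rewrite -scaleN1r innerZl // mulN1r. Qed.

Lemma innerBl u v w : L2 u -> L2 v -> L2 w ->
  inner (u - v) w = inner u w - inner v w.
Proof. by move=> a b c; rewrite innerDl ?innerNl //; exact: L2N. Qed.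

Lemma innerNr u w : L2 u -> L2 w -> inner w (- u) = - inner w u.
Proof. by move=> a b; rewrite -scaleN1r innerZr // rmorphN rmorph1 mulN1r. Qed.

Lemma innerBr u v w : L2 u -> L2 v -> L2 w ->
  inner w (u - v) = inner w u - inner w v.
Proof. by move=> a b c; rewrite innerDr ?innerNr //; exact: L2N. Qed.

Lemma n2D u v : L2 u -> L2 v -> n2 (u + v) = n2 u + n2 v + 2 * Re (inner u v).
Proof.
move=> Lu Lv; have L := L2D Lu Lv.
rewrite -[LHS]/(Re (n2 (u + v))%:C) -inner_self innerDl // !innerDr //.
rewrite !inner_self (inner_sym Lu Lv) !ReImE /=; ring.
Qed.

Lemma n2Z z u : L2 u -> n2 (z *: u) = normc2 z * n2 u.
Proof.
move=> Lu; rewrite /n2 -RintZ; last exact: L2_integr.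
by apply: eq_Rintegral => x _; rewrite -normc2M.
Qed.

Lemma n2N u : n2 (- u) = n2 u.
Proof. by apply: eq_Rintegral => x _; rewrite normc2N. Qed.

Lemma nrmN u : nrm (- u) = nrm u. Proof. by rewrite /nrm n2N. Qed.

Lemma nrmBC u v : nrm (u - v) = nrm (v - u).
Proof. by rewrite -nrmN opprB. Qed.

Lemma nrmZ z u : L2 u -> nrm (z *: u) = Num.sqrt (normc2 z) * nrm u.
Proof. by move=> Lu; rewrite /nrm n2Z // sqrtrM //; exact: normc2_ge0. Qed.

(** The polynomial n2 (u - t v) in t is nonnegative. With t = nrm u / nrm v
    this is the claim; if a norm vanishes, another t would make the polynomial
    negative unless the real part of the inner product is at most 0. *)
Lemma Re_inner_le u v : L2 u -> L2 v -> Re (inner u v) <= nrm u * nrm v.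
Proof.
move=> Lu Lv.
have key (t : R) : 0 <= n2 u + t ^+ 2 * n2 v - 2 * t * Re (inner u v).
  have := n2_ge0 (u + (- t)%:C *: v).
  have Lt := L2Z (- t)%:C Lv.
  rewrite n2D // n2Z // normc2_real innerZr //.
  by rewrite !ReImE /= oppr0 !mul0r subr0 sqrrN => h; lra.
have [v0|v0] := eqVneq (nrm v) 0.
  rewrite v0 mulr0; case: (leP (Re (inner u v)) 0) => // p.
  have := key ((n2 u + 1) / (2 * Re (inner u v))).
  rewrite -[n2 v]nrm_sqr v0 expr0n /= mulr0 addr0.
  rewrite -!mulrA [2 * _]mulrC -!mulrA.
  rewrite [X in _ - X](_ : _ = n2 u + 1); first by lra.
  by field; rewrite gt_eqF.
have vp : 0 < nrm v by rewrite lt_neqAle eq_sym v0 nrm_ge0.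
have := key (nrm u / nrm v); rewrite -![n2 _]nrm_sqr.
rewrite (_ : (nrm u / nrm v) ^+ 2 * nrm v ^+ 2 = nrm u ^+ 2); last by field.
move=> h.
have : 2 * (nrm u / nrm v) * Re (inner u v) <= 2 * nrm u ^+ 2 by lra.
have [u0|u0] := eqVneq (nrm u) 0.
  move=> _; rewrite u0 mul0r; case: (leP (Re (inner u v)) 0) => // p.
  have := key (Re (inner u v) / n2 v).
  rewrite -![n2 _]nrm_sqr u0 expr0n add0r.
  rewrite (_ : _ - _ = - (Re (inner u v) / nrm v) ^+ 2); last by field.
  by rewrite oppr_ge0 leNgt exprn_gt0 // divr_gt0.
have up : 0 < nrm u by rewrite lt_neqAle eq_sym u0 nrm_ge0.
rewrite (_ : 2 * nrm u ^+ 2 = 2 * (nrm u / nrm v) * (nrm u * nrm v)); last by field.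
by rewrite ler_pM2l // mulr_gt0 // divr_gt0.
Qed.

(** Only the real part of an inner product is controlled by [Re_inner_le]; the
    phase is removed by multiplying u by the conjugate of inner u v. *)
Lemma cauchy_schwarz u v : L2 u -> L2 v ->
  Num.sqrt (normc2 (inner u v)) <= nrm u * nrm v.
Proof.
move=> Lu Lv; set z := inner u v.
have := Re_inner_le (L2Z z^* Lu) Lv.
rewrite innerZl // mulrC normc2_mulJ nrmZ // normc2J /=.
rewrite -{1}[normc2 _]sqr_sqrtr; last exact: normc2_ge0.
rewrite expr2 -/z.
have [->|n0] := eqVneq (Num.sqrt (normc2 z)) 0; first by rewrite mulr_ge0.
by rewrite -mulrA ler_pM2l // lt_neqAle eq_sym n0 sqrtr_ge0.
Qed.

Lemma nrmD_le u v : L2 u -> L2 v -> nrm (u + v) <= nrm u + nrm v.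
Proof.
move=> Lu Lv; rewrite -(@ler_pXn2r _ 2) ?nnegrE ?addr_ge0 //.
rewrite nrm_sqr n2D // -!nrm_sqr.
have := Re_inner_le Lu Lv; lra.
Qed.

Lemma nrm_tri w u v : L2 u -> L2 v -> L2 w ->
  nrm (u - v) <= nrm (u - w) + nrm (w - v).
Proof.
move=> a b c; rewrite (_ : u - v = (u - w) + (w - v)).
  by apply: nrmD_le; exact: L2B.
by rewrite addrA subrK.
Qed.

Lemma nrm_ge_diff u v : L2 u -> L2 v -> `|nrm u - nrm v| <= nrm (u - v).
Proof.
move=> a b; rewrite ler_distl; apply/andP; split.
  rewrite lerBlDr nrmBC.
  rewrite -{1}(subrK u v); rewrite addrC; apply: nrmD_le => //; exact: L2B.
by rewrite -{1}(subrK v u) addrC; apply: nrmD_le => //; exact: L2B.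
Qed.

Lemma nrm_ae u v : cmeas u -> cmeas v -> {ae mu, forall x, u x = v x} ->
  nrm u = nrm v.
Proof. by move=> a b c; rewrite /nrm (n2_ae a b c). Qed.

Lemma ae_nrm_eq0 u v : cmeas u -> cmeas v -> {ae mu, forall x, u x = v x} ->
  nrm (u - v) = 0.
Proof.
move=> a b h; rewrite /nrm ae_n2_eq0 ?sqrtr0 //; first exact: cmeasB.
by apply: aeS h => x hx; rewrite -[LHS]/(u x - v x) hx subrr.
Qed.

End L2space.

(** * Almost everywhere limits and completeness of L^2 *)

Section LimitTheorems.
Variable R : realType.
Local Notation mu := (@lebesgue_measure R).

Lemma meas_EFin (f : R -> R) : meas f -> measurable_fun setT (EFin \o f).
Proof. by move=> h; apply/measurable_EFinP; exact: h. Qed.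

Lemma fatou_real (f_ : nat -> R -> R) (f : R -> R) (C : R) :
  (forall n, integr (f_ n)) -> (forall n x, 0 <= f_ n x) ->
  meas f -> (forall x, 0 <= f x) ->
  {ae mu, forall x, f_ n x @[n --> \oo] --> f x} ->
  (forall n, \int[mu]_x f_ n x <= C) ->
  integr f /\ \int[mu]_x f x <= C.
Proof.
move=> hf f_0 mf f0 cf hC.
have mF n : measurable_fun setT (EFin \o f_ n) by apply: meas_EFin; exact: integr_meas.
have F0 n x : setT x -> (0 <= (EFin \o f_ n) x)%E by rewrite lee_fin.
have mL : measurable_fun setT (fun x => limn_einf (fun n => (EFin \o f_ n) x)).
  under eq_fun do rewrite -[limn_einf _]oppeK -limn_esupN.
  apply: measurableT_comp; first exact: oppe_measurable.
  apply: measurable_fun_limn_esup => n.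
  by apply: (measurableT_comp (@oppe_measurable _ _)); exact: mF.
have := fatou mu measurableT mF F0.
set I := (\int[mu]_(x in _) _)%E; set J := limn_einf _ => IJ.
have IE : I = (\int[mu]_x (f x)%:E)%E.
  apply: ae_eq_integral => //; first exact: meas_EFin.
  apply: aeS cf => x cx _; rewrite is_cvg_limn_einfE.
    by apply/cvg_lim => //; apply: cvg_EFin => //; exact: nearW.
  by apply: (cvgP (f x)%:E); apply: cvg_EFin => //; exact: nearW.
have JC : (J <= C%:E)%E.
  rewrite /J limn_einf_lim; apply: lime_le; first exact: is_cvg_einfs.
  apply: nearW => n; apply: (@le_trans _ _ (\int[mu]_x (f_ n x)%:E)%E).
    by apply: ereal_inf_lbound; exists n => //=.
  by rewrite RintE // lee_fin.
have fC : (\int[mu]_x (f x)%:E <= C%:E)%E by rewrite -IE; exact: le_trans IJ JC.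
have fi : integr f by apply: integr_ge0P => //; apply: le_lt_trans fC _; rewrite ltry.
by split => //; rewrite -lee_fin -RintE.
Qed.

(** The sum of the f_ n has integral at most 2, hence is finite almost
    everywhere, and it dominates every f_ n. It is meant for f_ n = C_ n |u_
    n|^2 with C_ n growing geometrically, when boundedness at x says that u_ n
    x decays geometrically. *)
Lemma bounded_of_summable (f_ : nat -> R -> R) :
  (forall n, meas (f_ n)) -> (forall n x, 0 <= f_ n x) ->
  (forall n, (\int[mu]_x (f_ n x)%:E <= ((2^-1) ^+ n)%:E)%E) ->
  {ae mu, forall x, exists C, forall n, f_ n x <= C}.
Proof.
move=> mf f0 hf.
pose S x := (\sum_(n <oo) (f_ n x)%:E)%E.
have mF n : measurable_fun setT (fun x => (f_ n x)%:E) by exact: meas_EFin.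
have mS : measurable_fun setT S.
  by apply: ge0_emeasurable_sum => // n x _ _; rewrite lee_fin.
have S0 x : (0 <= S x)%E by apply: nneseries_ge0 => n _ _; rewrite lee_fin.
have iS : mu.-integrable setT S.
  apply/integrableP; split => //.
  under eq_integral do rewrite gee0_abs //.
  rewrite integral_nneseries //; last by move=> n x _; rewrite lee_fin.
  apply: (@le_lt_trans _ _ (\sum_(n <oo) ((2^-1) ^+ n)%:E)%E).
    by apply: lee_nneseries => // n _ _; apply: integral_ge0 => x _; rewrite lee_fin.
  apply: (@le_lt_trans _ _ (1 * (1 - 2^-1)^-1)%:E); last by rewrite ltry.
  apply: lime_le; first by apply: is_cvg_nneseries => n _ _; rewrite lee_fin exprn_ge0.
  apply: nearW => n; rewrite sumEFin lee_fin.
  have h2 : `|2^-1 : R| < 1 by rewrite ger0_norm // invf_lt1 // ltr1n.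
  have := @geometric_le_lim R n 1 2^-1 ler01 _ h2.
  rewrite /series /= ?big_mkord; under [in X in (_ -> X <= _) -> _] eq_bigr do rewrite mul1r.
  by rewrite ?big_mkord; apply; rewrite invr_gt0.
have := integrable_ae measurableT iS.
apply: aeS => x /(_ I) Sx; exists (fine (S x)) => n.
rewrite -lee_fin fineK //.
have := @nneseries_lim_ge R (fun n => (f_ n x)%:E) xpredT 0%N n.+1.
move=> /(_ (fun i _ _ => _)) h.
apply: (@le_trans _ _ (\sum_(0 <= i < n.+1) (f_ i x)%:E)%E).
  rewrite big_nat_recr //= -[leLHS]add0e; apply: leeD => //.
  by apply: sume_ge0 => i _; rewrite lee_fin.
by apply: nneseries_lim_ge => i _ _; rewrite lee_fin.
Qed.

Lemma geom_cvg0 (C : R) (a : nat -> R) :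
  (forall n, `|a n| <= C * (2^-1) ^+ n) -> a n @[n --> \oo] --> 0.
Proof.
move=> h; have h2 : `|2^-1 : R| < 1 by rewrite ger0_norm // invf_lt1 // ltr1n.
apply/cvgrPdist_le => e e0.
have /cvgrPdist_le /(_ e e0) [N _ hN] := @cvg_geometric R C _ h2.
exists N => // n /hN /=; rewrite !sub0r !normrN => hn.
by rewrite (le_trans (h n)) // (le_trans _ hn) // ler_norm.
Qed.

Lemma geom_cauchy (C : R) (a : nat -> R) :
  (forall n, `|a n.+1 - a n| <= C * (2^-1) ^+ n) -> cvgn a.
Proof.
move=> h; have h2 : `|2^-1 : R| < 1 by rewrite ger0_norm // invf_lt1 // ltr1n.
have cs : cvgn (series (telescope a)).
  apply: normed_cvg; apply: (@series_le_cvg R _ (geometric C 2^-1)) => //.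
  - by move=> n /=; rewrite normr_ge0.
  - by move=> n /=; apply: le_trans (h n).
  - exact: is_cvg_geometric_series.
case/cvg_ex: cs => l hl; apply/cvg_ex; exists (a 0%N + l).
under eq_cvg do rewrite eq_sum_telescope.
by apply: cvgD; [exact: cvg_cst|exact: hl].
Qed.

End LimitTheorems.

Section Completeness.
Variable R : realType.
Local Notation mu := (@lebesgue_measure R).
Implicit Types u v : Cfun R.

(** The componentwise upper limit is measurable whether or not the sequence
    converges, so it provides the limit function without first isolating the
    set of convergence. *)
Definition climsup (u_ : nat -> Cfun R) : Cfun R := fun x =>
  fine (limn_esup (fun n => (Re (u_ n x))%:E)) +i*
  fine (limn_esup (fun n => (Im (u_ n x))%:E)).

Lemma cmeas_climsup (u_ : nat -> Cfun R) :
  (forall n, cmeas (u_ n)) -> cmeas (climsup u_).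
Proof.
move=> h; split.
  apply: (measurableT_comp (fine_measurable measurableT)).
  by apply: measurable_fun_limn_esup => n; apply: meas_EFin; case: (h n).
apply: (measurableT_comp (fine_measurable measurableT)).
by apply: measurable_fun_limn_esup => n; apply: meas_EFin; case: (h n).
Qed.

Lemma fine_limn_esup (a : nat -> R) (l : R) :
  a n @[n --> \oo] --> l -> fine (limn_esup (fun n => (a n)%:E)) = l.
Proof.
move=> h; rewrite (cvg_limn_einf_sup (l := l%:E)) //.
by apply: cvg_EFin => //; exact: nearW.
Qed.

(** Convergence in coordinates: it needs no topology on R[i] and can be fed to
    the limit theorems for real integrals. *)
Definition ccvg (z_ : nat -> R[i]) (z : R[i]) :=
  Re (z_ n) @[n --> \oo] --> Re z /\ Im (z_ n) @[n --> \oo] --> Im z.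

Lemma ccvgD (z_ w_ : nat -> R[i]) z w :
  ccvg z_ z -> ccvg w_ w -> ccvg (fun n => z_ n + w_ n) (z + w).
Proof.
move=> [a b] [c d]; split; [rewrite cReD; under eq_cvg do rewrite cReD
 | rewrite cImD; under eq_cvg do rewrite cImD]; exact: cvgD.
Qed.

Lemma ccvgM (z_ w_ : nat -> R[i]) z w :
  ccvg z_ z -> ccvg w_ w -> ccvg (fun n => z_ n * w_ n) (z * w).
Proof.
move=> [a b] [c d]; split; [rewrite cReM; under eq_cvg do rewrite cReM
 | rewrite cImM; under eq_cvg do rewrite cImM].
  by apply: cvgB; apply: cvgM.
by apply: cvgD; apply: cvgM.
Qed.

Lemma ccvg_cst (z : R[i]) : ccvg (fun=> z) z.
Proof. by split; exact: cvg_cst. Qed.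

Lemma ccvgB (z_ w_ : nat -> R[i]) z w :
  ccvg z_ z -> ccvg w_ w -> ccvg (fun n => z_ n - w_ n) (z - w).
Proof.
move=> a [c d]; apply: ccvgD => //.
split; [rewrite cReN; under eq_cvg do rewrite cReN
 | rewrite cImN; under eq_cvg do rewrite cImN]; exact: cvgN.
Qed.

Lemma ccvg_real (a : nat -> R) (l : R) :
  a n @[n --> \oo] --> l -> ccvg (fun n => (a n)%:C) l%:C.
Proof. by move=> h; split => //; exact: cvg_cst. Qed.

Lemma ccvg_normc2 (z_ : nat -> R[i]) z :
  ccvg z_ z -> normc2 (z_ n) @[n --> \oo] --> normc2 z.
Proof. by move=> [a b]; apply: cvgD; apply: cvgM. Qed.

Lemma ccvg_unique (z_ : nat -> R[i]) z w : ccvg z_ z -> ccvg z_ w -> z = w.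
Proof.
move=> [a b] [c d]; apply: complexP.
  exact: (cvg_unique _ a c).
exact: (cvg_unique _ b d).
Qed.

Lemma ccvg_n2_0 (z_ : nat -> R[i]) z :
  normc2 (z_ n - z) @[n --> \oo] --> 0 -> ccvg z_ z.
Proof.
move=> h.
have hs : Num.sqrt (normc2 (z_ n - z)) @[n --> \oo] --> 0.
  rewrite -[X in _ --> X]sqrtr0; apply: continuous_cvg h; exact: sqrt_continuous.
split; apply/cvgrPdist_le => e e0; move/cvgrPdist_le : hs => /(_ e e0);
  apply: filterS => n; rewrite sub0r normrN ger0_norm ?sqrtr_ge0 // => hn;
  rewrite distrC; apply: le_trans hn.
  by have := absRe_le (z_ n - z); rewrite cReD cReN.
by have := absIm_le (z_ n - z); rewrite cImD cImN.
Qed.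

Lemma fatou_n2 (u_ : nat -> Cfun R) u (C : R) :
  (forall n, L2 (u_ n)) -> cmeas u ->
  {ae mu, forall x, normc2 (u_ n x) @[n --> \oo] --> normc2 (u x)} ->
  (forall n, n2 (u_ n) <= C) -> L2 u /\ n2 u <= C.
Proof.
move=> Lu cu cv hC.
have [] := @fatou_real R (fun n x => normc2 (u_ n x)) (fun x => normc2 (u x)) C.
- by move=> n; exact: L2_integr.
- by move=> n x; exact: normc2_ge0.
- exact: meas_normc2.
- by move=> x; exact: normc2_ge0.
- exact: cv.
- exact: hC.
by move=> a b; split => //; apply/L2P.
Qed.

Lemma fast_subseq (P : nat -> nat -> Prop) :
  (forall k, exists N, forall m, (N <= m)%N -> P k m) ->
  exists phi : nat -> nat, forall k m, (phi k <= m)%N -> P k m /\ (k <= m)%N.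
Proof.
move=> /choice[N hN]; exists (fun k => maxn k (N k)) => k m.
by rewrite geq_max => /andP[a b]; split => //; exact: hN.
Qed.

(** Along a subsequence with norms at most 2^-k, the functions 2^k |u_ (phi
    k)|^2 are summable in L^1, so they are bounded at almost every point,
    where u_ (phi k) then tends to 0. *)
Lemma cvg_subseq_ae (u_ : nat -> Cfun R) :
  (forall n, L2 (u_ n)) -> nrm (u_ n) @[n --> \oo] --> 0 ->
  exists2 phi : nat -> nat, (forall k, (k <= phi k)%N) &
    {ae mu, forall x, ccvg (fun k => u_ (phi k) x) 0}.
Proof.
move=> Lu cu.
have [phi hphi] : exists phi : nat -> nat, forall k m, (phi k <= m)%N ->
    n2 (u_ m) <= (2^-1) ^+ k * (2^-1) ^+ k /\ (k <= m)%N.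
  apply: (@fast_subseq (fun k m => n2 (u_ m) <= (2^-1) ^+ k * (2^-1) ^+ k)) => k.
  have e0 : 0 < (2^-1 : R) ^+ k by rewrite exprn_gt0 // invr_gt0.
  move/cvgrPdist_le : cu => /(_ _ e0) [N _ hN]; exists N => m /hN.
  rewrite sub0r normrN ger0_norm ?nrm_ge0 // => h.
  by rewrite -nrm_sqr expr2 ler_pM ?nrm_ge0.
exists phi; first by move=> k; have [] := hphi k _ (leqnn _).
pose f k x := 2 ^+ k * normc2 (u_ (phi k) x).
have : {ae mu, forall x, exists C, forall k, f k x <= C}.
  apply: bounded_of_summable.
  - move=> k; apply: measurable_funM; first exact: measurable_cst.
    by apply: meas_normc2; exact: L2_cmeas.
  - by move=> k x; rewrite mulr_ge0 ?exprn_ge0 ?normc2_ge0.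
  move=> k; have Lk := L2_integr (Lu (phi k)).
  rewrite RintE; last exact: integrZ.
  rewrite lee_fin RintZ // -/(n2 _).
  have [h _] := hphi k _ (leqnn _).
  apply: (@le_trans _ _ (2 ^+ k * ((2^-1) ^+ k * (2^-1) ^+ k))).
    by rewrite ler_pM2l // exprn_gt0.
  by rewrite mulrA -exprMn divff // expr1n mul1r.
apply: aeS => x [C hC]; apply: ccvg_n2_0.
apply: (@geom_cvg0 _ C) => n; rewrite subr0 ger0_norm ?normc2_ge0 //.
rewrite exprVn ler_pdivlMr ?exprn_gt0 // mulrC; exact: hC.
Qed.

(** The Riesz-Fischer argument: a subsequence whose increments have norm at
    most 4^-k has increments at most C 2^-k at almost every point, hence
    converges there; by Fatou's lemma the limit is close to every u_ n with n
    large, so it is in L^2 and the whole sequence tends to it. *)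
Lemma L2_complete (u_ : nat -> Cfun R) :
  (forall n, L2 (u_ n)) ->
  (forall e, 0 < e -> exists N, forall m n, (N <= m)%N -> (N <= n)%N ->
     nrm (u_ m - u_ n) <= e) ->
  exists2 u, L2 u & nrm (u_ n - u) @[n --> \oo] --> 0.
Proof.
move=> Lu cau.
have [psi hpsi] : exists psi : nat -> nat, forall k m, (psi k <= m)%N ->
    (forall n, (psi k <= n)%N -> nrm (u_ m - u_ n) <= (2^-1) ^+ k * (2^-1) ^+ k) /\ (k <= m)%N.
  have : forall k, exists N, forall m n, (N <= m)%N -> (N <= n)%N ->
      nrm (u_ m - u_ n) <= (2^-1) ^+ k * (2^-1) ^+ k.
    by move=> k; apply: cau; rewrite mulr_gt0 // exprn_gt0 // invr_gt0.
  move=> /choice[N hN]; exists (fun k => maxn k (N k)) => k m.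
  rewrite geq_max => /andP[a b]; split => // n; rewrite geq_max => /andP[c d].
  exact: hN.
(* Partial sums make the choice monotone: psi k <= phi j for k <= j. *)
pose phi k := (\sum_(i < k.+1) psi i)%N.
have psiphi k j : (k <= j)%N -> (psi k <= phi j)%N.
  move=> kj; have hk : (k < j.+1)%N by [].
  by rewrite /phi (bigD1 (Ordinal hk)) //= leq_addr.
have kphi k : (k <= phi k)%N by have [] := hpsi k _ (psiphi k k (leqnn k)).
pose d k := u_ (phi k.+1) - u_ (phi k).
have Ld k : L2 (d k) by exact: L2B.
have nd k : nrm (d k) <= (2^-1) ^+ k * (2^-1) ^+ k.
  have [h _] := hpsi k _ (psiphi k k.+1 (leqnSn k)).
  exact: h (psiphi k k (leqnn k)).
have : {ae mu, forall x, exists C, forall k, (2 ^+ k) ^+ 2 * normc2 (d k x) <= C}.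
  apply: bounded_of_summable.
  - move=> k; apply: measurable_funM; first exact: measurable_cst.
    by apply: meas_normc2; exact: L2_cmeas.
  - by move=> k x; rewrite mulr_ge0 ?exprn_ge0 ?normc2_ge0.
  move=> k; have Lk := L2_integr (Ld k).
  rewrite RintE; last exact: integrZ.
  rewrite lee_fin RintZ // -/(n2 _) -nrm_sqr -exprMn.
  have p : 0 < (2^-1 : R) ^+ k by rewrite exprn_gt0 // invr_gt0.
  have p1 : (2^-1 : R) ^+ k <= 1 by rewrite exprn_ile1 // invf_le1 // ler1n.
  have h : 2 ^+ k * nrm (d k) <= (2^-1) ^+ k.
    apply: (@le_trans _ _ (2 ^+ k * ((2^-1) ^+ k * (2^-1) ^+ k))).
      by rewrite ler_pM2l // exprn_gt0.
    by rewrite mulrA -exprMn divff // expr1n mul1r.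
  have q : 0 <= 2 ^+ k * nrm (d k) by rewrite mulr_ge0 ?nrm_ge0 // exprn_ge0.
  rewrite expr2; apply: le_trans (_ : (2^-1) ^+ k * 1 <= _); last by rewrite mulr1.
  by apply: ler_pM => //; exact: le_trans p1.
move=> bd.
pose u := climsup (fun k => u_ (phi k)).
have cu : cmeas u by apply: cmeas_climsup => n; exact: L2_cmeas.
have cv : {ae mu, forall x, ccvg (fun k => u_ (phi k) x) (u x)}.
  apply: aeS bd => x [C hC].
  have key k : Num.sqrt (normc2 (d k x)) <= Num.sqrt C * (2^-1) ^+ k.
    rewrite exprVn ler_pdivlMr ?exprn_gt0 //.
    rewrite -[X in _ * X]ger0_norm ?exprn_ge0 // -sqrtr_sqr -sqrtrM ?normc2_ge0 //.
    by rewrite mulrC; apply: ler_wsqrtr; exact: hC.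
  have cr : cvgn (fun k => Re (u_ (phi k) x)).
    apply: (@geom_cauchy _ (Num.sqrt C)) => k; apply: le_trans (key k).
    by have := absRe_le (d k x); rewrite cReD cReN.
  have ci : cvgn (fun k => Im (u_ (phi k) x)).
    apply: (@geom_cauchy _ (Num.sqrt C)) => k; apply: le_trans (key k).
    by have := absIm_le (d k x); rewrite cImD cImN.
  split.
    rewrite [X in _ --> X](_ : _ = limn (fun k => Re (u_ (phi k) x))); first exact: cr.
    exact: fine_limn_esup.
  rewrite [X in _ --> X](_ : _ = limn (fun k => Im (u_ (phi k) x))); first exact: ci.
  exact: fine_limn_esup.
have fin e : 0 < e -> exists N, forall n, (N <= n)%N -> L2 (u - u_ n) /\ nrm (u - u_ n) <= e.
  move=> e0; have [N hN] := cau e e0; exists N => n Nn.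
  have [] := @fatou_n2 (fun k => u_ (phi (k + N)%N) - u_ n) (u - u_ n) (e ^+ 2).
  - by move=> k; exact: L2B.
  - by apply: cmeasB => //; exact: L2_cmeas.
  - apply: aeS cv => x [c1 c2]; apply: ccvg_normc2; apply: ccvgB; last exact: ccvg_cst.
    by split; [apply: (cvg_comp _ _ (cvg_addnr N) c1)|apply: (cvg_comp _ _ (cvg_addnr N) c2)].
  - move=> k; rewrite -nrm_sqr ler_pXn2r ?nnegrE ?nrm_ge0 //; last exact: ltW.
    apply: hN => //; apply: leq_trans (kphi _); exact: leq_addl.
  move=> L h; split => //.
  by rewrite -(@ler_pXn2r _ 2) ?nnegrE ?nrm_sqr ?nrm_ge0 //; exact: ltW.
have Lu' : L2 u.
  have [N hN] := fin 1 ltr01; have [h _] := hN N (leqnn N).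
  by rewrite -(subrK (u_ N) u); exact: L2D.
exists u => //; apply/cvgrPdist_le => e e0; have [N hN] := fin e e0; exists N => // n /= Nn.
by rewrite sub0r normrN ger0_norm ?nrm_ge0 // nrmBC; have [] := hN n Nn.
Qed.

End Completeness.

(** * Translations and reflections *)

Section ChangeOfVariable.
Variable R : realType.
Local Notation mu := (@lebesgue_measure R).

(** Lebesgue measure is a times its own push-forward under x |-> a x + b: by
    uniqueness this need only be checked on intervals. *)
Lemma ge0_integral_affine (a b : R) (f : R -> \bar R) : 0 < a ->
  measurable_fun setT f -> (forall x, 0 <= f x)%E ->
  (\int[mu]_x f x = a%:E * \int[mu]_x f (a * x + b)%R)%E.
Proof.
move=> a0 mf f0.
pose phi : measurableTypeR R -> measurableTypeR R := fun x => a * x + b.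
have mphi : measurable_fun setT phi.
  by apply: measurable_funD => //; exact: mulrl_measurable.
pose phi' : {mfun measurableTypeR R >-> measurableTypeR R} :=
  MeasurableFun.Pack (MeasurableFun.Class (isMeasurableFun.Build _ _ _ _ phi mphi)).
pose k : {nonneg R} := NngNum (ltW a0).
have muE A : measurable A -> mu A = mscale k (pushforward mu phi') A.
  apply: lebesgue_measure_unique => _ [[c d] _ <-].
  rewrite -[RHS]/(a%:E * mu (phi @^-1` `]c, d]%classic))%E.
  rewrite (_ : phi @^-1` _ = `](c - b) / a, (d - b) / a]%classic); last first.
    apply/seteqP; split=> x /=; rewrite !in_itv /= /phi
      ltr_pdivrMr // ler_pdivlMr // ltrBlDr lerBrDr mulrC //.
  rewrite !lebesgue_measure_itv /= !lte_fin ltr_pM2r ?invr_gt0 // ltrD2r.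
  case: ifPn => _; last by rewrite mule0.
  by rewrite -!EFinD -EFinM; congr EFin; field; rewrite gt_eqF.
have E : (\int[mu]_x f x = \int[mscale k (pushforward mu phi')]_x f x)%E.
  by move=> m; apply: eq_measure_integral => A mA _; exact: (muE m A mA).
by rewrite (E mphi) ge0_integral_mscale //= ge0_integral_pushforward.
Qed.

Lemma ge0_integral_oppr (f : R -> \bar R) :
  measurable_fun setT f -> (forall x, 0 <= f x)%E ->
  (\int[mu]_x f x = \int[mu]_x f (- x)%R)%E.
Proof.
move=> mf f0.
rewrite -[RHS](@ge0_integral_pushforward _ _ _ _ R (-%R : measurableTypeR R -> measurableTypeR R) _ mu setT f) //.
by apply: eq_measure_integral => A mA _; exact/esym/lebesgue_measureN.
Qed.

Section Transfer.
(* A substitution rule for nonnegative functions extends to an integrable f,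
   which is the difference of f + |f| and |f|. *)
Variables (phi : R -> R) (c : R).
Hypothesis c0 : 0 < c.
Hypothesis mphi : forall f : R -> R, meas f -> meas (f \o phi).
Hypothesis H : forall f : R -> \bar R, measurable_fun setT f ->
  (forall x, 0 <= f x)%E -> (\int[mu]_x f x = c%:E * \int[mu]_x f (phi x))%E.

Lemma integr_transfer f : integr f -> integr (f \o phi).
Proof.
move=> fi; apply/integrableP; split.
  by apply: meas_EFin; apply: mphi; exact: integr_meas.
have h := integr_fin (integr_norm fi).
move: h; rewrite (H _ _) //; last by apply: meas_EFin; exact: integr_meas (integr_norm fi).
move=> h; rewrite ltey; apply/eqP => h'; move: h.
rewrite (_ : (\int[mu]_x _ = +oo)%E); last by rewrite -h'.
by rewrite gt0_muley ?lte_fin // ltxx.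
Qed.

Lemma Rint_transfer f : integr f -> \int[mu]_x f x = c * \int[mu]_x f (phi x).
Proof.
have pos g : integr g -> (forall x, 0 <= g x) ->
    \int[mu]_x g x = c * \int[mu]_x g (phi x).
  move=> ig g0; apply: EFin_inj; rewrite -RintE // EFinM -RintE.
    by apply: H => //; apply: meas_EFin; exact: integr_meas.
  exact: integr_transfer.
move=> fi; have ni := integr_norm fi; have si := integrD fi ni.
have -> : \int[mu]_x f x = \int[mu]_x (f x + `|f x|) - \int[mu]_x `|f x|.
  by rewrite RintD // addrK.
rewrite (pos _ si) => [|x]; last first.
  by rewrite -lerBlDl sub0r -normrN ler_norm.
rewrite (pos _ ni) // -mulrBr RintD; last 2 first.
  exact: integr_transfer fi.
  exact: integr_transfer ni.
by rewrite addrK.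
Qed.

Lemma cmeas_transfer (u : Cfun R) : cmeas u -> cmeas (fun x => u (phi x)).
Proof. by move=> [a b]; split; [exact: (mphi a)|exact: (mphi b)]. Qed.

Lemma L2_transfer (u : Cfun R) : L2 u -> L2 (fun x => u (phi x)).
Proof.
move=> /L2P[a b]; apply/L2P; split; first exact: cmeas_transfer.
exact: integr_transfer b.
Qed.

Lemma n2_transfer (u : Cfun R) : L2 u -> n2 u = c * n2 (fun x => u (phi x)).
Proof. by move=> Lu; apply: Rint_transfer; exact: L2_integr. Qed.

End Transfer.

Lemma meas_affine (a b : R) f : meas f -> meas (fun x => f (a * x + b)).
Proof.
move=> mf; apply: (measurableT_comp mf).
by apply: measurable_funD => //; exact: mulrl_measurable.
Qed.

Lemma Rint_affine (a b : R) f : 0 < a -> integr f ->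
  \int[mu]_x f x = a * \int[mu]_x f (a * x + b).
Proof.
move=> a0; apply: Rint_transfer => //.
- by move=> g; exact: meas_affine.
- by move=> g mg g0; exact: ge0_integral_affine.
Qed.

Lemma integr_affine (a b : R) f : 0 < a -> integr f ->
  integr (fun x => f (a * x + b)).
Proof.
move=> a0; apply: (@integr_transfer (fun x => a * x + b) a) => //.
- by move=> g; exact: meas_affine.
- by move=> g mg g0; exact: ge0_integral_affine.
Qed.

Definition tau (h : R) (u : Cfun R) : Cfun R := fun x => u (x + h).
Definition refl (u : Cfun R) : Cfun R := fun x => u (- x).

Let shiftH h (f : R -> \bar R) : measurable_fun setT f ->
  (forall x, 0 <= f x)%E -> (\int[mu]_x f x = 1%:E * \int[mu]_x f (x + h)%R)%E.
Proof.
move=> mf f0; rewrite (@ge0_integral_affine 1 h) //.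
by under eq_integral do rewrite mul1r.
Qed.

Let shiftm h (f : R -> R) : meas f -> meas (f \o (fun x => x + h)).
Proof.
move=> /(@meas_affine 1 h); rewrite (_ : (fun x => f (1 * x + h)) = f \o (+%R^~ h)) //.
by apply/funext => x /=; rewrite mul1r.
Qed.

Lemma cmeas_tau h u : cmeas u -> cmeas (tau h u).
Proof. by apply: cmeas_transfer; exact: shiftm. Qed.

Lemma L2_tau h u : L2 u -> L2 (tau h u).
Proof. by apply: L2_transfer; [exact: ltr01|exact: shiftm|exact: shiftH]. Qed.

Lemma n2_tau h u : L2 u -> n2 (tau h u) = n2 u.
Proof.
move=> Lu; rewrite (@n2_transfer (+%R^~ h) 1 _ _ _ u) ?mul1r //;
  by [exact: shiftm|exact: shiftH].
Qed.

Lemma integr_shift h (f : R -> R) : integr f -> integr (fun x => f (x + h)).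
Proof.
by apply: (@integr_transfer (+%R^~ h) 1); [exact: ltr01|exact: shiftm|exact: shiftH].
Qed.

Lemma Rint_shift h f : integr f -> \int[mu]_x f (x + h) = \int[mu]_x f x.
Proof.
move=> fi; rewrite [RHS](@Rint_transfer (+%R^~ h) 1 _ _ _ f) ?mul1r //;
  by [exact: shiftm|exact: shiftH].
Qed.

Let reflH (f : R -> \bar R) : measurable_fun setT f ->
  (forall x, 0 <= f x)%E -> (\int[mu]_x f x = 1%:E * \int[mu]_x f (- x)%R)%E.
Proof. by move=> mf f0; rewrite mul1e ge0_integral_oppr. Qed.

Let reflm (f : R -> R) : meas f -> meas (f \o -%R).
Proof. by move=> mf; apply: (measurableT_comp mf); exact: oppr_measurable. Qed.

Lemma cmeas_refl u : cmeas u -> cmeas (refl u).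
Proof. by apply: cmeas_transfer; exact: reflm. Qed.

Lemma L2_refl u : L2 u -> L2 (refl u).
Proof. by apply: L2_transfer; [exact: ltr01|exact: reflm|exact: reflH]. Qed.

Lemma n2_refl u : L2 u -> n2 (refl u) = n2 u.
Proof.
move=> Lu; rewrite (@n2_transfer -%R 1 _ _ _ u) ?mul1r //;
  by [exact: reflm|exact: reflH].
Qed.

Lemma Rint_opp f : integr f -> \int[mu]_x f (- x) = \int[mu]_x f x.
Proof.
move=> fi; rewrite [RHS](@Rint_transfer -%R 1 _ _ _ f) ?mul1r //;
  by [exact: reflm|exact: reflH].
Qed.

End ChangeOfVariable.

Section DominatedConvergence.
Variable R : realType.
Local Notation mu := (@lebesgue_measure R).

Lemma dominated_cvg (f_ : nat -> R -> R) (f g : R -> R) :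
  (forall n, meas (f_ n)) -> meas f -> integr g ->
  {ae mu, forall x, f_ n x @[n --> \oo] --> f x} ->
  (forall n x, `|f_ n x| <= g x) ->
  integr f /\ \int[mu]_x f_ n x @[n --> \oo] --> \int[mu]_x f x.
Proof.
move=> mf_ mf gi cf fg.
have [] := @dominated_convergence _ _ _ mu setT measurableT
  (fun n => EFin \o f_ n) (EFin \o f) (EFin \o g).
- by move=> n; exact: meas_EFin.
- exact: meas_EFin.
- by apply: aeS cf => x h _; apply: cvg_EFin => //; exact: nearW.
- exact: gi.
- by apply: aeW => x n _; rewrite /= lee_fin.
move=> fi _ h; split => //.
by apply: fine_cvg; rewrite -RintE.
Qed.

(** The form of dominated convergence that is used for cut-offs, for
    translations and for symbols. *)
Lemma dominated_cvgL2_0 (u_ : nat -> Cfun R) (g : R -> R) :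
  (forall n, cmeas (u_ n)) -> integr g ->
  {ae mu, forall x, ccvg (fun n => u_ n x) 0} ->
  (forall n x, normc2 (u_ n x) <= g x) ->
  nrm (u_ n) @[n --> \oo] --> 0.
Proof.
move=> cu gi cv ug.
have cv2 : {ae mu, forall x, normc2 (u_ n x) @[n --> \oo] --> 0}.
  by apply: aeS cv => x /ccvg_normc2; rewrite normc2_0.
have [||n x|_] := @dominated_cvg (fun n x => normc2 (u_ n x)) (fun=> 0) g _ _ gi cv2 _.
- by move=> n; exact: meas_normc2.
- exact: measurable_cst.
- by rewrite ger0_norm ?normc2_ge0.
rewrite (_ : \int[mu]_x 0 = 0); last by rewrite /Rintegral integral0.
move=> h; rewrite -[X in _ --> X]sqrtr0.
by apply: continuous_cvg h; exact: sqrt_continuous.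
Qed.

End DominatedConvergence.

(** * Continuity of translations in L^2 *)

Section TranslationContinuity.
Variable R : realType.
Local Notation mu := (@lebesgue_measure R).

Definition tau_cont (u : Cfun R) := forall e : R, 0 < e ->
  exists2 d : R, 0 < d & forall h : R, `|h| < d -> nrm (tau h u - u) <= e.

Lemma tauB h (u v : Cfun R) : tau h (u - v) = tau h u - tau h v.
Proof. by []. Qed.

Lemma nrm_tau h (u : Cfun R) : L2 u -> nrm (tau h u) = nrm u.
Proof. by move=> Lu; rewrite /nrm n2_tau. Qed.

(** The e / 3 argument, translations being isometries. *)
Lemma tau_cont_closed (u : Cfun R) : L2 u ->
  (forall e, 0 < e -> exists v, [/\ L2 v, tau_cont v & nrm (u - v) <= e]) ->
  tau_cont u.
Proof.
move=> Lu H e e0; have e3 : 0 < e / 3 by rewrite divr_gt0.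
have [v [Lv cv uv]] := H _ e3; have [d d0 hd] := cv _ e3.
exists d => // h hh.
have L1 := L2_tau h Lu; have L2' := L2_tau h Lv.
have h1 := nrm_tri L1 Lu L2'; have h2 := nrm_tri L2' Lu Lv.
have h3 := hd h hh.
have h4 : nrm (tau h u - tau h v) <= e / 3 by rewrite -tauB nrm_tau //; exact: L2B.
rewrite nrmBC in uv.
lra.
Qed.

Lemma tau_contD (u v : Cfun R) : L2 u -> L2 v -> tau_cont u -> tau_cont v ->
  tau_cont (u + v).
Proof.
move=> Lu Lv cu cv e e0; have e3 : 0 < e / 2 by rewrite divr_gt0.
have [d d0 hd] := cu _ e3; have [d' d'0 hd'] := cv _ e3.
exists (Num.min d d'); first by rewrite lt_min d0.
move=> h; rewrite lt_min => /andP[a b].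
rewrite (_ : tau h (u + v) - (u + v) = (tau h u - u) + (tau h v - v)); last first.
  by rewrite opprD addrACA.
have L1 := L2B (L2_tau h Lu) Lu; have L2' := L2B (L2_tau h Lv) Lv.
have := nrmD_le L1 L2'; have := hd _ a; have := hd' _ b; lra.
Qed.

Lemma tau_contZ z (u : Cfun R) : L2 u -> tau_cont u -> tau_cont (z *: u).
Proof.
move=> Lu cu e e0.
have p : 0 < Num.sqrt (normc2 z) + 1 by rewrite ltr_wpDl // sqrtr_ge0.
have [d d0 hd] := cu (e / (Num.sqrt (normc2 z) + 1)) (divr_gt0 e0 p).
exists d => // h hh.
rewrite (_ : tau h (z *: u) - z *: u = z *: (tau h u - u)); last by rewrite scalerBr.
rewrite nrmZ; last by apply: L2B => //; exact: L2_tau.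
have := hd h hh; rewrite ler_pdivlMr //.
have := nrm_ge0 (tau h u - u); have := sqrtr_ge0 (normc2 z); nra.
Qed.

Lemma integr_indic (a b c : R) : integr (fun x => c * \1_(`[a, b]%classic) x).
Proof.
apply: integrZ; apply/integrableP; split.
  by apply: meas_EFin; exact: measurable_indic.
under eq_integral do rewrite /= ger0_norm //.
by rewrite integral_indic //= setIT lebesgue_measure_itv /=; case: ifP => _; rewrite -?EFinD ltry.
Qed.

(** If continuity at 0 failed, there would be steps h n tending to 0 along
    which the norm stays above e; but the integrands tend to 0 pointwise, and
    for |h n| <= 1 they are dominated by a multiple of the indicator of [-N -
    1, N + 1]. *)
Lemma tau_cont_cc (w : R -> R) (N M : R) : continuous w ->
  (forall x, `|w x| <= M) -> (forall x, N < `|x| -> w x = 0) ->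
  L2 (fun x => (w x)%:C : R[i]^o) /\ tau_cont (fun x => (w x)%:C).
Proof.
move=> cw wM wN; have mw : meas w by exact: continuous_measurable_fun.
have cmw : cmeas (fun x => (w x)%:C : R[i]^o) by exact: cmeas_real.
have M2 x : w x ^+ 2 <= M ^+ 2.
  by rewrite -real_normK ?num_real // lerXn2r ?nnegrE ?normr_ge0 // (le_trans _ (wM 0)).
have Lw : L2 (fun x => (w x)%:C : R[i]^o).
  apply/L2P; split => //; apply: (integr_le (meas_normc2 cmw) (integr_indic (- N) N (M ^+ 2))) => x.
  rewrite ger0_norm ?normc2_ge0 // normc2_real indicE.
  case: (boolP (x \in _)) => xN; first by rewrite mulr1.
  rewrite wN ?expr0n ?mulr0 // ltNge; apply: contra xN => xN.
  by rewrite inE /= in_itv /= -ler_norml.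
split=> //; apply: contrapT => /existsNP[e /not_implyP[e0 /forall2NP H]].
have {H}/choice[h hh] : forall n : nat, exists h : R, `|h| < n.+1%:R^-1 /\
    e < nrm (tau h (fun x => (w x)%:C : R[i]^o) - (fun x => (w x)%:C)).
  move=> n; have [] := H n.+1%:R^-1; first by rewrite invr_gt0.
  by move=> /existsNP[h /not_implyP[a /negP]]; rewrite -ltNge => b; exists h.
have h0 : h n @[n --> \oo] --> 0.
  apply/cvgrPdist_lt => d d0; near=> n; rewrite sub0r normrN.
  have [a _] := hh n; apply: lt_trans a _; near: n.
  exact: near_infty_natSinv_lt (PosNum d0).
have : nrm (tau (h n) (fun x => (w x)%:C : R[i]^o) - (fun x => (w x)%:C)) @[n --> \oo] --> 0.
  apply: (@dominated_cvgL2_0 _ _ _ _ (integr_indic (- (N + 1)) (N + 1) (4 * M ^+ 2))).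
  - by move=> n; apply: cmeasB => //; exact: cmeas_tau.
  - apply: aeW => x; rewrite -[X in ccvg _ X](subrr (w x)%:C).
    apply: ccvgB; last exact: ccvg_cst.
    apply: ccvg_real; apply: (@cvg_comp _ _ _ (fun n => x + h n) w _ (nbhs x)); last exact: cw.
    have c : x + h n @[n --> \oo] --> x + 0 by apply: cvgD => //; exact: cvg_cst.
    by rewrite addr0 in c; exact: c.
  move=> n x; rewrite -[(_ - _) x]/((w (x + h n))%:C - (w x)%:C) -rmorphB normc2_real indicE.
  have [hn _] := hh n; have hn1 : `|h n| <= 1.
    by apply: (le_trans (ltW hn)); rewrite invf_le1 // ler1n.
  case: (boolP (x \in _)) => xN.
    rewrite mulr1; have := M2 (x + h n); have := M2 x; have := sqr_ge0 (w (x + h n) + w x); nra.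
  have xN' : N + 1 < `|x|.
    rewrite ltNge; apply: contra xN => xN.
    by rewrite inE /= in_itv /= -ler_norml.
  rewrite !wN ?subrr ?expr0n ?mulr0 //; first by lra.
  have := ler_normB (x + h n) (h n); rewrite addrK; lra.
move/cvgrPdist_lt => /(_ _ e0)[n _ /(_ n (leqnn n))].
rewrite sub0r normrN ger0_norm ?nrm_ge0 //; have [_ +] := hh n; lra.
Unshelve. all: by end_near. Qed.

End TranslationContinuity.

Section TranslationContinuityL2.
Variable R : realType.
Local Notation mu := (@lebesgue_measure R).

Let cont_max (f g : R -> R) : continuous f -> continuous g ->
  continuous (fun x => Num.max (f x) (g x)).
Proof. by move=> cf cg x; exact: (@continuous_max R R f g x (cf x) (cg x)). Qed.

Let cont_min (f g : R -> R) : continuous f -> continuous g ->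
  continuous (fun x => Num.min (f x) (g x)).
Proof. by move=> cf cg x; exact: (@continuous_min R R f g x (cf x) (cg x)). Qed.

Let clip (M y : R) : R := Num.max (- M) (Num.min M y).

Let clip_le M y : 0 <= M -> `|clip M y| <= M.
Proof.
move=> M0; rewrite /clip ler_norml.
by case: (ltP M y) => h1; case: (ltP (- M)) => h2; apply/andP; split; lra.
Qed.

Let clip_dist M y z : `|z| <= M -> `|z - clip M y| <= `|z - y|.
Proof.
rewrite ler_norml => /andP[a b]; rewrite /clip.
case: (ltP M y) => h1; case: (ltP (- M)) => h2.
- by rewrite !ler0_norm; lra.
- have -> : z = 0 by lra.
  have -> : M = 0 by lra.
  by rewrite oppr0 subrr normr0 normr_ge0.
- by [].
- by rewrite !ger0_norm; lra.
Qed.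

Let ramp (N x : R) : R := Num.max 0 (Num.min 1 (N + 1 - `|x|)).

Let ramp01 N x : 0 <= ramp N x <= 1.
Proof.
by rewrite /ramp le_max lexx ge_max ler01 ge_min lexx.
Qed.

Let ramp1 N x : `|x| <= N -> ramp N x = 1.
Proof.
move=> h; rewrite /ramp; case: (ltP 1 _) => h1; case: (ltP 0 _) => h2; lra.
Qed.

Let ramp0 N x : N + 1 < `|x| -> ramp N x = 0.
Proof.
move=> h; rewrite /ramp; case: (ltP 1 _) => h1; case: (ltP 0 _) => h2; lra.
Qed.

Let continuous_ramp N : continuous (ramp N).
Proof.
apply: cont_max; first by move=> x; exact: cvg_cst.
apply: cont_min; first by move=> x; exact: cvg_cst.
by move=> x; apply: cvgB; [exact: cvg_cst|exact: norm_continuous].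
Qed.

(** On [-N - 1, N + 1] the function is approximated in L^1 by continuous
    functions g_ n. Cutting one of these off outside [-N - 1, N + 1] and
    clipping it to [-M, M] gives a function w that is no farther from f, and
    turns L^1 closeness into L^2 closeness, since |f - w|^2 <= 2 M |f - w|. *)
Lemma tau_cont_bounded (f : R -> R) (N M : R) : meas f -> 0 <= N ->
  (forall x, `|f x| <= M) -> (forall x, N < `|x| -> f x = 0) ->
  L2 (fun x => (f x)%:C : R[i]^o) /\ tau_cont (fun x => (f x)%:C).
Proof.
move=> mf N0 fM fN; have M0 : 0 <= M by exact: le_trans (fM 0).
set u : Cfun R := fun x => (f x)%:C.
have cu : cmeas u by exact: cmeas_real.
pose E := `[- (N + 1), N + 1]%classic : set R.
have inE_ x : (x \in E) = (`|x| <= N + 1) by rewrite /E mem_setE in_itv /= ler_norml.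
have iM := integr_indic (- (N + 1)) (N + 1).
have Lu : L2 u.
  apply/L2P; split => //; apply: (integr_le (meas_normc2 cu) (iM (M ^+ 2))) => x.
  rewrite ger0_norm ?normc2_ge0 // normc2_real indicE inE_.
  case: (leP `|x|) => xN; rewrite ?mulr1 ?mulr0.
    by rewrite -real_normK ?num_real // lerXn2r ?nnegrE ?normr_ge0.
  by rewrite fN ?expr0n //; lra.
split => //; apply: tau_cont_closed => // e e0.
have mE : measurable E by exact: measurable_itv.
have muE : (mu E < +oo)%E.
  by rewrite lebesgue_measure_itv /=; case: ifP => _; rewrite -?EFinD ltry.
have fi : mu.-integrable E (EFin \o f).
  have := integr_le mf (iM M); move=> /(_ _)/integrableS; apply => //.
  move=> x; rewrite indicE inE_; case: (leP `|x|) => xN; rewrite ?mulr1 ?mulr0 //.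
  by rewrite fN ?normr0 //; lra.
have [g_ [cg gi gcv]] := approximation_continuous_integrable mE muE fi.
have d0 : 0 < e ^+ 2 / (2 * M + 1) by rewrite divr_gt0 ?exprn_gt0 //; lra.
have [n hn] : exists n, (\int[mu]_(x in E) `|(f x - g_ n x)%:E| <= (e ^+ 2 / (2 * M + 1))%:E)%E.
  move/fine_cvgP: gcv => [[n1 _ fin1]] /cvgrPdist_le/(_ _ d0)[n2 _ h2].
  exists (maxn n1 n2).
  have := fin1 (maxn n1 n2) (leq_maxl _ _) => /= /fineK <-; rewrite lee_fin.
  by have := h2 (maxn n1 n2) (leq_maxr _ _); rewrite sub0r normrN; apply: le_trans; exact: ler_norm.
pose w x := clip M (ramp N x * g_ n x).
have cw : continuous w.
  apply: cont_max; first by move=> x; exact: cvg_cst.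
  apply: cont_min; first by move=> x; exact: cvg_cst.
  by move=> x; apply: cvgM; [exact: continuous_ramp|exact: cg].
have [Lw tw] : L2 (fun x => (w x)%:C : R[i]^o) /\ tau_cont (fun x => (w x)%:C).
  apply: (@tau_cont_cc _ _ (N + 1) M) => //; first by move=> x; exact: clip_le.
  move=> x xN; rewrite /w ramp0 // mul0r /clip.
  by case: (ltP M 0) => h1; case: (ltP (- M)) => h2; lra.
exists (fun x => (w x)%:C); split => //.
rewrite -(@ler_pXn2r _ 2) ?nnegrE ?nrm_ge0 ?(ltW e0) // nrm_sqr.
have Luw := L2_integr (L2B Lu Lw).
rewrite -lee_fin /n2 -RintE //.
apply: (@le_trans _ _ ((2 * M)%:E * \int[mu]_(x in E) `|(f x - g_ n x)%:E|)%E); last first.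
  apply: (@le_trans _ _ ((2 * M)%:E * (e ^+ 2 / (2 * M + 1))%:E)%E).
    by apply: lee_wpmul2l => //; rewrite lee_fin; lra.
  rewrite -EFinM lee_fin mulrA ler_pdivrMr; last by lra.
  by rewrite mulrC ler_wpM2l ?sqr_ge0 //; lra.
rewrite -ge0_integralZl //; last 2 first.
- apply: measurableT_comp => //; apply/measurable_EFinP; apply: measurable_funB.
    exact: measurable_funTS.
  by apply: measurable_funTS; exact: continuous_measurable_fun.
- by rewrite lee_fin; lra.
rewrite [leRHS]integral_mkcond; apply: ge0_le_integral => //.
- by move=> x _; rewrite lee_fin normc2_ge0.
- by apply: meas_EFin; exact: integr_meas.
- apply/(measurable_restrictT _ mE); apply: measurable_funeM.
  apply: measurableT_comp => //; apply/measurable_EFinP; apply: measurable_funB.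
    exact: measurable_funTS.
  by apply: measurable_funTS; exact: continuous_measurable_fun.
move=> x _; rewrite patchE inE_.
rewrite -[(u - _) x]/((f x)%:C - (w x)%:C) -rmorphB normc2_real.
have key : `|f x - w x| <= `|f x - ramp N x * g_ n x| by exact: clip_dist.
have k2 : `|f x - w x| <= 2 * M.
  by apply: le_trans (ler_normB _ _) _; have := fM x; have := clip_le (ramp N x * g_ n x) M0; rewrite -/(w x); lra.
rewrite -real_normK ?num_real // expr2.
have rf : f x = ramp N x * f x.
  by case: (leP `|x| N) => h; [rewrite ramp1 // mul1r|rewrite fN // mulr0].
rewrite {2}rf -mulrBr normrM in key.
have /andP[r0 r1] := ramp01 N x; rewrite (ger0_norm r0) in key.
case: (leP `|x|) => xN.
  rewrite -EFinM lee_fin; apply: ler_pM => //.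
  by apply: le_trans key _; rewrite ler_piMl ?normr_ge0.
rewrite -[point]/(0%:E : \bar R) lee_fin; rewrite ramp0 // mul0r in key.
have -> : `|f x - w x| = 0 by apply/eqP; rewrite eq_le key normr_ge0.
by rewrite mulr0.
Qed.

(** The truncations of a real function to {|x| <= k, |f x| <= k} tend to it in
    L^2 and satisfy [tau_cont_bounded]. *)
Lemma L2_tau_cont (u : Cfun R) : L2 u -> tau_cont u.
Proof.
have real (f : R -> R) : L2 (fun x => (f x)%:C : R[i]^o) -> tau_cont (fun x => (f x)%:C).
  move=> Lf; have [mf _] := L2_cmeas Lf; rewrite /= in mf.
  apply: tau_cont_closed => // e e0.
  pose A k : set R := [set x | `|x| <= k%:R] `&` [set x | `|f x| <= k%:R].
  have mA k : measurable (A k).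
    apply: measurableI.
      rewrite (_ : [set x | _] = `[- k%:R, k%:R]%classic) //.
      by apply/seteqP; split => x /=; rewrite in_itv /= ler_norml.
    rewrite -[X in measurable X]setTI.
    have := measurable_fun_ler (measurableT_comp (@normr_measurable R setT) mf)
      (@measurable_cst _ _ _ _ setT (k%:R : R)).
    by move=> /(_ measurableT [set true] _); apply.
  pose fk k x : R := f x * \1_(A k) x.
  have mfk k : meas (fk k) by apply: measurable_funM => //; exact: measurable_indic.
  have bfk k x : `|fk k x| <= k%:R.
    rewrite /fk indicE; case: (boolP (x \in _)); rewrite ?mulr0 ?normr0 //.
    by rewrite inE mulr1 => -[].
  have sfk k x : k%:R < `|x| -> fk k x = 0.
    rewrite /fk indicE; case: (boolP (x \in _)); rewrite ?mulr0 //.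
    by rewrite inE => -[/= h _] /(le_lt_trans h); rewrite ltxx.
  have tk k := tau_cont_bounded (mfk k) (ler0n _ k) (bfk k) (sfk k).
  have : nrm ((fun x => (f x)%:C : R[i]^o) - (fun x => (fk k x)%:C)) @[k --> \oo] --> 0.
    apply: (@dominated_cvgL2_0 _ _ _ _ (L2_integr Lf)).
    - by move=> k; apply: cmeasB; [exact: L2_cmeas|exact: cmeas_real].
    - apply: aeW => x; rewrite -[X in ccvg _ X](subrr (f x)%:C).
      apply: ccvgB; first exact: ccvg_cst.
      apply: ccvg_real; apply: cvg_near_cst.
      have [k hk] : exists k : nat, Num.max `|x| `|f x| < k%:R.
        exists (Num.truncn (Num.max `|x| `|f x|)).+1; exact: truncnS_gt.
      exists k => // m /= km; rewrite /fk indicE mem_set ?mulr1 //.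
      move: hk; rewrite gt_max => /andP[h1 h2].
      have kmR : (k%:R : R) <= m%:R by rewrite ler_nat.
      by split => /=; lra.
    move=> k x; rewrite -[(_ - _) x]/((f x)%:C - (fk k x)%:C) -rmorphB !normc2_real /fk indicE.
    by case: (x \in _); rewrite ?mulr1 ?subrr ?expr0n ?sqr_ge0 // mulr0 subr0.
  move/cvgrPdist_le => /(_ _ e0)[k _ /(_ k (leqnn k))].
  rewrite sub0r normrN ger0_norm ?nrm_ge0 // => h.
  by exists (fun x => (fk k x)%:C); have [a b] := tk k.
move=> Lu; have [cr ci] := L2_cmeas Lu.
have Lr : L2 (fun x => (Re (u x))%:C : R[i]^o).
  apply: (L2_dom (K := 1) _ Lu); first exact: cmeas_real.
  by move=> x; rewrite normc2_real mul1r lerDl sqr_ge0.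
have Li : L2 (fun x => (Im (u x))%:C : R[i]^o).
  apply: (L2_dom (K := 1) _ Lu); first exact: cmeas_real.
  by move=> x; rewrite normc2_real mul1r lerDr sqr_ge0.
have -> : u = (fun x => (Re (u x))%:C : R[i]^o) + ('i : R[i]) *: (fun x => (Im (u x))%:C : R[i]^o).
  apply/funext => x; rewrite -[RHS]/((Re (u x))%:C + 'i * (Im (u x))%:C).
  by apply: complexP; rewrite !ReImE /=; ring.
by apply: tau_contD => //; [exact: L2Z|exact: real|apply: tau_contZ => //; exact: real].
Qed.

End TranslationContinuityL2.

(** * Fubini's theorem for bounded kernels *)

Section Fubini.
Variable R : realType.
Local Notation mu := (@lebesgue_measure R).

Definition meas2 (g : R -> R -> R) :=
  measurable_fun setT (fun z : measurableTypeR R * measurableTypeR R => g z.1 z.2).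

Lemma meas2_l f : meas f -> meas2 (fun x _ => f x).
Proof. by move=> mf; apply: (measurableT_comp mf); exact: measurable_fst. Qed.

Lemma meas2_r f : meas f -> meas2 (fun _ y => f y).
Proof. by move=> mf; apply: (measurableT_comp mf); exact: measurable_snd. Qed.

Lemma meas2M g h : meas2 g -> meas2 h -> meas2 (fun x y => g x y * h x y).
Proof. by move=> a b; apply: measurable_funM. Qed.

Lemma meas2D g h : meas2 g -> meas2 h -> meas2 (fun x y => g x y + h x y).
Proof. by move=> a b; apply: measurable_funD. Qed.

Lemma meas2_comp f g : meas f -> meas2 g -> meas2 (fun x y => f (g x y)).
Proof. by move=> a b; apply: (measurableT_comp a). Qed.

Lemma meas2_sec1 g x : meas2 g -> meas (g x).
Proof. by move=> h; apply: (measurableT_comp h (measurable_pair1 x)). Qed.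

Lemma meas2_sec2 g y : meas2 g -> meas (g ^~ y).
Proof. by move=> h; apply: (measurableT_comp h (measurable_pair2 y)). Qed.

Lemma fubini_real (g : R -> R -> R) : meas2 g ->
  (\int[mu]_x \int[mu]_y `|g x y|%:E < +oo)%E ->
  (forall x, integr (g x)) -> (forall y, integr (g ^~ y)) ->
  integr (fun x => \int[mu]_y g x y) /\
  \int[mu]_x \int[mu]_y g x y = \int[mu]_y \int[mu]_x g x y.
Proof.
move=> mg fg g1 g2.
pose G (z : measurableTypeR R * measurableTypeR R) := (g z.1 z.2)%:E.
have mG : measurable_fun setT G by apply/measurable_EFinP; exact: mg.
have iG : (mu \x mu)%E.-integrable setT G by apply/integrable12ltyP.
have e1 x : (\int[mu]_y G (x, y) = (\int[mu]_y g x y)%:E)%E.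
  exact: (RintE (g1 x)).
have e2 y : (\int[mu]_x G (x, y) = (\int[mu]_x g x y)%:E)%E.
  exact: (RintE (g2 y)).
split.
  have := integrable_fubini_F iG; rewrite /fubini_F; under eq_fun do rewrite e1.
  by [].
have := Fubini iG; under eq_integral do rewrite e1.
under [X in _ = X -> _]eq_integral do rewrite e2.
by rewrite /Rintegral => ->.
Qed.

(** The integrand is dominated by B |f x| |w y|, which is integrable on the
    plane as a product. *)
Lemma fubini_kernel (f w : R -> R) (b : R -> R -> R) (B : R) :
  integr f -> integr w -> meas2 b -> (forall x y, `|b x y| <= B) ->
  integr (fun x => f x * \int[mu]_y (w y * b x y)) /\
  \int[mu]_x (f x * \int[mu]_y (w y * b x y)) =
  \int[mu]_y (w y * \int[mu]_x (f x * b x y)).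
Proof.
move=> fi wi mb bB.
have w1 x : integr (fun y => w y * b x y).
  apply: (integr_le _ (integrZ B (integr_norm wi))).
    by apply: measurable_funM; [exact: integr_meas|exact: meas2_sec1].
  by move=> y; rewrite normrM mulrC ler_wpM2r ?normr_ge0.
have f1 y : integr (fun x => f x * b x y).
  apply: (integr_le _ (integrZ B (integr_norm fi))).
    by apply: measurable_funM; [exact: integr_meas|exact: meas2_sec2].
  by move=> x; rewrite normrM mulrC ler_wpM2r ?normr_ge0.
have e1 x : f x * \int[mu]_y (w y * b x y) = \int[mu]_y (f x * (w y * b x y)).
  by rewrite RintZ.
have e2 y : w y * \int[mu]_x (f x * b x y) = \int[mu]_x (f x * (w y * b x y)).
  by rewrite -RintZ //; apply: eq_Rintegral => x _; rewrite mulrCA.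
under eq_fun do rewrite e1.
rewrite [in RHS](_ : (fun y => _) = (fun y => \int[mu]_x (f x * (w y * b x y)))); last first.
  by apply/funext => y; exact: e2.
have m2 : meas2 (fun x y => f x * (w y * b x y)).
  apply: meas2M; first by apply: meas2_l; exact: integr_meas.
  by apply: meas2M => //; apply: meas2_r; exact: integr_meas.
apply: fubini_real => //.
- have B0 : 0 <= B by exact: le_trans (bB 0 0).
  pose K := \int[mu]_y `|w y|.
  have E x : (\int[mu]_y `|f x * (w y * b x y)|%:E <= (B * K * `|f x|)%:E)%E.
    rewrite RintE; last exact/integr_norm/integrZ.
    rewrite lee_fin mulrC mulrA /K -RintZ; last exact: integr_norm.
    apply: Rint_le; [exact/integr_norm/integrZ|exact/integrZ/integr_norm|].
    move=> y; rewrite !normrM -mulrA; apply: ler_wpM2l => //.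
    by rewrite mulrC; apply: ler_wpM2r.
  apply: (@le_lt_trans _ _ (\int[mu]_x (B * K * `|f x|)%:E)%E).
    apply: ge0_le_integral => //.
    - by move=> x _; apply: integral_ge0.
    - apply: (@measurable_fun_fubini_tonelli_F _ _ _ _ R mu (fun z => `|f z.1 * (w z.2 * b z.1 z.2)|%:E)) => //.
      by apply/measurable_EFinP; apply: measurableT_comp => //; exact: m2.
    by apply: meas_EFin; exact: integr_meas (integrZ _ (integr_norm fi)).
  exact: integr_fin (integrZ _ (integr_norm fi)).
- by move=> x; exact: integrZ.
- move=> y; have := integrZ (w y) (f1 y).
  by under eq_fun do rewrite mulrCA.
Qed.

End Fubini.

(** * The Poisson kernel *)

Section PoissonKernel.
Variable R : realType.
Local Notation mu := (@lebesgue_measure R).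

Lemma is_derive_lin (c x : R) : is_derive x 1 (fun y : R => c * y) c.
Proof.
have := is_deriveZ c (is_derive_id x (1 : R)).
by rewrite /GRing.scale /= mulr1.
Qed.

Lemma is_derive_expM (c x : R) :
  is_derive x 1 (fun y => expR (c * y)) (c * expR (c * x)).
Proof.
rewrite mulrC; apply: is_derive1_comp; exact: is_derive_lin.
Qed.

Lemma is_derive_cosM (c x : R) :
  is_derive x 1 (fun y => cos (c * y)) (- sin (c * x) * c).
Proof.
apply: is_derive1_comp; exact: is_derive_lin.
Qed.

Lemma is_derive_sinM (c x : R) :
  is_derive x 1 (fun y => sin (c * y)) (cos (c * x) * c).
Proof.
apply: is_derive1_comp; exact: is_derive_lin.
Qed.

Definition pweight (e x : R) : R := expR (- e * `|x|).
(** A primitive of exp(- e x) (1 + cos (t x)) that tends to 0 at +oo. *)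
Definition pprim (e t x : R) : R := expR (- e * x) *
  (- e^-1 + (t * sin (t * x) - e * cos (t * x)) / (e ^+ 2 + t ^+ 2)).

Lemma is_derive_pprim (e t x : R) : 0 < e ->
  is_derive x 1 (pprim e t) (expR (- e * x) * (1 + cos (t * x))).
Proof.
move=> e0.
have d0 : e ^+ 2 + t ^+ 2 != 0 by rewrite gt_eqF // ltr_pwDl ?exprn_gt0 ?sqr_ge0.
pose B := fun x => - e^-1 + (t * sin (t * x) - e * cos (t * x)) / (e ^+ 2 + t ^+ 2).
pose B' := (t * (cos (t * x) * t) - e * (- sin (t * x) * t)) / (e ^+ 2 + t ^+ 2).
have dB : is_derive x 1 B B'.
  have h := is_deriveB (is_deriveZ t (is_derive_sinM t x)) (is_deriveZ e (is_derive_cosM t x)).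
  have h2 := is_deriveD (is_derive_cst (- e^-1) x 1) (is_deriveZ (e ^+ 2 + t ^+ 2)^-1 h).
  rewrite add0r in h2.
  rewrite (_ : B' = (e ^+ 2 + t ^+ 2)^-1 * (t * (cos (t * x) * t) - e * (- sin (t * x) * t))); last by rewrite mulrC.
  move: h2; rewrite (_ : _ + (_ \*: _) = B) //.
  by apply/funext => y; rewrite /B mulrC.
have h := is_deriveM (is_derive_expM (- e) x) dB.
rewrite (_ : expR _ * _ = expR (- e * x) *: B' + B x *: (- e * expR (- e * x))) //.
rewrite /B /B' /GRing.scale /=; field.
by rewrite d0 gt_eqF.
Qed.

Lemma cvg_expNy (e : R) : 0 < e -> expR (- e * x) @[x --> +oo] --> 0.
Proof.
move=> e0; under eq_cvg do rewrite mulNr.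
apply: (@cvg_comp _ _ _ (fun x => e * x) (fun y => expR (- y)) +oo +oo); last exact: cvgr_expR.
by apply: gt0_cvgMry => //; exact: cvg_id.
Qed.

Lemma cvg_pprim e t : 0 < e -> pprim e t x @[x --> +oo] --> 0.
Proof.
move=> e0.
pose C := e^-1 + (`|t| + e) / (e ^+ 2 + t ^+ 2).
have h : C * expR (- e * x) @[x --> +oo] --> 0.
  rewrite -[X in _ --> X](mulr0 C); apply: cvgM; [exact: cvg_cst|exact: cvg_expNy].
have d0 : 0 < e ^+ 2 + t ^+ 2 by rewrite ltr_pwDl ?exprn_gt0 ?sqr_ge0.
apply/cvgrPdist_le => d dp; move/cvgrPdist_le : h => /(_ d dp).
apply: filterS => x; rewrite !sub0r !normrN; apply: le_trans.
rewrite /pprim normrM mulrC [X in _ <= X]normrM.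
rewrite ler_wpM2r ?normr_ge0 // (le_trans _ (ler_norm _)) //.
apply: le_trans (ler_normD _ _) _; rewrite normrN ger0_norm ?invr_ge0 ?(ltW e0) // lerD2l.
rewrite normrM (ger0_norm (_ : 0 <= (_)^-1)) ?invr_ge0 ?(ltW d0) // ler_pM2r ?invr_gt0 //.
apply: le_trans (ler_normB _ _) _; rewrite !normrM (ger0_norm (ltW e0)).
have := sin_max (t * x); have := cos_max (t * x) => h1 h2.
by apply: lerD; rewrite ler_piMr ?normr_ge0 ?(ltW e0).
Qed.

(** The summand 1 keeps the integrand nonnegative, so that the fundamental
    theorem of calculus on a half-line applies before integrability is known;
    it is removed in [poisson_kernel] by subtracting the case t = 0. *)
Lemma integral_pweight_cos e t : 0 < e ->
  (\int[mu]_x (pweight e x * (1 + cos (t * x)))%:E =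
   (2 * (e^-1 + e / (e ^+ 2 + t ^+ 2)))%:E)%E.
Proof.
move=> e0.
have cos1 y : 0 <= 1 + cos y :> R by have := cos_geN1 y; lra.
have cf : continuous (fun x => pweight e x * (1 + cos (t * x))).
  move=> x; apply: cvgM.
    apply: (@cvg_comp _ _ _ (fun x => - e * `|x|) expR _ (nbhs (- e * `|x|))).
      by apply: cvgM; [exact: cvg_cst|exact: norm_continuous].
    exact: continuous_expR.
  apply: cvgD; first exact: cvg_cst.
  apply: (@cvg_comp _ _ _ (fun x => t * x) cos _ (nbhs (t * x))).
    by apply: cvgM; [exact: cvg_cst|exact: cvg_id].
  exact: continuous_cos.
rewrite ge0_symfun_integralT //; last 2 first.
- by move=> x; rewrite mulr_ge0 // expR_ge0.
- by move=> x; rewrite /pweight /= normrN mulrN cosN.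
rewrite (_ : [set x | 0 <= x] = `[0, +oo[%classic); last first.
  by apply/seteqP; split => x /=; rewrite in_itv /= andbT.
rewrite EFinM; congr (_ * _)%E.
rewrite (@ge0_continuous_FTC2y _ _ (pprim e t) 0 0).
- rewrite /pprim !mulr0 expR0 sin0 cos0 mulr0 sub0r mulr1 mul1r -EFinB; congr EFin.
  by rewrite sub0r opprD opprK mulNr opprK.
- by move=> x _; rewrite mulr_ge0 // expR_ge0.
- exact: continuous_subspaceT.
- exact: cvg_pprim.
- by move=> x _; have [] := is_derive_pprim t x e0.
- apply: cvg_at_right_filter; apply: differentiable_continuous.
  by apply/derivable1_diffP; have [] := is_derive_pprim t 0 e0.
- move=> x; rewrite in_itv /= andbT => x0.
  rewrite derive1E (@derive_val _ _ _ _ _ _ _ (is_derive_pprim t x e0)).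
  by rewrite /pweight gtr0_norm.
Qed.

Lemma meas_pweight e : meas (pweight e).
Proof.
apply: continuous_measurable_fun => x.
apply: (@cvg_comp _ _ _ (fun x => - e * `|x|) expR _ (nbhs (- e * `|x|))).
  by apply: cvgM; [exact: cvg_cst|exact: norm_continuous].
exact: continuous_expR.
Qed.

Lemma pweight_ge0 e x : 0 <= pweight e x. Proof. exact: expR_ge0. Qed.

Lemma integr_pweight e : 0 < e -> integr (pweight e).
Proof.
move=> e0; apply: integr_ge0P; [exact: meas_pweight|exact: pweight_ge0|].
have := integral_pweight_cos 0 e0.
under eq_integral do rewrite mul0r cos0.
move=> h; apply: (@le_lt_trans _ _ (\int[mu]_x (pweight e x * (1 + 1))%:E)%E).
  apply: ge0_le_integral => //.
  - by move=> x _; rewrite lee_fin pweight_ge0.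
  - by apply: meas_EFin; exact: meas_pweight.
  - by apply: meas_EFin; apply: measurable_funM; [exact: meas_pweight|exact: measurable_cst].
  by move=> x _; rewrite lee_fin; have := pweight_ge0 e x; lra.
by rewrite h ltry.
Qed.

Lemma poisson_kernel e t : 0 < e ->
  \int[mu]_x (pweight e x * cos (t * x)) = 2 * e / (e ^+ 2 + t ^+ 2).
Proof.
move=> e0.
have ip := integr_pweight e0.
have ic s : integr (fun x => pweight e x * cos (s * x)).
  apply: (integr_le _ ip).
    apply: measurable_funM; first exact: meas_pweight.
    apply: (measurableT_comp (continuous_measurable_fun (@continuous_cos R))).
    exact: mulrl_measurable.
  move=> x; rewrite normrM ger0_norm ?pweight_ge0 //.
  by rewrite ler_piMr ?pweight_ge0 // cos_max.
have E s : \int[mu]_x pweight e x + \int[mu]_x (pweight e x * cos (s * x)) =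
    2 * (e^-1 + e / (e ^+ 2 + s ^+ 2)).
  rewrite -RintD //; apply: EFin_inj; rewrite -integral_pweight_cos // -RintE.
    by apply: eq_integral => x _; rewrite mulrDr mulr1.
  exact: integrD.
have E0 := E 0; have Et := E t.
rewrite (_ : \int[mu]_x (pweight e x * cos (0 * x)) = \int[mu]_x pweight e x) in E0; last first.
  by apply: eq_Rintegral => x _; rewrite mul0r cos0 mulr1.
rewrite expr0n addr0 (_ : e / e ^+ 2 = e^-1) in E0; last by field; rewrite gt_eqF.
lra.
Qed.

End PoissonKernel.

Section CauchyWeight.
Variable R : realType.
Local Notation mu := (@lebesgue_measure R).

(** The Poisson kernel 2 e / (e^2 + t^2) in the rescaled variable s = t / e.
    Its total mass is 2 pi. *)
Definition cauchyw (s : R) : R := 2 / (1 + s ^+ 2).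

Lemma cauchywE s : cauchyw s = 2 / (1 + s ^+ 2). Proof. by []. Qed.

Lemma meas_cauchyw : meas cauchyw.
Proof.
apply: measurable_funM; first exact: measurable_cst.
have : continuous (fun s : R => (oneDsqr s)^-1) by exact: continuous_oneDsqrV.
by move=> h; exact: continuous_measurable_fun h.
Qed.

Lemma cauchyw_ge0 s : 0 <= cauchyw s.
Proof. by rewrite divr_ge0 // addr_ge0 // sqr_ge0. Qed.

Lemma cauchyw_le2 s : cauchyw s <= 2.
Proof.
rewrite /cauchyw ler_pdivrMr; last by rewrite ltr_pwDl // sqr_ge0.
by have := sqr_ge0 s; lra.
Qed.

Lemma integral_cauchyw : (\int[mu]_s (cauchyw s)%:E = (2 * pi)%:E)%E.
Proof.
have cV : continuous (fun s : R => (oneDsqr s)^-1) by exact: continuous_oneDsqrV.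
transitivity (\int[mu]_s (2%:E * ((oneDsqr s)^-1)%:E))%E; first by apply: eq_integral.
rewrite ge0_integralZl //; last by apply: meas_EFin; exact: continuous_measurable_fun cV.
rewrite ge0_symfun_integralT //; last first.
  by move=> x; rewrite /= /oneDsqr sqrrN.
rewrite (_ : [set x | 0 <= x] = `[0, +oo[%classic); last first.
  by apply/seteqP; split => x /=; rewrite in_itv /= andbT.
by rewrite integral0y_oneDsqr -!EFinM; congr EFin; field.
Qed.

Lemma integr_cauchyw : integr cauchyw.
Proof.
apply: integr_ge0P; [exact: meas_cauchyw|exact: cauchyw_ge0|].
by rewrite integral_cauchyw ltry. Qed.

End CauchyWeight.

Definition autocorr (R : realType) (f : R -> R) (t : R) : R :=
  \int[@lebesgue_measure R]_x (f x * f (x + t)).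

Lemma autocorrE (R : realType) (f : R -> R) t :
  autocorr f t = \int[@lebesgue_measure R]_x (f x * f (x + t)).
Proof. by []. Qed.

Local Opaque cauchyw autocorr.

(** * Plancherel's identity for real integrable functions *)

Section Autocorrelation.
Variable R : realType.
Local Notation mu := (@lebesgue_measure R).
Local Notation p := (@cauchyw R).
Variable f : R -> R.
Hypothesis fi : integr f.
Local Notation F := (fun x => (f x)%:C : R[i]^o).
Let mf : meas f. Proof. exact: integr_meas. Qed.

(** The substitution y = x + e s turns the Poisson kernel of width e into the
    fixed weight [cauchyw], on which dominated convergence can act as e tends
    to 0. *)
Lemma poisson_conv e x : 0 < e ->
  \int[mu]_y (f y * (2 * e / (e ^+ 2 + (x - y) ^+ 2))) =
  \int[mu]_s (p s * f (x + e * s)).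
Proof.
move=> e0.
have d0 z : 0 < e ^+ 2 + z ^+ 2 by rewrite ltr_pwDl ?exprn_gt0 ?sqr_ge0.
have fq : integr (fun y => f y * (2 * e / (e ^+ 2 + (x - y) ^+ 2))).
  apply: (integr_le _ (integrZ (2 * e / e ^+ 2) (integr_norm fi))).
    apply: measurable_funM => //.
    apply: continuous_measurable_fun => y; apply: cvgM; first exact: cvg_cst.
    apply: cvgV; first by rewrite gt_eqF.
    apply: cvgD; first exact: cvg_cst.
    by apply: cvgM; apply: cvgB; by [exact: cvg_cst|exact: cvg_id].
  move=> y; rewrite normrM mulrC ler_wpM2r ?normr_ge0 // ger0_norm; last first.
    by rewrite divr_ge0 ?(ltW (d0 _)) // mulr_ge0 // ltW.
  by rewrite ler_wpM2l ?mulr_ge0 ?(ltW e0) // lef_pV2 ?posrE ?exprn_gt0 // lerDl sqr_ge0.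
rewrite (Rint_affine x e0 fq) -(RintZ e (integr_affine x e0 fq)).
apply: eq_Rintegral => s _; rewrite cauchywE (addrC (e * s)) mulrCA mulrC; congr (_ * _).
have -> : x - (x + e * s) = - (e * s) by ring.
have h1 : 1 + s ^+ 2 != 0 by rewrite gt_eqF // ltr_pwDl // sqr_ge0.
rewrite (_ : e ^+ 2 + (- (e * s)) ^+ 2 = e ^+ 2 * (1 + s ^+ 2)); last by ring.
by field; rewrite h1 gt_eqF.
Qed.

Hypothesis fL : L2 F.

Let iff t : integr (fun x => f x * f (x + t)).
Proof.
have := integr_ReM fL (L2_tau t fL).
by rewrite /tau; under eq_fun do rewrite cReM /= mulr0 subr0.
Qed.

(** Absolute convergence comes from |f x f (x + e s)| <= f x ^2 + f (x + e
    s)^2, whose integral in x does not depend on s. *)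
Lemma autocorr_fubini e : 0 < e ->
  integr (fun s => p s * autocorr f (e * s)) /\
  \int[mu]_x (f x * \int[mu]_s (p s * f (x + e * s))) =
  \int[mu]_s (p s * autocorr f (e * s)).
Proof.
move=> e0.
have i1 x : integr (fun s => p s * f (x + e * s)).
  have := integr_affine x e0 fi; under eq_fun do rewrite addrC.
  move=> ia; apply: (integr_le _ (integrZ 2 (integr_norm ia))).
    by apply: measurable_funM; [exact: meas_cauchyw|exact: integr_meas ia].
  move=> s; rewrite normrM (ger0_norm (cauchyw_ge0 s)).
  by apply: ler_wpM2r; [exact: normr_ge0|exact: cauchyw_le2].
rewrite (_ : (fun x => f x * _) = (fun x => \int[mu]_s (f x * (p s * f (x + e * s))))); last first.
  by apply/funext => x; rewrite RintZ.
have -> : (fun s => p s * autocorr f (e * s)) = (fun s => \int[mu]_x (f x * (p s * f (x + e * s)))).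
  apply/funext => s; rewrite autocorrE -RintZ; last exact: iff.
  by apply: eq_Rintegral => x _; rewrite mulrCA.
have m2 : meas2 (fun s x => f x * (p s * f (x + e * s))).
  apply: meas2M; first exact: meas2_r mf.
  apply: meas2M; first exact: meas2_l (@meas_cauchyw R).
  apply: (meas2_comp mf); apply: meas2D; first exact: meas2_r (@measurable_id _ R setT).
  by apply: meas2_l; exact: mulrl_measurable.
have i2 s : integr (fun x => f x * (p s * f (x + e * s))).
  by have := integrZ (p s) (iff (e * s)); under eq_fun do rewrite mulrCA.
have fin : (\int[mu]_s \int[mu]_x `|f x * (p s * f (x + e * s))|%:E < +oo)%E.
  apply: (@le_lt_trans _ _ (\int[mu]_s ((n2 F + n2 F) * p s)%:E)%E); last first.
    exact: integr_fin (integrZ _ (@integr_cauchyw R)).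
  apply: ge0_le_integral => //.
  - by move=> s _; apply: integral_ge0 => x _; rewrite lee_fin.
  - apply: (@measurable_fun_fubini_tonelli_F _ _ _ _ R mu
      (fun z => `|f z.2 * (p z.1 * f (z.2 + e * z.1))|%:E)) => //.
    by apply/measurable_EFinP; apply: measurableT_comp => //; exact: m2.
  - by apply: meas_EFin; exact: integr_meas (integrZ _ (@integr_cauchyw R)).
  move=> s _; have Lt := L2_tau (e * s) fL.
  rewrite RintE; last exact: integr_norm (i2 s).
  rewrite lee_fin -[X in _ + X](n2_tau (e * s) fL) -RintD; try exact: L2_integr.
  rewrite [leRHS]mulrC -RintZ; last by apply: integrD; exact: L2_integr.
  apply: Rint_le; first exact: integr_norm (i2 s).
    by apply: integrZ; apply: integrD; exact: L2_integr.
  have ps : 0 <= p s by exact: cauchyw_ge0.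
  move=> x; rewrite mulrCA normrM [X in X * _ <= _]ger0_norm //; apply: ler_wpM2l => //.
  rewrite /tau !normc2_real ler_norml.
  have h1 := sqr_ge0 (f x + f (x + e * s)); have h2 := sqr_ge0 (f x - f (x + e * s)).
  by apply/andP; split; nra.
have [a b'] := fubini_real m2 fin i2 (fun x => integrZ (f x) (i1 x)).
by split; [exact: a|exact: esym b'].
Qed.

End Autocorrelation.

Section PlancherelReal.
Variable R : realType.
Local Notation mu := (@lebesgue_measure R).
Variable f : R -> R.
Hypothesis fi : integr f.
Hypothesis fL : L2 (fun x => (f x)%:C : R[i]^o).

Definition cosT (xi : R) : R := \int[mu]_x (f x * cos (x * xi)).
Definition sinT (xi : R) : R := \int[mu]_x (f x * sin (x * xi)).
Let I := \int[mu]_x `|f x|.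

Let mf : meas f. Proof. exact: integr_meas. Qed.
Let mid : meas (@id R). Proof. exact: measurable_id. Qed.
Let mcos : meas (@cos R).
Proof. exact: (continuous_measurable_fun (@continuous_cos R)). Qed.
Let msin : meas (@sin R).
Proof. exact: (continuous_measurable_fun (@continuous_sin R)). Qed.
Let m2mul : meas2 (fun x y : R => x * y).
Proof. by apply: meas2M; [exact: meas2_l|exact: meas2_r]. Qed.

Let integr_osc (g : R -> R) : meas g -> (forall x, `|g x| <= 1) ->
  integr (fun x => f x * g x).
Proof.
move=> mg g1; apply: (integr_le _ (integr_norm fi)); first exact: measurable_funM.
by move=> x; rewrite normrM ler_piMr ?normr_ge0.
Qed.

Let ifc xi : integr (fun x => f x * cos (x * xi)).
Proof.
apply: integr_osc; last by move=> x; exact: cos_max.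
by apply: (measurableT_comp mcos); exact: mulrr_measurable.
Qed.

Let ifs xi : integr (fun x => f x * sin (x * xi)).
Proof.
apply: integr_osc; last by move=> x; exact: sin_max.
by apply: (measurableT_comp msin); exact: mulrr_measurable.
Qed.

Let oscT_bound (g : R -> R) : meas g -> (forall x, `|g x| <= 1) ->
  `|\int[mu]_x (f x * g x)| <= I.
Proof.
move=> mg g1; have ig := integr_osc mg g1.
apply: le_trans (Rint_abs_le ig) _; apply: Rint_le; [exact: integr_norm|exact: integr_norm|].
by move=> x; rewrite normrM ler_piMr ?normr_ge0.
Qed.

Let cosT_bound xi : `|cosT xi| <= I.
Proof.
apply: oscT_bound; last by move=> x; exact: cos_max.
by apply: (measurableT_comp mcos); exact: mulrr_measurable.
Qed.

Let sinT_bound xi : `|sinT xi| <= I.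
Proof.
apply: oscT_bound; last by move=> x; exact: sin_max.
by apply: (measurableT_comp msin); exact: mulrr_measurable.
Qed.

Let meas_oscT (g : R -> R) : meas g -> (forall x, `|g x| <= 1) ->
  meas (fun xi => \int[mu]_x (f x * g (x * xi))).
Proof.
move=> mg g1.
have m2 : meas2 (fun xi x : R => g (x * xi)).
  by apply: meas2_comp => //; apply: meas2M; [exact: meas2_r|exact: meas2_l].
have [h _] := fubini_kernel (integr_pweight (@ltr01 R)) fi m2 (fun x y => g1 _).
have := measurable_funM (meas_pweight (-1 : R)) (integr_meas h).
rewrite /meas; congr (measurable_fun _ _); apply/funext => xi /=.
by rewrite mulrA /pweight -expRD opprK -mulrDl subrr mul0r expR0 mul1r.
Qed.

Lemma meas_cosT : meas cosT.
Proof. by apply: (meas_oscT mcos) => x; exact: cos_max. Qed.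
Lemma meas_sinT : meas sinT.
Proof. by apply: (meas_oscT msin) => x; exact: sin_max. Qed.

(* Integrating f against b x squares the transform (TE), while the addition
   formula makes b x xi the integral of f y cos ((x - y) xi) in y (bE). *)
Let b x xi := cos (x * xi) * cosT xi + sin (x * xi) * sinT xi.

Let m2b : meas2 b.
Proof.
apply: meas2D; apply: meas2M; try exact: meas2_comp;
  by [apply: meas2_r; exact: meas_cosT|apply: meas2_r; exact: meas_sinT].
Qed.

Let b_bound x xi : `|b x xi| <= I + I.
Proof.
apply: le_trans (ler_normD _ _) _; rewrite !normrM; apply: lerD.
  by apply: le_trans (cosT_bound xi); rewrite ler_piMl ?normr_ge0 // cos_max.
by apply: le_trans (sinT_bound xi); rewrite ler_piMl ?normr_ge0 // sin_max.
Qed.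

Let bE x xi : b x xi = \int[mu]_y (f y * cos ((x - y) * xi)).
Proof.
rewrite /b /cosT /sinT -!RintZ // -RintD; try exact: integrZ.
by apply: eq_Rintegral => y _; rewrite mulrBl cosB; ring.
Qed.

Let TE xi : \int[mu]_x (f x * b x xi) = cosT xi ^+ 2 + sinT xi ^+ 2.
Proof.
rewrite -[X in _ = X + _]/(_ * _) -[X in _ = _ + X]/(_ * _).
rewrite {2}/cosT {2}/sinT -!RintZ // -RintD; try exact: integrZ.
by apply: eq_Rintegral => y _; rewrite /b; ring.
Qed.

Let w (e : R) := pweight e.

Local Notation A := (autocorr f).
Local Notation p := (@cauchyw R).
Let p0 := @cauchyw_ge0 R.
Let p2 := @cauchyw_le2 R.
Let mp := @meas_cauchyw R.
Let ip := @integr_cauchyw R.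
Let intp := @integral_cauchyw R.

Let F : Cfun R := fun x => (f x)%:C.

Let conv_poisson e x : 0 < e ->
  \int[mu]_xi (w e xi * b x xi) = \int[mu]_s (p s * f (x + e * s)).
Proof.
move=> e0.
have m2c : meas2 (fun xi y : R => cos ((x - y) * xi)).
  apply: meas2_comp => //; apply: meas2M; last exact: meas2_l.
  by apply: meas2_r; apply: measurable_funB => //; exact: measurable_cst.
have [_ h] := fubini_kernel (integr_pweight e0) fi m2c (fun x y => cos_max _).
rewrite (_ : (fun xi => w e xi * b x xi) =
  (fun xi => pweight e xi * \int[mu]_y (f y * cos ((x - y) * xi)))); last first.
  by apply/funext => xi; rewrite bE.
rewrite h.
rewrite (_ : (fun y => _) = (fun y => f y * (2 * e / (e ^+ 2 + (x - y) ^+ 2)))); last first.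
  by apply/funext => y; rewrite poisson_kernel.
exact: poisson_conv.
Qed.

Let A_le t : `|A t| <= n2 F.
Proof.
have e1 : A t = Re (inner F (tau t F)).
  by rewrite autocorrE; apply: eq_Rintegral => x _; rewrite cReM /= oppr0 mulr0 subr0.
have Lt := L2_tau t fL.
rewrite -nrm_sqr expr2 ler_norml; apply/andP; split; last first.
  by rewrite e1; apply: le_trans (Re_inner_le fL Lt) _; rewrite nrm_tau.
rewrite lerNl e1 -cReN -innerNl //.
apply: le_trans (Re_inner_le (L2N fL) Lt) _.
by rewrite nrm_tau // nrmN.
Qed.

Let A_cont (t : nat -> R) : t n @[n --> \oo] --> 0 -> A (t n) @[n --> \oo] --> n2 F.
Proof.
move=> ht.
have e1 s : A s = Re (inner (tau s F) F).
  by rewrite autocorrE; apply: eq_Rintegral => x _; rewrite cReM /= oppr0 mulr0 subr0 mulrC.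
have key s : `|A s - n2 F| <= nrm (tau s F - F) * nrm F.
  have Ls := L2_tau s fL; have L' := L2B Ls fL.
  have -> : A s - n2 F = Re (inner (tau s F - F) F).
    by rewrite innerBl // inner_self cReD cReN e1.
  rewrite ler_norml; apply/andP; split; last exact: Re_inner_le.
  rewrite lerNl -cReN -innerNl //; apply: le_trans (Re_inner_le (L2N L') fL) _.
  by rewrite nrmN.
apply/cvgrPdist_le => d d0.
have p1 : 0 < nrm F + 1 by rewrite ltr_wpDl // nrm_ge0.
have [eta eta0 heta] := L2_tau_cont fL (divr_gt0 d0 p1).
move/cvgrPdist_lt : ht => /(_ _ eta0); apply: filterS => n.
rewrite sub0r normrN => /heta; rewrite ler_pdivlMr // => h.
rewrite distrC; apply: le_trans (key _) (le_trans _ h).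
by rewrite ler_wpM2l ?nrm_ge0 // lerDl.
Qed.

Let weighted e : 0 < e -> integr (fun s => p s * A (e * s)) /\
  \int[mu]_xi (w e xi * (cosT xi ^+ 2 + sinT xi ^+ 2)) = \int[mu]_s (p s * A (e * s)).
Proof.
move=> e0.
have [_ h] := fubini_kernel fi (integr_pweight e0) m2b b_bound.
rewrite [X in _ /\ \int[mu]_(x in _) X x = _](_ : _ = (fun xi => pweight e xi * \int[mu]_x (f x * b x xi))); last first.
  by apply/funext => xi; rewrite TE.
rewrite -h (_ : (fun x => f x * _) = (fun x => f x * \int[mu]_s (p s * f (x + e * s)))); last first.
  by apply/funext => x; rewrite conv_poisson.
exact: autocorr_fubini.
Qed.

(** The weights exp(- |xi| / (k + 1)) increase to 1, so monotone convergence
    gives the left side without assuming it finite. By [weighted] each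
    weighted integral equals that of p s * A (s / (k + 1)), which tends to
    that of p s * A 0, since the autocorrelation A is continuous at 0 and
    bounded by A 0. *)
Lemma plancherel_real :
  (\int[mu]_xi (cosT xi ^+ 2 + sinT xi ^+ 2)%:E = (2 * pi * n2 F)%:E)%E.
Proof.
pose T xi := cosT xi ^+ 2 + sinT xi ^+ 2.
have T0 xi : 0 <= T xi by rewrite addr_ge0 // sqr_ge0.
have mT : meas T.
  by apply: measurable_funD; apply: measurable_funX; [exact: meas_cosT|exact: meas_sinT].
have TB xi : T xi <= I ^+ 2 + I ^+ 2.
  have I0 : 0 <= I by exact: le_trans (cosT_bound 0).
  have sq a : `|a| <= I -> a ^+ 2 <= I ^+ 2.
    by move=> h; rewrite -real_normK ?num_real // lerXn2r ?nnegrE ?normr_ge0.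
  by apply: lerD; apply: sq; [exact: cosT_bound|exact: sinT_bound].
pose eps (k : nat) : R := k.+1%:R^-1.
have eps0 k : 0 < eps k by rewrite invr_gt0.
have epsc : eps k @[k --> \oo] --> 0 by exact: cvg_harmonic.
have iw k : integr (fun xi => pweight (eps k) xi * T xi).
  apply: (integr_le _ (integrZ (I ^+ 2 + I ^+ 2) (integr_pweight (eps0 k)))).
    by apply: measurable_funM => //; exact: meas_pweight.
  move=> xi; rewrite ger0_norm ?mulr_ge0 ?pweight_ge0 ?T0 // mulrC.
  by apply: ler_wpM2r; [exact: pweight_ge0|exact: TB].
have cw xi : pweight (eps k) xi * T xi @[k --> \oo] --> T xi.
  rewrite -[X in _ --> X]mul1r; apply: cvgM; last exact: cvg_cst.
  rewrite -expR0 -(mul0r (- `|xi|)).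
  rewrite /pweight; under eq_cvg do rewrite mulNr -mulrN.
  apply: (@cvg_comp _ _ _ (fun k => eps k * - `|xi|) expR _ (nbhs (0 * - `|xi|))).
    by apply: cvgM => //; exact: cvg_cst.
  exact: continuous_expR.
transitivity (limn (fun k => \int[mu]_xi (pweight (eps k) xi * T xi)%:E))%E.
  rewrite -monotone_convergence //.
  - apply: eq_integral => xi _; apply/esym/cvg_lim => //.
    by apply: cvg_EFin; [exact: nearW|exact: cw].
  - by move=> k; apply: meas_EFin; exact: integr_meas (iw k).
  - by move=> k xi _; rewrite lee_fin mulr_ge0 // pweight_ge0.
  - move=> xi _ k m km; rewrite lee_fin; apply: ler_wpM2r; first exact: T0.
    rewrite /pweight ler_expR; apply: ler_wpM2r => //.
    by rewrite lerN2 lef_pV2 ?posrE // ler_nat.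
apply/cvg_lim => //.
  under eq_cvg => k do rewrite (RintE (iw k)).
  apply: cvg_EFin; first exact: nearW.
  rewrite /comp /=; under eq_cvg => k do rewrite (weighted (eps0 k)).2.
have cv : {ae mu, forall s, p s * A (eps k * s) @[k --> \oo] --> p s * n2 F}.
  apply: aeW => s; apply: cvgM; first exact: cvg_cst.
  apply: A_cont; rewrite -(mul0r s); apply: cvgM => //; exact: cvg_cst.
have [|n x|_] := @dominated_cvg R (fun k s => p s * A (eps k * s)) (fun s => p s * n2 F)
  (fun s => n2 F * p s) (fun k => integr_meas (weighted (eps0 k)).1) _ (integrZ _ ip) cv _.
- by apply: measurable_funM; [exact: mp|exact: measurable_cst].
- by rewrite normrM (ger0_norm (p0 x)) mulrC; apply: ler_wpM2r; [exact: p0|exact: A_le].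
rewrite (_ : \int[mu]_x (p x * n2 F) = 2 * pi * n2 F) //.
rewrite (_ : (fun x => _) = (fun x => n2 F * p x)); last by apply/funext => x; rewrite mulrC.
rewrite RintZ // mulrC; congr (_ * _); apply: EFin_inj; by rewrite -RintE.
Qed.

End PlancherelReal.

(** * The Fourier integral and truncations *)

Section FourierIntegral.
Variable R : realType.
Local Notation mu := (@lebesgue_measure R).
Implicit Types u v : Cfun R.

Definition cintegr u := integr (fun x => Re (u x)) /\ integr (fun x => Im (u x)).

Lemma cintegrD u v : cintegr u -> cintegr v -> cintegr (u + v).
Proof.
move=> [a b] [c d]; split;
  [under eq_fun do rewrite cReD|under eq_fun do rewrite cImD]; exact: integrD.
Qed.

Lemma cintegrZ z u : cintegr u -> cintegr (z *: u).
Proof.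
move=> [a b]; rewrite /cintegr.
rewrite (_ : (fun x => Re ((z *: u) x)) = (fun x => Re z * Re (u x) - Im z * Im (u x))); last first.
  by apply/funext => x; rewrite cReM.
rewrite (_ : (fun x => Im ((z *: u) x)) = (fun x => Re z * Im (u x) + Im z * Re (u x))); last first.
  by apply/funext => x; rewrite cImM.
by split; [apply: integrB|apply: integrD]; exact: integrZ.
Qed.

Lemma cintegr_cmeas u : cintegr u -> cmeas u.
Proof. by move=> [a b]; split; exact: integr_meas. Qed.

Lemma cintegrM B m u : cmeas m -> cintegr u -> (forall x, normc2 (m x) <= B) ->
  cintegr (fun x => u x * m x).
Proof.
move=> mm cu mB; have [c1 c2] := cmeasM (cintegr_cmeas cu) mm.
case: cu => a b.
have h := integrZ (Num.sqrt B) (integrD (integr_norm a) (integr_norm b)).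
have k x : `|Re (m x)| <= Num.sqrt B /\ `|Im (m x)| <= Num.sqrt B.
  by split; [apply: le_trans (absRe_le _) _|apply: le_trans (absIm_le _) _];
    apply: ler_wsqrtr.
split; apply: (integr_le _ h) => // x; have [k1 k2] := k x;
  have := (normr_ge0 (Re (u x)), normr_ge0 (Im (u x))) => -[n1 n2].
  rewrite cReM; apply: le_trans (ler_normB _ _) _; rewrite !normrM mulrDr; apply: lerD.
    by rewrite mulrC; apply: ler_wpM2r.
  by rewrite mulrC; apply: ler_wpM2r.
rewrite cImM; apply: le_trans (ler_normD _ _) _; rewrite !normrM mulrDr; apply: lerD.
  by rewrite mulrC; apply: ler_wpM2r.
by rewrite mulrC; apply: ler_wpM2r.
Qed.

Lemma CintD u v : cintegr u -> cintegr v ->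
  Cintegral setT (u + v) = Cintegral setT u + Cintegral setT v.
Proof.
move=> [a b] [c d]; apply: complexP; rewrite ?cReD ?cImD /= -RintD //;
  by apply: eq_Rintegral => x _; rewrite ?cReD ?cImD.
Qed.

Lemma CintZ z u : cintegr u -> Cintegral setT (z *: u) = z * Cintegral setT u.
Proof.
move=> [a b]; apply: complexP; rewrite ?cReM ?cImM /= -!RintZ // -?RintB -?RintD //;
  try exact: integrZ; by apply: eq_Rintegral => x _; rewrite ?cReM ?cImM.
Qed.

Lemma cmeas_expNi xi : cmeas (fun x : R => expNi (x * xi) : R[i]^o).
Proof.
split.
  apply: (measurableT_comp (continuous_measurable_fun (@continuous_cos R))).
  exact: mulrr_measurable.
apply: measurableT_comp => //.
apply: (measurableT_comp (continuous_measurable_fun (@continuous_sin R))).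
exact: mulrr_measurable.
Qed.

Lemma normc2_expNi (t : R) : normc2 (expNi t) = 1.
Proof. by rewrite /normc2 /= sqrrN cos2Dsin2. Qed.

Lemma cintegr_expNi u xi : cintegr u -> cintegr (fun x => u x * expNi (x * xi)).
Proof.
move=> cu; apply: (cintegrM (B := 1) (cmeas_expNi xi) cu) => x.
by rewrite normc2_expNi.
Qed.

(** The Fourier integral, for integrable functions; [fourier] agrees with it
    on the intersection of L^1 and L^2 by [fourier_fint]. *)
Definition fint u : Cfun R := fun xi =>
  (Num.sqrt (2 * pi))^-1%:C * Cintegral setT (fun x => u x * expNi (x * xi)).

Lemma fintD u v : cintegr u -> cintegr v -> fint (u + v) = fint u + fint v.
Proof.
move=> cu cv; apply/funext => xi; rewrite -[RHS]/(fint u xi + fint v xi) /fint -mulrDr.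
congr (_ * _); rewrite -CintD; try exact: cintegr_expNi.
by congr Cintegral; apply/funext => x; rewrite -[LHS]/((u x + v x) * _) mulrDl.
Qed.

Lemma fintZ z u : cintegr u -> fint (z *: u) = z *: fint u.
Proof.
move=> cu; apply/funext => xi; rewrite -[RHS]/(z * fint u xi) /fint mulrCA.
congr (_ * _); rewrite -CintZ; last exact: cintegr_expNi.
by congr Cintegral; apply/funext => x; rewrite -[LHS]/((z * u x) * _) -mulrA.
Qed.

Lemma fintB u v : cintegr u -> cintegr v -> fint (u - v) = fint u - fint v.
Proof.
move=> cu cv; rewrite (_ : u - v = u + (-1) *: v); last by rewrite scaleN1r.
by rewrite (fintD cu (cintegrZ (-1) cv)) fintZ // scaleN1r.
Qed.

Lemma integr_cos f xi : integr f -> integr (fun x : R => f x * cos (x * xi)).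
Proof.
move=> fi; have h : cintegr (fun x => (f x)%:C : R[i]^o).
  by split => //=; exact: integrable0.
have [+ _] := cintegr_expNi xi h.
by under eq_fun do rewrite cReM /= mul0r subr0.
Qed.

Lemma integr_sin f xi : integr f -> integr (fun x : R => f x * sin (x * xi)).
Proof.
move=> fi; have h : cintegr (fun x => (f x)%:C : R[i]^o).
  by split => //=; exact: integrable0.
have [_] := cintegr_expNi xi h.
move=> /integrN; under eq_fun do rewrite cImM /= mul0r addr0 mulrN opprK.
by [].
Qed.

Lemma fintE u xi : cintegr u ->
  let f x := Re (u x) in let g x := Im (u x) in
  fint u xi = (Num.sqrt (2 * pi))^-1%:C *
   ((cosT f xi + sinT g xi) +i* (cosT g xi - sinT f xi)).
Proof.
move=> [a b] f g; congr (_ * _); apply: complexP => /=.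
  rewrite -RintD; [|exact: integr_cos|exact: integr_sin].
  by apply: eq_Rintegral => x _; rewrite cReM /= mulrN opprK.
rewrite -RintB; [|exact: integr_cos|exact: integr_sin].
by apply: eq_Rintegral => x _; rewrite cImM /= mulrN addrC.
Qed.

Lemma cosTN f xi : @cosT R f (- xi) = cosT f xi.
Proof. by apply: eq_Rintegral => x _; rewrite mulrN cosN. Qed.

Lemma sinTN f xi : integr f -> @sinT R f (- xi) = - sinT f xi.
Proof.
move=> fi; rewrite /sinT -RintN; last exact: integr_sin.
by apply: eq_Rintegral => x _; rewrite mulrN sinN mulrN.
Qed.

Lemma cmeas_fint u : cintegr u -> cmeas (fint u).
Proof.
move=> cu; have [a b] := cu.
rewrite (_ : fint u = (Num.sqrt (2 * pi))^-1%:C *: (fun xi =>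
  ((cosT (fun x => Re (u x)) xi + sinT (fun x => Im (u x)) xi) +i*
   (cosT (fun x => Im (u x)) xi - sinT (fun x => Re (u x)) xi)) : R[i]^o)); last first.
  by apply/funext => xi; rewrite fintE.
apply: cmeasZ; split.
  by apply: measurable_funD; [exact: meas_cosT|exact: meas_sinT].
by apply: measurable_funB; [exact: meas_cosT|exact: meas_sinT].
Qed.

(** For u = f + i g the squared transform contains a cross term between f and
    g, which is odd in xi. Adding the values at xi and - xi cancels it and
    leaves the two real cases. *)
Lemma plancherel_fint u : L2 u -> cintegr u -> L2 (fint u) /\ n2 (fint u) = n2 u.
Proof.
move=> Lu cu; have [fi gi] := cu; have [mf mg] := L2_cmeas Lu.
set f := (fun x => Re (u x)) in fi mf *; set g := (fun x => Im (u x)) in gi mg *.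
have Lf : L2 (fun x => (f x)%:C : R[i]^o).
  apply: (L2_dom (K := 1) _ Lu); first exact: cmeas_real.
  by move=> x; rewrite normc2_real mul1r lerDl sqr_ge0.
have Lg : L2 (fun x => (g x)%:C : R[i]^o).
  apply: (L2_dom (K := 1) _ Lu); first exact: cmeas_real.
  by move=> x; rewrite normc2_real mul1r lerDr sqr_ge0.
have Ef := plancherel_real fi Lf; have Eg := plancherel_real gi Lg.
have p0 : 0 < 2 * pi :> R by rewrite mulr_gt0 // pi_gt0.
have cF := cmeas_fint cu.
have mF : measurable_fun setT (fun xi => (normc2 (fint u xi))%:E).
  by apply: meas_EFin; exact: meas_normc2.
have E xi : normc2 (fint u xi) + normc2 (fint u (- xi)) =
    pi^-1 * ((cosT f xi ^+ 2 + sinT f xi ^+ 2) + (cosT g xi ^+ 2 + sinT g xi ^+ 2)).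
  rewrite !fintE // !normc2M normc2_real exprVn sqr_sqrtr ?(ltW p0) // -/f -/g.
  rewrite !cosTN !sinTN // /normc2 /=.
  have pn : (pi : R) != 0 by rewrite gt_eqF // pi_gt0.
  have -> : (pi : R)^-1 = 2 * (2 * pi)^-1 by rewrite invfM mulrA divff // mul1r.
  by ring.
(* The integral of the even part of |fint u|^2 is that of |fint u|^2 itself.
   Working in the extended reals avoids assuming X finite. *)
pose X := (\int[mu]_xi (normc2 (fint u xi))%:E)%E.
have nn xi : (0 <= (normc2 (fint u xi))%:E)%E by rewrite lee_fin normc2_ge0.
have XX : (X + X = (2 * n2 u)%:E)%E.
  rewrite {2}/X (ge0_integral_oppr mF) // /X -ge0_integralD //; last first.
    by have := cmeas_refl cF; move=> /meas_normc2 h; apply: meas_EFin.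
  transitivity (\int[mu]_xi (pi^-1%:E * ((cosT f xi ^+ 2 + sinT f xi ^+ 2)%:E + (cosT g xi ^+ 2 + sinT g xi ^+ 2)%:E)))%E.
    by apply: eq_integral => xi _; rewrite -EFinD E EFinM EFinD.
  have mfT : measurable_fun setT (fun xi => (cosT f xi ^+ 2 + sinT f xi ^+ 2)%:E).
    by apply: meas_EFin; apply: measurable_funD; apply: measurable_funX; [exact: meas_cosT|exact: meas_sinT].
  have mgT : measurable_fun setT (fun xi => (cosT g xi ^+ 2 + sinT g xi ^+ 2)%:E).
    by apply: meas_EFin; apply: measurable_funD; apply: measurable_funX; [exact: meas_cosT|exact: meas_sinT].
  have pp h xi : (0 <= (@cosT R h xi ^+ 2 + sinT h xi ^+ 2)%:E)%E.
    by rewrite lee_fin addr_ge0 // sqr_ge0.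
  rewrite ge0_integralZl //; last 3 first.
  - exact: emeasurable_funD.
  - by move=> x _; rewrite adde_ge0.
  - by rewrite lee_fin invr_ge0 pi_ge0.
  rewrite ge0_integralD // Ef Eg -EFinD -EFinM; congr EFin.
  have -> : n2 u = n2 (fun x => (f x)%:C : R[i]^o) + n2 (fun x => (g x)%:C : R[i]^o).
    rewrite /n2 -RintD; try exact: L2_integr.
    by apply: eq_Rintegral => x _; rewrite !normc2_real.
  set a := n2 _; set b := n2 _.
  have -> : pi^-1 * (2 * pi * a + 2 * pi * b) = (pi^-1 * pi) * (2 * (a + b)) by ring.
  by rewrite mulVf ?mul1r // gt_eqF // pi_gt0.
have X0 : (0 <= X)%E by apply: integral_ge0.
have Xfin : (X < +oo)%E.
  rewrite ltey; apply/eqP => XE; move: XX; rewrite XE => /eqP.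
  by [].
have LF : L2 (fint u) by apply/L2P; split => //; apply: integr_ge0P Xfin; [exact: meas_normc2|move=> x; exact: normc2_ge0].
split => //; have := XX; rewrite /X RintE; last exact: L2_integr.
rewrite -EFinD => h; have := EFin_inj h; rewrite -/(n2 _); lra.
Qed.

Lemma Cint_restrict (D : set R) (w : Cfun R) :
  Cintegral D w = Cintegral setT (fun x => (\1_D x)%:C * w x).
Proof.
apply: complexP; rewrite /= [LHS]Rintegral_mkcond; apply: eq_Rintegral => x _;
  rewrite patch_indic /= mulrC ?cReM ?cImM /= mul0r ?subr0 ?addr0 //.
Qed.

Definition cut (n : nat) (u : Cfun R) : Cfun R :=
  fun x => (\1_(`[- n%:R, n%:R]%classic) x)%:C * u x.

Lemma truncE u n : fourier_trunc u n = fint (cut n u).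
Proof.
apply/funext => xi; rewrite /fourier_trunc Cint_restrict /fint /cut.
by congr (_ * Cintegral _ _); apply/funext => x; rewrite mulrA.
Qed.

Lemma indic01 (D : set R) x : 0 <= (\1_D x : R) <= 1.
Proof. by rewrite indicE; case: (_ \in _); rewrite lexx ler01. Qed.

Lemma normc2_indic (D : set R) x : normc2 ((\1_D x : R)%:C) <= 1.
Proof.
rewrite normc2_real; have /andP[a b] := indic01 D x.
by rewrite expr_le1.
Qed.

Lemma cmeas_indic (D : set R) : measurable D -> cmeas (fun x => (\1_D x : R)%:C : R[i]^o).
Proof. by move=> mD; apply: cmeas_real; exact: measurable_indic. Qed.

Lemma L2_cut n u : L2 u -> L2 (cut n u).
Proof.
move=> Lu; apply: (L2M (B := 1) _ Lu); first exact: cmeas_indic.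
by move=> x; exact: normc2_indic.
Qed.

Lemma L2_indic (a b : R) : L2 (fun x => (\1_(`[a, b]%classic) x : R)%:C : R[i]^o).
Proof.
apply/L2P; split; first exact: cmeas_indic.
apply: (integr_le _ (integr_indic a b 1)).
  by apply: meas_normc2; exact: cmeas_indic.
move=> x; rewrite mul1r normc2_real indicE.
by case: (_ \in _); rewrite ?expr1n ?expr0n ?normr1 ?normr0.
Qed.

Lemma cintegr_cut n u : L2 u -> cintegr (cut n u).
Proof. by move=> Lu; split; [apply: integr_ReM|apply: integr_ImM] => //; exact: L2_indic. Qed.

Lemma cutD n u v : cut n (u + v) = cut n u + cut n v.
Proof. by apply/funext => x; rewrite -[RHS]/(_ * u x + _ * v x) -mulrDr. Qed.

Lemma cutZ n z u : cut n (z *: u) = z *: cut n u.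
Proof. by apply/funext => x; rewrite -[RHS]/(z * (_ * u x)) mulrCA. Qed.

(** Dominated convergence, the difference being u outside [-n, n]. *)
Lemma cut_cvg u : L2 u -> nrm (cut n u - u) @[n --> \oo] --> 0.
Proof.
move=> Lu; apply: (@dominated_cvgL2_0 _ _ _ _ (L2_integr Lu)).
- by move=> n; apply: cmeasB; apply: L2_cmeas => //; exact: L2_cut.
- apply: aeW => x; split; apply: cvg_near_cst;
    (exists (Num.truncn `|x|).+1 => // n /= hn);
    rewrite -[(_ - _) x]/(_ * u x - u x) indicE mem_set ?mul1r ?subrr //=;
    rewrite in_itv /= -ler_norml; apply: (le_trans (ltW (truncnS_gt _)));
    by rewrite ler_nat.
- move=> n x; rewrite -[(_ - _) x]/(_ * u x - u x) indicE.
  by case: (_ \in _); rewrite ?mul1r ?subrr ?mul0r ?sub0r ?normc2N ?normc2_0 ?normc2_ge0.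
Qed.

End FourierIntegral.

Section L2Convergence.
Variable R : realType.
Local Notation mu := (@lebesgue_measure R).
Implicit Types u v w : Cfun R.

Definition cvgL2 (u_ : nat -> Cfun R) u := nrm (u_ n - u) @[n --> \oo] --> 0.
Definition aeq u v := {ae mu, forall x, u x = v x}.

Lemma aeq_refl u : aeq u u. Proof. exact: aeW. Qed.
Lemma aeq_sym u v : aeq u v -> aeq v u. Proof. by apply: aeS => x ->. Qed.
Lemma aeq_trans v u w : aeq u v -> aeq v w -> aeq u w.
Proof. by apply: aeS2 => x -> ->. Qed.

Lemma squeeze0 (a b : nat -> R) : (forall n, 0 <= a n <= b n) ->
  b n @[n --> \oo] --> 0 -> a n @[n --> \oo] --> 0.
Proof.
move=> ab b0; apply: (squeeze_cvgr (f := cst 0) (h := b)) => //.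
  exact: nearW.
exact: cvg_cst.
Qed.

Lemma cvgL2D (u_ v_ : nat -> Cfun R) u v :
  (forall n, L2 (u_ n)) -> L2 u -> (forall n, L2 (v_ n)) -> L2 v ->
  cvgL2 u_ u -> cvgL2 v_ v -> cvgL2 (fun n => u_ n + v_ n) (u + v).
Proof.
move=> a b c d cu cv.
apply: (squeeze0 (b := fun n => nrm (u_ n - u) + nrm (v_ n - v))).
  move=> n; rewrite nrm_ge0 opprD addrACA /=.
  by apply: nrmD_le; exact: L2B.
by rewrite -[X in _ --> X]addr0; exact: cvgD.
Qed.

Lemma cvgL2Z z (u_ : nat -> Cfun R) u :
  (forall n, L2 (u_ n)) -> L2 u ->
  cvgL2 u_ u -> cvgL2 (fun n => z *: u_ n) (z *: u).
Proof.
move=> a b cu; rewrite /cvgL2.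
under eq_cvg => n do rewrite -scalerBr (nrmZ z (L2B (a n) b)).
have h : Num.sqrt (normc2 z) * nrm (u_ n - u) @[n --> \oo] -->
    Num.sqrt (normc2 z) * 0 by apply: cvgM => //; exact: cvg_cst.
by rewrite mulr0 in h; exact: h.
Qed.

Lemma cvgL2_unique (u_ : nat -> Cfun R) u v :
  (forall n, L2 (u_ n)) -> L2 u -> L2 v ->
  cvgL2 u_ u -> cvgL2 u_ v -> aeq u v.
Proof.
move=> a b c cu cv; apply: nrm_eq0_ae => //.
have h1 : nrm (u - v) @[_ --> \oo] --> nrm (u - v) by exact: cvg_cst.
suff h0 : nrm (u - v) @[_ --> \oo] --> (0 : R) by exact: (cvg_unique _ h1 h0).
apply: (squeeze0 (b := fun n => nrm (u_ n - u) + nrm (u_ n - v))).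
  by move=> n; rewrite nrm_ge0 /= [nrm (u_ n - u)]nrmBC; exact: nrm_tri b c (a n).
by rewrite -[X in _ --> X]addr0; exact: cvgD.
Qed.

Lemma cvgL2_nrm (u_ : nat -> Cfun R) u :
  (forall n, L2 (u_ n)) -> L2 u -> cvgL2 u_ u ->
  nrm (u_ n) @[n --> \oo] --> nrm u.
Proof.
move=> a b cu; apply/cvgrPdist_le => e e0.
move/cvgrPdist_le: cu => /(_ e e0); apply: filterS => n.
rewrite sub0r normrN ger0_norm ?nrm_ge0 // distrC => h.
by apply: le_trans h; exact: nrm_ge_diff.
Qed.

Lemma cvgL2_ae (u_ v_ : nat -> Cfun R) u :
  (forall n, L2 (u_ n)) -> (forall n, L2 (v_ n)) -> L2 u ->
  (forall n, aeq (u_ n) (v_ n)) -> cvgL2 u_ u -> cvgL2 v_ u.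
Proof.
move=> a b c h; rewrite /cvgL2; apply: cvg_trans; apply: near_eq_cvg; apply: nearW => n.
apply: nrm_ae; try (by apply: L2_cmeas; exact: L2B).
apply: aeS (h n) => x hx.
by rewrite -[LHS]/(u_ n x - u x) hx.
Qed.

(** An operator that preserves distances to u preserves limits; the Fourier
    transform, translations, reflections and unimodular factors are of this
    kind. *)
Lemma cvgL2_isometry (T : Cfun R -> Cfun R) (u_ : nat -> Cfun R) u :
  (forall n, nrm (T (u_ n) - T u) = nrm (u_ n - u)) ->
  cvgL2 u_ u -> cvgL2 (fun n => T (u_ n)) (T u).
Proof. by move=> h; rewrite /cvgL2; under [X in _ -> X]eq_cvg do rewrite h. Qed.

End L2Convergence.

(** * The Fourier transform on L^2 *)

Section FourierL2.
Variable R : realType.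
Local Notation mu := (@lebesgue_measure R).
Implicit Types u v w : Cfun R.

Lemma L2_trunc u n : L2 u -> L2 (fourier_trunc u n).
Proof.
by move=> Lu; rewrite truncE; have [] := plancherel_fint (L2_cut n Lu) (cintegr_cut n Lu).
Qed.

Lemma nrm_trunc u n : L2 u -> nrm (fourier_trunc u n) = nrm (cut n u).
Proof.
move=> Lu; rewrite truncE /nrm.
by have [_ ->] := plancherel_fint (L2_cut n Lu) (cintegr_cut n Lu).
Qed.

Lemma is_fourierE u w : L2 u ->
  is_fourier u w <-> L2 w /\ cvgL2 (fourier_trunc u) w.
Proof.
move=> Lu; split=> -[Lw h]; split => //.
  move: h; under eq_cvg => n do rewrite (norm2_n2 (L2B (L2_trunc n Lu) Lw)).
  move=> /fine_cvgP[_ h].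
  have hs : Num.sqrt (n2 (fourier_trunc u n - w)) @[n --> \oo] --> Num.sqrt (0 : R).
    by apply: continuous_cvg h; exact: sqrt_continuous.
  by rewrite sqrtr0 in hs; exact: hs.
under eq_cvg => n do rewrite (norm2_n2 (L2B (L2_trunc n Lu) Lw)) -nrm_sqr.
apply: cvg_EFin; first exact: nearW.
have h2 : nrm (fourier_trunc u n - w) * nrm (fourier_trunc u n - w) @[n --> \oo] --> (0 * 0 : R).
  by apply: cvgM.
by rewrite mulr0 in h2; exact: h2.
Qed.

(** The truncations of u are a Cauchy sequence in L^2 and the Fourier integral
    is an isometry on them. *)
Lemma fourier_exists u : L2 u -> exists w, is_fourier u w.
Proof.
move=> Lu.
have [||w Lw cw] := @L2_complete R (fourier_trunc u).
- by move=> n; exact: L2_trunc.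
- move=> e e0; have e2 : 0 < e / 2 by rewrite divr_gt0.
  move/cvgrPdist_le: (cut_cvg Lu) => /(_ _ e2)[N _ hN]; exists N => m n Nm Nn.
  have Lm := L2_cut m Lu; have Ln := L2_cut n Lu.
  have cm := cintegr_cut m Lu; have cn := cintegr_cut n Lu.
  rewrite !truncE -fintB //.
  have [_ E] : L2 (fint (cut m u - cut n u)) /\ n2 (fint (cut m u - cut n u)) = n2 (cut m u - cut n u).
    apply: plancherel_fint; first exact: L2B.
    by rewrite -scaleN1r; apply: cintegrD => //; exact: cintegrZ.
  rewrite /nrm E -/(nrm _); apply: le_trans (nrm_tri Lm Ln Lu) _.
  have small k : (N <= k)%N -> nrm (cut k u - u) <= e / 2.
    by move=> /hN; rewrite sub0r normrN (ger0_norm (nrm_ge0 _)).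
  by rewrite [leRHS]splitr; apply: lerD; [exact: small|rewrite nrmBC; exact: small].
by exists w; apply/is_fourierE.
Qed.

Lemma fourierP u : L2 u -> L2 (fourier u) /\ cvgL2 (fourier_trunc u) (fourier u).
Proof.
move=> Lu; apply/is_fourierE => //.
by have [w hw] := fourier_exists Lu; exact: (xgetPex 0 (ex_intro _ w hw)).
Qed.

Lemma L2_fourier u : L2 u -> L2 (fourier u). Proof. by case/fourierP. Qed.

Local Opaque fourier.

Lemma fourier_unique u w : L2 u -> L2 w -> cvgL2 (fourier_trunc u) w -> aeq (fourier u) w.
Proof.
move=> Lu Lw cw; have [Lf cf] := fourierP Lu.
by apply: cvgL2_unique cf cw => // n; exact: L2_trunc.
Qed.

Lemma nrm_fourier u : L2 u -> nrm (fourier u) = nrm u.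
Proof.
move=> Lu; have [Lf cf] := fourierP Lu.
have h1 := cvgL2_nrm (fun n => L2_trunc n Lu) Lf cf.
have h2 : nrm (cut n u) @[n --> \oo] --> nrm u.
  by apply: cvgL2_nrm => //; [move=> n; exact: L2_cut|exact: cut_cvg].
move: h1; under eq_cvg => n do rewrite nrm_trunc //.
by move=> h1; exact: (cvg_unique _ h1 h2).
Qed.

Lemma n2_fourier u : L2 u -> n2 (fourier u) = n2 u.
Proof. by move=> Lu; rewrite -!nrm_sqr nrm_fourier. Qed.

Lemma fourierD u v : L2 u -> L2 v -> aeq (fourier (u + v)) (fourier u + fourier v).
Proof.
move=> Lu Lv; have [Lf cf] := fourierP Lu; have [Lg cg] := fourierP Lv.
apply: fourier_unique; [exact: L2D|exact: L2D|].
rewrite (_ : fourier_trunc (u + v) = (fun n => fourier_trunc u n + fourier_trunc v n)); last first.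
  by apply/funext => n; rewrite !truncE cutD fintD //; exact: cintegr_cut.
by apply: cvgL2D => // n; exact: L2_trunc.
Qed.

Lemma fourierZ z u : L2 u -> aeq (fourier (z *: u)) (z *: fourier u).
Proof.
move=> Lu; have [Lf cf] := fourierP Lu.
apply: fourier_unique; [exact: L2Z|exact: L2Z|].
rewrite (_ : fourier_trunc (z *: u) = (fun n => z *: fourier_trunc u n)); last first.
  by apply/funext => n; rewrite !truncE cutZ fintZ //; exact: cintegr_cut.
by apply: cvgL2Z => // n; exact: L2_trunc.
Qed.

Lemma aeqD u u' v v' : aeq u u' -> aeq v v' -> aeq (u + v) (u' + v').
Proof. by apply: aeS2 => x a b; rewrite -[LHS]/(u x + v x) a b. Qed.

Lemma aeqZ z u u' : aeq u u' -> aeq (z *: u) (z *: u').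
Proof. by apply: aeS => x a; rewrite -[LHS]/(z * u x) a. Qed.

Lemma aeqM (m : Cfun R) u u' : aeq u u' -> aeq (fun x => m x * u x) (fun x => m x * u' x).
Proof. by apply: aeS => x ->. Qed.

Lemma fourierB u v : L2 u -> L2 v -> aeq (fourier (u - v)) (fourier u - fourier v).
Proof.
move=> Lu Lv; rewrite -[- v]scaleN1r -[- fourier v]scaleN1r.
apply: aeq_trans (fourierD Lu (L2Z _ Lv)) _.
by apply: aeqD; [exact: aeq_refl|exact: fourierZ].
Qed.

Lemma nrm_fourierB u v : L2 u -> L2 v -> nrm (fourier u - fourier v) = nrm (u - v).
Proof.
move=> Lu Lv; rewrite -(nrm_fourier (L2B Lu Lv)); apply: nrm_ae.
- by apply: L2_cmeas; apply: L2B; exact: L2_fourier.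
- by apply: L2_cmeas; apply: L2_fourier; exact: L2B.
- by apply: aeq_sym; exact: fourierB.
Qed.

Lemma fourier_aeq u v : L2 u -> L2 v -> aeq u v -> aeq (fourier u) (fourier v).
Proof.
move=> Lu Lv h; apply: nrm_eq0_ae; [exact: L2_fourier|exact: L2_fourier|].
by rewrite nrm_fourierB //; apply: ae_nrm_eq0 => //; exact: L2_cmeas.
Qed.

Lemma fourier_cvg (u_ : nat -> Cfun R) u : (forall n, L2 (u_ n)) -> L2 u ->
  cvgL2 u_ u -> cvgL2 (fun n => fourier (u_ n)) (fourier u).
Proof.
by move=> a b; apply: cvgL2_isometry => n; exact: nrm_fourierB.
Qed.

Lemma Re_inner_fourier u v : L2 u -> L2 v ->
  Re (inner (fourier u) (fourier v)) = Re (inner u v).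
Proof.
have aux (a b c a' b' c' s t : R) : c = a + b + 2 * s -> c' = a' + b' + 2 * t ->
  c' = c -> a' = a -> b' = b -> t = s by lra.
move=> Lu Lv; have h := n2D Lu Lv.
have h2 := n2D (L2_fourier Lu) (L2_fourier Lv).
have h3 : n2 (fourier u + fourier v) = n2 (u + v).
  rewrite -(n2_fourier (L2D Lu Lv)); apply: n2_ae.
  - by apply: L2_cmeas; apply: L2D; exact: L2_fourier.
  - by apply: L2_cmeas; apply: L2_fourier; exact: L2D.
  - by apply: aeq_sym; exact: fourierD.
exact: aux h h2 h3 (n2_fourier Lu) (n2_fourier Lv).
Qed.

Lemma inner_ae u u' v v' : cmeas u -> cmeas u' -> cmeas v -> cmeas v' ->
  aeq u u' -> aeq v v' -> inner u v = inner u' v'.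
Proof.
move=> a b c d h k.
have [m1 m2] := cmeasM a (cmeasJ c); have [m3 m4] := cmeasM b (cmeasJ d).
by apply: complexP; apply: eq_Rint_ae => //; apply: aeS2 h k => x -> ->.
Qed.

Lemma Re_innerZi u v : L2 u -> L2 v -> Re (inner u ('i *: v)) = Im (inner u v).
Proof. by move=> Lu Lv; rewrite innerZr // ReImE /= mul0r sub0r mulN1r opprK. Qed.

(** Polarization: an isometry preserves real parts of inner products, and
    imaginary parts are real parts after multiplication by i. *)
Lemma inner_fourier u v : L2 u -> L2 v -> inner (fourier u) (fourier v) = inner u v.
Proof.
move=> Lu Lv; apply: complexP; first exact: Re_inner_fourier.
have Lf := L2_fourier Lu; have Lg := L2_fourier Lv.
have K := Re_inner_fourier Lu (L2Z 'i Lv).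
have E : inner (fourier u) (fourier ('i *: v)) = inner (fourier u) ('i *: fourier v).
  apply: inner_ae; [exact: L2_cmeas|exact: L2_cmeas| | |exact: aeq_refl|exact: fourierZ].
    by apply: L2_cmeas; apply: L2_fourier; exact: L2Z.
  by apply: L2_cmeas; exact: L2Z.
apply: etrans (esym (Re_innerZi Lf Lg)) _; apply: etrans (esym (congr1 _ E)) _.
by apply: etrans K _; exact: Re_innerZi.
Qed.

Lemma fourier_fint u : L2 u -> cintegr u -> aeq (fourier u) (fint u).
Proof.
move=> Lu cu; have [Lf _] := plancherel_fint Lu cu.
apply: fourier_unique => //.
rewrite (_ : fourier_trunc u = (fun n => fint (cut n u))); last by apply/funext => n; rewrite truncE.
apply: cvgL2_isometry; last exact: cut_cvg.
move=> n; have Ln := L2_cut n Lu; have cn := cintegr_cut n Lu.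
rewrite -fintB // /nrm.
have [_ -> //] : L2 (fint (cut n u - u)) /\ n2 (fint (cut n u - u)) = n2 (cut n u - u).
apply: plancherel_fint; first exact: L2B.
by rewrite -scaleN1r; apply: cintegrD => //; exact: cintegrZ.
Qed.

Lemma expNiD (s t : R) : expNi (s + t) = expNi s * expNi t.
Proof. by apply: complexP; rewrite !ReImE /= ?cosD ?sinD; ring. Qed.

Lemma conjcM (z w : R[i]) : (z * w)^*%C = z^*%C * w^*%C.
Proof. exact: (rmorphM (@conjc R)). Qed.

Lemma expNiN (t : R) : expNi (- t) = (expNi t)^*.
Proof. by rewrite /expNi cosN sinN. Qed.

Lemma Cint_tau h u : cintegr u -> Cintegral setT (tau h u) = Cintegral setT u.
Proof. by move=> [a b]; apply: complexP; rewrite /= /tau ?(Rint_shift h a) ?(Rint_shift h b). Qed.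

Lemma Cint_refl u : cintegr u -> Cintegral setT (refl u) = Cintegral setT u.
Proof. by move=> [a b]; apply: complexP; rewrite /= /refl ?(Rint_opp a) ?(Rint_opp b). Qed.

Lemma CintJ u : cintegr u -> Cintegral setT (fun x => (u x)^*) = (Cintegral setT u)^*.
Proof.
move=> [a b]; apply: complexP; rewrite /= -?RintN //;
  by apply: eq_Rintegral => x _; rewrite ?cReJ ?cImJ.
Qed.

Lemma fint_tau h u : cintegr u ->
  fint (tau h u) = (fun xi => (expNi (h * xi))^* * fint u xi).
Proof.
move=> cu; apply/funext => xi; rewrite /fint mulrCA; congr (_ * _).
have c0 := cintegr_expNi xi cu.
transitivity (expNi (- (h * xi)) * Cintegral setT (fun x => u x * expNi (x * xi))); last first.
  by rewrite expNiN.
rewrite -CintZ; last exact: cintegr_expNi.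
rewrite -[RHS](Cint_tau h); last exact: cintegrZ.
congr Cintegral; apply/funext => x; rewrite /tau -[RHS]/(_ * (_ * _)) mulrCA -expNiD.
by congr (_ * expNi _); ring.
Qed.

Lemma L2_unimod (m : Cfun R) u : cmeas m -> (forall x, normc2 (m x) = 1) -> L2 u ->
  L2 (fun x => m x * u x).
Proof. by move=> cm m1 Lu; apply: (L2M (B := 1) cm Lu) => x; rewrite m1. Qed.

Lemma nrm_unimod (m : Cfun R) u v : (forall x, normc2 (m x) = 1) ->
  nrm ((fun x => m x * u x) - (fun x => m x * v x)) = nrm (u - v).
Proof.
move=> m1; rewrite /nrm; congr Num.sqrt; apply: eq_Rintegral => x _.
by rewrite -[(_ - _) x]/(m x * u x - m x * v x) -mulrBr normc2M m1 mul1r.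
Qed.

Lemma cmeas_expNiJ h : cmeas (fun xi : R => (expNi (h * xi))^* : R[i]^o).
Proof. by have := cmeasJ (cmeas_expNi h); under eq_fun do rewrite mulrC. Qed.

(** Both sides depend continuously on u, and for a truncation of u the
    identity is the translation rule for Fourier integrals. *)
Lemma fourier_tau h u : L2 u ->
  aeq (fourier (tau h u)) (fun xi => (expNi (h * xi))^* * fourier u xi).
Proof.
move=> Lu; have m1 x : normc2 ((expNi (h * x))^* : R[i]) = 1 by rewrite normc2J normc2_expNi.
have Lf := L2_fourier Lu; have Lt := L2_tau h Lu.
have Lc n := L2_cut n Lu; have Ltc n := L2_tau h (Lc n).
have h1 : cvgL2 (fun n => fourier (tau h (cut n u))) (fourier (tau h u)).
  apply: fourier_cvg => //; apply: cvgL2_isometry; last exact: cut_cvg.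
  by move=> n; rewrite -tauB nrm_tau //; exact: L2B.
have h2 : cvgL2 (fun n => (fun xi => (expNi (h * xi))^* * fourier (cut n u) xi) : Cfun R)
    (fun xi => (expNi (h * xi))^* * fourier u xi).
  apply: (@cvgL2_isometry _ (fun v xi => (expNi (h * xi))^* * fourier v xi)).
    by move=> n; rewrite nrm_unimod // nrm_fourierB.
  exact: cut_cvg.
apply: (cvgL2_unique _ _ _ h1).
- by move=> n; exact: L2_fourier.
- exact: L2_fourier.
- exact: (L2_unimod (cmeas_expNiJ h)).
apply: cvgL2_ae h2.
- by move=> n; exact: (L2_unimod (cmeas_expNiJ h) m1 (L2_fourier (Lc n))).
- by move=> n; exact: L2_fourier.
- exact: (L2_unimod (cmeas_expNiJ h)).
move=> n; have cn := cintegr_cut n Lu.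
have ct : cintegr (tau h (cut n u)) by case: cn => a b; split; [exact: (integr_shift h a)|exact: (integr_shift h b)].
apply: aeq_sym; apply: aeq_trans (fourier_fint (Ltc n) ct) _; rewrite fint_tau //.
by apply: aeqM; apply: aeq_sym; exact: fourier_fint.
Qed.

Lemma cut_refl n u : cut n (refl u) = refl (cut n u).
Proof.
apply/funext => x; rewrite /cut /refl !indicE; congr (_%:R%:C * _); congr nat_of_bool.
by rewrite !mem_setE !in_itv /= [in RHS]lerN2 [in RHS]lerNl andbC.
Qed.

Lemma fint_refl u : cintegr u -> fint (refl u) = refl (fint u).
Proof.
move=> cu; apply/funext => xi; rewrite /refl /fint; congr (_ * _).
rewrite -(Cint_refl (cintegr_expNi _ cu)); congr Cintegral; apply/funext => x.
by rewrite /refl mulrNN.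
Qed.

Lemma nrm_refl u v : L2 u -> L2 v -> nrm (refl u - refl v) = nrm (u - v).
Proof. by move=> Lu Lv; rewrite /nrm -(n2_refl (L2B Lu Lv)). Qed.

Lemma fourier_refl u : L2 u -> aeq (fourier (refl u)) (refl (fourier u)).
Proof.
move=> Lu; have [Lf cf] := fourierP Lu.
apply: fourier_unique; [exact: L2_refl|exact: L2_refl|].
rewrite (_ : fourier_trunc (refl u) = (fun n => refl (fourier_trunc u n))); last first.
  by apply/funext => n; rewrite !truncE cut_refl fint_refl //; exact: cintegr_cut.
by rewrite /cvgL2; under eq_cvg => n do rewrite (nrm_refl (L2_trunc n Lu) Lf).
Qed.

Lemma fourierJ u : L2 u -> aeq (fourier (fun x => (u x)^*)) (fun xi => (refl (fourier u) xi)^*).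
Proof.
move=> Lu; have [Lf cf] := fourierP Lu; have LJ := L2J Lu.
apply: fourier_unique => //; first by apply: L2J; exact: L2_refl.
rewrite (_ : fourier_trunc (fun x => (u x)^*) = (fun n => (fun xi => (refl (fourier_trunc u n) xi)^*) : Cfun R)); last first.
  apply/funext => n; rewrite !truncE; apply/funext => xi; rewrite /refl /fint conjcM; congr (_ * _).
    exact/esym/conjc_real.
  transitivity (Cintegral setT (fun x => (cut n u x * expNi (x * - xi))^*)); last first.
    by apply: CintJ; apply: cintegr_expNi; exact: cintegr_cut.
  congr Cintegral; apply/funext => x; rewrite mulrN expNiN !conjcM.
  rewrite (_ : (expNi (x * xi))^*%C^*%C = expNi (x * xi)); last exact: conjcK.
  by congr (_ * _ * _); exact/esym/conjc_real.
rewrite /cvgL2; apply: cvg_trans cf; apply: near_eq_cvg; apply: nearW => n.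
rewrite -(nrm_refl (L2_trunc n Lu) Lf) /nrm -n2J; congr Num.sqrt.
by apply: eq_Rintegral => x _; congr normc2; exact: (rmorphB (@conjc R)).
Qed.

End FourierL2.

Local Opaque fourier.

(** * The multiplication formula and Fourier inversion *)

Section Inversion.
Variable R : realType.
Local Notation mu := (@lebesgue_measure R).
Implicit Types u v w : Cfun R.

Lemma meas2_arg : @meas2 R (fun x y => x * y).
Proof. by apply: meas2M; [apply: meas2_l|apply: meas2_r]; exact: measurable_id. Qed.

(** The kernel cos (x xi) is symmetric and bounded, so this is Fubini's
    theorem. *)
Lemma cosT_sym (f h : R -> R) : integr f -> integr h ->
  integr (fun y => f y * cosT h y) /\
  \int[mu]_y (f y * cosT h y) = \int[mu]_x (cosT f x * h x).
Proof.
move=> fi hi.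
have mb : meas2 (fun x y : R => cos (y * x)).
  under eq_fun do under eq_fun do rewrite mulrC.
  by apply: meas2_comp meas2_arg; apply: continuous_measurable_fun; exact: continuous_cos.
have bb (x y : R) : `|cos (y * x)| <= 1 by exact: cos_max.
have [h1 h2] := fubini_kernel fi hi mb bb; split; first exact: h1.
apply: etrans h2 _; apply: eq_Rintegral => x _; rewrite mulrC; congr (_ * _).
by apply: eq_Rintegral => y _; rewrite mulrC [x * y]mulrC mulrC.
Qed.

Lemma sinT_sym (f h : R -> R) : integr f -> integr h ->
  integr (fun y => f y * sinT h y) /\
  \int[mu]_y (f y * sinT h y) = \int[mu]_x (sinT f x * h x).
Proof.
move=> fi hi.
have mb : meas2 (fun x y : R => sin (y * x)).
  under eq_fun do under eq_fun do rewrite mulrC.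
  by apply: meas2_comp meas2_arg; apply: continuous_measurable_fun; exact: continuous_sin.
have bb (x y : R) : `|sin (y * x)| <= 1 by exact: sin_max.
have [h1 h2] := fubini_kernel fi hi mb bb; split; first exact: h1.
apply: etrans h2 _; apply: eq_Rintegral => x _; rewrite mulrC; congr (_ * _).
by apply: eq_Rintegral => y _; rewrite mulrC [x * y]mulrC mulrC.
Qed.

Lemma RintLC (a b c d : R -> R) (s t : R) : integr a -> integr b -> integr c -> integr d ->
  \int[mu]_x (a x + b x + s * c x + t * d x) =
  \int[mu]_x a x + \int[mu]_x b x + s * \int[mu]_x c x + t * \int[mu]_x d x.
Proof.
move=> ia ib ic id.
rewrite RintD; [|by apply: integrD; [exact: integrD|exact: integrZ]|exact: integrZ].
by rewrite RintD; [|exact: integrD|exact: integrZ]; rewrite RintD // !RintZ.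
Qed.

(** The kernel exp(- i x xi) is symmetric; the four real cases are [cosT_sym]
    and [sinT_sym]. *)
Lemma fint_mult u v : cintegr u -> cintegr v ->
  Cintegral setT (fun x => fint u x * v x) = Cintegral setT (fun x => u x * fint v x).
Proof.
move=> cu cv; have [fi gi] := cu; have [pr qi] := cv.
set c : R := (Num.sqrt (2 * pi))^-1.
set f := (fun x => Re (u x)) in fi; set g := (fun x => Im (u x)) in gi.
set p := (fun x => Re (v x)) in pr; set q := (fun x => Im (v x)) in qi.
have E (a b : R -> R) : \int[mu]_x (a x * b x) = \int[mu]_x (b x * a x).
  by apply: eq_Rintegral => x _; rewrite mulrC.
have lin (F a b d e : R -> R) (s t : R) : (forall x, F x = c * (a x + b x + s * d x + t * e x)) ->
    integr a -> integr b -> integr d -> integr e ->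
  \int[mu]_x F x = c * (\int[mu]_x a x + \int[mu]_x b x + s * \int[mu]_x d x + t * \int[mu]_x e x).
  move=> FE ia ib id ie; rewrite -RintLC // -RintZ; first by apply: eq_Rintegral => x _; exact: FE.
  by apply: integrD; [apply: integrD; [exact: integrD|exact: integrZ]|exact: integrZ].
apply: complexP; rewrite /=.
  rewrite (lin _ _ _ _ _ (-1) 1 _ (cosT_sym pr fi).1 (sinT_sym pr gi).1
    (cosT_sym qi gi).1 (sinT_sym qi fi).1); last by move=> x; rewrite fintE // -/c
      !ReImE /= -/f -/g -/(p x) -/(q x); ring.
  rewrite [RHS](lin _ _ _ _ _ (-1) 1 _ (cosT_sym fi pr).1 (sinT_sym gi pr).1
    (cosT_sym gi qi).1 (sinT_sym fi qi).1); last by move=> x; rewrite fintE // -/c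
      !ReImE /= -/p -/q -/(f x) -/(g x); ring.
  rewrite (cosT_sym fi pr).2 (sinT_sym gi pr).2 (cosT_sym gi qi).2 (sinT_sym fi qi).2.
  by rewrite !(E (cosT _)) !(E (sinT _)).
rewrite (lin _ _ _ _ _ 1 (-1) _ (cosT_sym qi fi).1 (sinT_sym qi gi).1
  (cosT_sym pr gi).1 (sinT_sym pr fi).1); last by move=> x; rewrite fintE // -/c
    !ReImE /= -/f -/g -/(p x) -/(q x); ring.
rewrite [RHS](lin _ _ _ _ _ 1 (-1) _ (cosT_sym fi qi).1 (sinT_sym gi qi).1
  (cosT_sym gi pr).1 (sinT_sym fi pr).1); last by move=> x; rewrite fintE // -/c
    !ReImE /= -/p -/q -/(f x) -/(g x); ring.
rewrite (cosT_sym fi qi).2 (sinT_sym gi qi).2 (cosT_sym gi pr).2 (sinT_sym fi pr).2.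
by rewrite !(E (cosT _)) !(E (sinT _)).
Qed.

Lemma Re_inner_cvg (u_ v_ : nat -> Cfun R) u v :
  (forall n, L2 (u_ n)) -> L2 u -> (forall n, L2 (v_ n)) -> L2 v ->
  cvgL2 u_ u -> cvgL2 v_ v -> Re (inner (u_ n) (v_ n)) @[n --> \oo] --> Re (inner u v).
Proof.
move=> Lu_ Lu Lv_ Lv cu cv.
have E (a b : Cfun R) : L2 a -> L2 b -> Re (inner a b) =
    2^-1 * (nrm (a + b) * nrm (a + b) - nrm a * nrm a - nrm b * nrm b).
  move=> La Lb; have := n2D La Lb; rewrite -!expr2 !nrm_sqr => ->.
  by move: (n2 a) (n2 b) (Re _) => x y z; lra.
rewrite (E _ _ Lu Lv); under eq_cvg => n do rewrite (E _ _ (Lu_ n) (Lv_ n)).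
have c0 := cvgL2_nrm Lu_ Lu cu; have c1 := cvgL2_nrm Lv_ Lv cv.
have c2 := cvgL2_nrm (fun n => L2D (Lu_ n) (Lv_ n)) (L2D Lu Lv) (cvgL2D Lu_ Lu Lv_ Lv cu cv).
apply: cvgM; first exact: cvg_cst.
by apply: cvgB; [apply: cvgB|]; exact: cvgM.
Qed.

Lemma inner_cvg_eq (u_ v_ u'_ v'_ : nat -> Cfun R) u v u' v' :
  (forall n, L2 (u_ n)) -> L2 u -> (forall n, L2 (v_ n)) -> L2 v ->
  (forall n, L2 (u'_ n)) -> L2 u' -> (forall n, L2 (v'_ n)) -> L2 v' ->
  cvgL2 u_ u -> cvgL2 v_ v -> cvgL2 u'_ u' -> cvgL2 v'_ v' ->
  (forall n, inner (u_ n) (v_ n) = inner (u'_ n) (v'_ n)) -> inner u v = inner u' v'.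
Proof.
move=> a b c d a' b' c' d' h1 h2 h3 h4 E; apply: complexP.
  have k1 := Re_inner_cvg a b c d h1 h2; have k2 := Re_inner_cvg a' b' c' d' h3 h4.
  by move: k1; under eq_cvg => n do rewrite E; move=> k1; exact: (cvg_unique _ k1 k2).
have k1 := Re_inner_cvg a b (fun n => L2Z 'i (c n)) (L2Z 'i d) h1 (cvgL2Z 'i c d h2).
have k2 := Re_inner_cvg a' b' (fun n => L2Z 'i (c' n)) (L2Z 'i d') h3 (cvgL2Z 'i c' d' h4).
rewrite Re_innerZi // in k1; rewrite Re_innerZi // in k2.
move: k1; under eq_cvg => n do rewrite (Re_innerZi (a n) (c n)) E -(Re_innerZi (a' n) (c' n)).
by move=> k1; exact: (cvg_unique _ k1 k2).
Qed.

Definition cbar u : Cfun R := fun x => (u x)^*.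

Lemma cbarK u : cbar (cbar u) = u.
Proof. by apply/funext => x; exact: conjcK. Qed.

Lemma L2_cbar u : L2 u -> L2 (cbar u). Proof. exact: L2J. Qed.

Lemma cvgL2_cbar (u_ : nat -> Cfun R) u : cvgL2 u_ u -> cvgL2 (fun n => cbar (u_ n)) (cbar u).
Proof.
apply: cvgL2_isometry => n; rewrite /nrm; congr Num.sqrt.
rewrite -(n2J (u_ n - u)); apply: eq_Rintegral => x _; congr normc2.
exact/esym/(rmorphB (@conjc R)).
Qed.

Lemma inner_cbar u v : inner u (cbar v) = Cintegral setT (fun x => u x * v x).
Proof. by congr Cintegral; apply/funext => x; congr (_ * _); exact: conjcK. Qed.

(** The identity [fint_mult] for truncations, passed to the limit. The
    conjugate [cbar] turns the sesquilinear inner product into the bilinear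
    pairing. *)
Lemma fourier_mult u v : L2 u -> L2 v -> inner (fourier u) (cbar v) = inner u (cbar (fourier v)).
Proof.
move=> Lu Lv; have [Lf cf] := fourierP Lu; have [Lg cg] := fourierP Lv.
apply: (inner_cvg_eq (fun n => L2_trunc n Lu) Lf (fun n => L2_cbar (L2_cut n Lv)) (L2_cbar Lv)
  (fun n => L2_cut n Lu) Lu (fun n => L2_cbar (L2_trunc n Lv)) (L2_cbar Lg)) => //.
- by apply: cvgL2_cbar; exact: cut_cvg.
- exact: cut_cvg.
- exact: cvgL2_cbar.
- move=> n; rewrite !inner_cbar !truncE; apply: fint_mult; exact: cintegr_cut.
Qed.

Lemma L2_ifourier w : L2 w -> L2 (ifourier w).
Proof. by move=> Lw; apply: L2_refl; exact: L2_fourier. Qed.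

Lemma fourier_adjoint u w : L2 u -> L2 w -> inner (fourier u) w = inner u (ifourier w).
Proof.
move=> Lu Lw; have Lb := L2_cbar Lw.
rewrite -[in LHS](cbarK w) fourier_mult //; apply: inner_ae.
- exact: L2_cmeas.
- exact: L2_cmeas.
- by apply: L2_cmeas; apply: L2_cbar; exact: L2_fourier.
- by apply: L2_cmeas; exact: L2_ifourier.
- exact: aeq_refl.
- by apply: aeS (fourierJ Lw) => x E; rewrite /cbar E; exact: conjcK.
Qed.

Lemma inner_eq0_ae u v : L2 u -> L2 v -> (forall w, L2 w -> inner w u = inner w v) -> aeq u v.
Proof.
move=> Lu Lv h; have Luv := L2B Lu Lv; apply: nrm_eq0_ae => //.
have := h _ Luv; move=> E; have : inner (u - v) (u - v) = 0 by rewrite innerBr // E subrr.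
rewrite inner_self => /(congr1 (@complex.Re R)) /= h0.
by rewrite /nrm h0 sqrtr0.
Qed.

(** For every w, inner w (ifourier (fourier v)) is inner (fourier w) (fourier
    v) by [fourier_adjoint], which is inner w v by Plancherel. *)
Lemma ifourierK v : L2 v -> aeq (ifourier (fourier v)) v.
Proof.
move=> Lv; have Lf := L2_fourier Lv; apply: inner_eq0_ae => //; first exact: L2_ifourier.
by move=> w Lw; rewrite -fourier_adjoint // inner_fourier.
Qed.

(** The transform commutes with the reflection, so this reduces to
    [ifourierK]. *)
Lemma fourierK w : L2 w -> aeq (fourier (ifourier w)) w.
Proof.
move=> Lw; apply: aeq_trans (fourier_refl (L2_fourier Lw)) _; exact: ifourierK.
Qed.

Lemma nrm_ifourier w : L2 w -> nrm (ifourier w) = nrm w.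
Proof. by move=> Lw; rewrite -(nrm_fourier Lw) /nrm -(n2_refl (L2_fourier Lw)). Qed.

Lemma aeq_fourier_inj u v : L2 u -> L2 v -> aeq (fourier u) (fourier v) -> aeq u v.
Proof.
move=> Lu Lv h; apply: nrm_eq0_ae => //.
rewrite -(nrm_fourierB Lu Lv); apply: ae_nrm_eq0 => //; apply: L2_cmeas; exact: L2_fourier.
Qed.

End Inversion.

(** * Fourier multipliers and the spaces H^k *)

Section Sobolev.
Variable R : realType.
Local Notation mu := (@lebesgue_measure R).
Implicit Types u v w m p : Cfun R.

Definition pmul m u : Cfun R := fun x => m x * u x.

Definition hnorm2 k u : R := \int[mu]_xi ((1 + xi ^+ 2) ^+ k * normc2 (fourier u xi)).

Lemma fine_Hnorm2 k u : fine (Hnorm2 k u) = hnorm2 k u.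
Proof. by []. Qed.

Lemma jw_ge1 k (xi : R) : 1 <= (1 + xi ^+ 2) ^+ k.
Proof. by apply: exprn_ege1; rewrite lerDl sqr_ge0. Qed.

Lemma jw_ge0 k (xi : R) : 0 <= (1 + xi ^+ 2) ^+ k.
Proof. exact: le_trans ler01 (jw_ge1 _ _). Qed.

Lemma meas_jw k : meas (fun xi : R => (1 + xi ^+ 2) ^+ k).
Proof.
apply: (@measurable_funX _ _ _ _ _ k); by apply: measurable_funD => //.
Qed.

Lemma meas_jwn k w : cmeas w -> meas (fun xi => (1 + xi ^+ 2) ^+ k * normc2 (w xi)).
Proof. by move=> cw; apply: measurable_funM; [exact: meas_jw|exact: meas_normc2]. Qed.

Lemma jwn_ge0 k w xi : 0 <= (1 + xi ^+ 2) ^+ k * normc2 (w xi).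
Proof. by rewrite mulr_ge0 ?jw_ge0 ?normc2_ge0. Qed.

Lemma HP k u : H k u <->
  L2 u /\ integr (fun xi => (1 + xi ^+ 2) ^+ k * normc2 (fourier u xi)).
Proof.
split=> -[Lu h]; split => //; have cf := L2_cmeas (L2_fourier Lu).
  by apply: integr_ge0P => //; [exact: meas_jwn|exact: jwn_ge0].
exact: integr_fin.
Qed.

Lemma H_L2 k u : H k u -> L2 u. Proof. by case. Qed.

Lemma hnorm2_ge0 k u : 0 <= hnorm2 k u.
Proof. by apply: Rintegral_ge0 => x _; exact: jwn_ge0. Qed.

(** Symbols of order k: the multiplier by m maps H^k to L^2 with norm at most
    the square root of K. *)
Definition symb k m K := cmeas m /\ forall xi, normc2 (m xi) <= K * (1 + xi ^+ 2) ^+ k.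

Lemma L2_symb k m K u : symb k m K -> H k u -> L2 (pmul m (fourier u)).
Proof.
move=> [cm mK] /HP[Lu iu]; have cf := L2_cmeas (L2_fourier Lu).
apply/L2P; split; first exact: cmeasM.
apply: (integr_le _ (integrZ K iu)); first by apply: meas_normc2; exact: cmeasM.
move=> x; rewrite ger0_norm ?normc2_ge0 // normc2M mulrA.
by apply: ler_wpM2r; [exact: normc2_ge0|exact: mK].
Qed.

Lemma n2_symb k m K u : symb k m K -> H k u -> n2 (pmul m (fourier u)) <= K * hnorm2 k u.
Proof.
move=> sm hu; have /L2P[_ i1] := L2_symb sm hu.
have [Lu iu] := (HP k u).1 hu; have [cm mK] := sm.
rewrite /hnorm2 -RintZ //; apply: Rint_le => //; first exact: integrZ.
move=> x; rewrite normc2M mulrA.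
by apply: ler_wpM2r; [exact: normc2_ge0|exact: mK].
Qed.

Lemma H_mono j k u : (j <= k)%N -> H k u -> H j u.
Proof.
move=> jk /HP[Lu iu]; apply/HP; split => //; have cf := L2_cmeas (L2_fourier Lu).
apply: (integr_le (meas_jwn _ cf) iu) => xi; rewrite ger0_norm ?jwn_ge0 //.
apply: ler_wpM2r; first exact: normc2_ge0.
by apply: ler_weXn2l => //; rewrite lerDl sqr_ge0.
Qed.

Lemma H2_H1 u : H 2 u -> H 1 u. Proof. exact: H_mono. Qed.

Lemma n2_le_hnorm2 k u : H k u -> n2 u <= hnorm2 k u.
Proof.
move=> /HP[Lu iu]; rewrite -(n2_fourier Lu); have Lf := L2_fourier Lu.
apply: Rint_le => //; first exact: L2_integr.
by move=> x; rewrite ler_peMl ?normc2_ge0 ?jw_ge1.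
Qed.

Lemma integr_jwn_ae k w (f : R -> R) : cmeas w -> integr f ->
  {ae mu, forall x, (1 + x ^+ 2) ^+ k * normc2 (w x) = f x} ->
  integr (fun xi => (1 + xi ^+ 2) ^+ k * normc2 (w xi)).
Proof.
move=> cw fi h; apply: integr_ge0P; [exact: meas_jwn|exact: jwn_ge0|].
have E : (\int[mu]_x ((1 + x ^+ 2) ^+ k * normc2 (w x))%:E =
    \int[mu]_x (f x)%:E)%E.
  apply: ae_eq_integral => //.
  - by apply: meas_EFin; exact: meas_jwn.
  - by apply: meas_EFin; exact: integr_meas.
  - by apply: aeS h => x -> _.
by rewrite E; exact: integr_fin.
Qed.

Lemma H_of_fourier k u v : L2 u -> H k v -> aeq (fourier u) (fourier v) -> H k u.
Proof.
move=> Lu /HP[Lv iv] h; apply/HP; split; first exact: Lu.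
apply: (integr_jwn_ae (L2_cmeas (L2_fourier Lu)) iv) => //.
by apply: aeS h => x ->.
Qed.

Lemma H_aeq k u v : cmeas v -> H k u -> aeq u v -> H k v.
Proof.
move=> cv hu h; have Lu := H_L2 hu; have Lv := L2_ae cv Lu h.
by apply: (H_of_fourier Lv hu); apply: fourier_aeq => //; exact: aeq_sym.
Qed.

Lemma HD k u v : H k u -> H k v -> H k (u + v).
Proof.
move=> /HP[Lu iu] /HP[Lv iv]; have L := L2D Lu Lv; apply/HP; split; first exact: L.
have cf := L2_cmeas (L2_fourier Lu); have cg := L2_cmeas (L2_fourier Lv).
have cs := L2_cmeas (L2_fourier L).
have ci : integr (fun xi => (1 + xi ^+ 2) ^+ k * normc2 ((fourier u + fourier v) xi)).
  have i2 := integrZ 2 (integrD iu iv).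
  apply: (integr_le _ i2); first by apply: meas_jwn; exact: cmeasD.
  move=> x; rewrite ger0_norm ?jwn_ge0 // -mulrDr mulrCA; apply: ler_wpM2l (jw_ge0 _ _) _ _ _.
  by rewrite mulrDr; exact: (normc2D_le (fourier u x) (fourier v x)).
by apply: (integr_jwn_ae cs ci); apply: aeS (fourierD Lu Lv) => x ->.
Qed.

Lemma hnorm2Z k z u : H k u -> hnorm2 k (z *: u) = normc2 z * hnorm2 k u.
Proof.
move=> /HP[Lu iu]; rewrite /hnorm2 -RintZ //; apply: eq_Rint_ae.
- by apply: meas_jwn; apply: L2_cmeas; apply: L2_fourier; exact: L2Z.
- by apply: measurable_funM => //; apply: meas_jwn; apply: L2_cmeas; exact: L2_fourier.
- apply: aeS (fourierZ z Lu) => x ->.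
  by rewrite -[(z *: _) x]/(z * fourier u x) normc2M mulrCA.
Qed.

Lemma HZ k z u : H k u -> H k (z *: u).
Proof.
move=> /HP[Lu iu]; apply/HP; split; first exact: L2Z.
have cs := L2_cmeas (L2_fourier (L2Z z Lu)).
apply: (integr_jwn_ae cs (integrZ (normc2 z) iu)).
apply: aeS (fourierZ z Lu) => x ->.
by rewrite -[(z *: _) x]/(z * fourier u x) normc2M mulrCA.
Qed.

Lemma HB k u v : H k u -> H k v -> H k (u - v).
Proof. by move=> a b; rewrite -scaleN1r; apply: HD a _; exact: HZ. Qed.

Lemma L2_multiplier m u : L2 (pmul m (fourier u)) -> L2 (multiplier m u).
Proof. exact: L2_ifourier. Qed.

Lemma fourier_multiplier m u : L2 (pmul m (fourier u)) ->
  aeq (fourier (multiplier m u)) (pmul m (fourier u)).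
Proof. exact: fourierK. Qed.

Lemma nrm_multiplier m u : L2 (pmul m (fourier u)) ->
  nrm (multiplier m u) = nrm (pmul m (fourier u)).
Proof. exact: nrm_ifourier. Qed.

Lemma n2_multiplier m u : L2 (pmul m (fourier u)) ->
  n2 (multiplier m u) = n2 (pmul m (fourier u)).
Proof. by move=> h; rewrite -!nrm_sqr nrm_multiplier. Qed.

Lemma inner_multiplier m u v : L2 (pmul m (fourier u)) -> L2 v ->
  inner (multiplier m u) v = inner (pmul m (fourier u)) (fourier v).
Proof.
move=> h Lv; rewrite -(inner_fourier (L2_multiplier h) Lv); apply: inner_ae.
- by apply: L2_cmeas; apply: L2_fourier; exact: L2_multiplier.
- exact: L2_cmeas.
- by apply: L2_cmeas; exact: L2_fourier.
- by apply: L2_cmeas; exact: L2_fourier.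
- exact: fourier_multiplier.
- exact: aeq_refl.
Qed.

Lemma multiplierD m u v : L2 u -> L2 v ->
  L2 (pmul m (fourier u)) -> L2 (pmul m (fourier v)) -> L2 (pmul m (fourier (u + v))) ->
  aeq (multiplier m (u + v)) (multiplier m u + multiplier m v).
Proof.
move=> Lu Lv a b c; have La := L2_multiplier a; have Lb := L2_multiplier b.
apply: aeq_fourier_inj; [exact: L2_multiplier|exact: L2D|].
apply: aeq_trans (fourier_multiplier c) _.
apply: aeq_trans (aeq_sym (fourierD La Lb)).
apply: aeq_trans (aeq_sym (aeqD (fourier_multiplier a) (fourier_multiplier b))).
by apply: aeS (fourierD Lu Lv) => x E; rewrite /pmul E; exact: mulrDr.
Qed.

Lemma multiplierZ m z u : L2 u -> L2 (pmul m (fourier u)) -> L2 (pmul m (fourier (z *: u))) ->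
  aeq (multiplier m (z *: u)) (z *: multiplier m u).
Proof.
move=> Lu a c; have La := L2_multiplier a.
apply: aeq_fourier_inj; [exact: L2_multiplier|exact: L2Z|].
apply: aeq_trans (fourier_multiplier c) _.
apply: aeq_trans (aeq_sym (fourierZ z La)).
apply: aeq_trans (aeq_sym (aeqZ z (fourier_multiplier a))).
by apply: aeS (fourierZ z Lu) => x E; rewrite /pmul E; exact: mulrCA.
Qed.

Lemma multiplier_aeq m u v : L2 u -> L2 v -> aeq u v ->
  L2 (pmul m (fourier u)) -> L2 (pmul m (fourier v)) ->
  aeq (multiplier m u) (multiplier m v).
Proof.
move=> Lu Lv h a b; apply: aeq_fourier_inj; [exact: L2_multiplier|exact: L2_multiplier|].
apply: aeq_trans (fourier_multiplier a) _.
apply: aeq_trans (aeq_sym (fourier_multiplier b)).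
by apply: aeqM; exact: fourier_aeq.
Qed.

Lemma symb_multiplier j k m K u : symb j m K -> H (k + j) u -> H k (multiplier m u).
Proof.
move=> sm hu; have L := L2_symb sm (H_mono (leq_addl k j) hu).
have LM := L2_multiplier L; apply/HP; split; first exact: LM.
have [Lu iu] := (HP _ _).1 hu; have cM := L2_cmeas (L2_fourier LM).
have i2 : integr (fun xi => (1 + xi ^+ 2) ^+ k * normc2 (pmul m (fourier u) xi)).
  apply: (integr_le _ (integrZ K iu)); first by apply: meas_jwn; exact: L2_cmeas.
  move=> x; rewrite ger0_norm ?jwn_ge0 // normc2M exprD.
  rewrite [leRHS](_ : _ = (1 + x ^+ 2) ^+ k * ((K * (1 + x ^+ 2) ^+ j) * normc2 (fourier u x))); last by ring.
  by apply: ler_wpM2l (jw_ge0 _ _) _ _ _; apply: ler_wpM2r (normc2_ge0 _) _ _ _; exact: sm.2.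
by apply: (integr_jwn_ae cM i2); apply: aeS (fourier_multiplier L) => x ->.
Qed.

Lemma symb_Dx k : symb k (fun xi : R => (xi *i) ^+ k) 1.
Proof.
have nX n (z : R[i]) : normc2 (z ^+ n) = normc2 z ^+ n.
  by elim: n => [|n IH]; rewrite ?expr0 ?normc2_real ?expr1n // !exprS normc2M IH.
split; last first.
  move=> xi; rewrite mul1r nX; apply: lerXn2r; rewrite ?nnegrE ?normc2_ge0 //.
    by rewrite addr_ge0 ?sqr_ge0.
  by rewrite /normc2 /= expr0n add0r lerDr.
have c1 : cmeas (fun xi : R => xi *i : R[i]^o).
  by split; [exact: measurable_cst|exact: measurable_id].
elim: k => [|k IH]; first exact: cmeas_cst.
by under eq_fun do rewrite exprS; exact: (cmeasM c1 IH).
Qed.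

Lemma symb_abs : symb 1 (fun xi : R => `|xi|%:C) 1.
Proof.
split; first by apply: cmeas_real; exact: normr_measurable.
by move=> xi; rewrite normc2_real real_normK ?num_real // mul1r expr1 lerDr.
Qed.

Lemma hnorm2_1 u : H 1 u -> hnorm2 1 u = n2 u + n2 (Dx 1 u).
Proof.
move=> hu; have [Lu iu] := (HP 1 u).1 hu; have L := L2_symb (symb_Dx 1) hu.
rewrite (n2_multiplier L) -(n2_fourier Lu) /n2 -RintD; first last.
- exact: L2_integr.
- by apply: L2_integr; exact: L2_fourier.
apply: eq_Rintegral => x _; rewrite normc2M expr1 mulrDl mul1r; congr (_ + _ * _).
by rewrite expr1 /normc2 /= expr0n add0r.
Qed.

(** On the Fourier side (1 + xi^2)^2 = (1 + xi^2) + (1 + xi^2) xi^2. *)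
Lemma H2_Dx u : H 1 u -> H 1 (Dx 1 u) -> H 2 u.
Proof.
move=> hu hd; have [Lu iu] := (HP 1 u).1 hu; have [Ld id] := (HP 1 _).1 hd.
have L := L2_symb (symb_Dx 1) hu.
have cu := L2_cmeas (L2_fourier Lu).
apply/HP; split; first exact: Lu.
apply: (integr_jwn_ae cu (integrD iu id)).
apply: aeS (fourier_multiplier L) => x ->.
by rewrite normc2M !expr1 {3}/normc2 /=; ring.
Qed.

Lemma Dx2 u : H 2 u -> aeq (Dx 2 u) (Dx 1 (Dx 1 u)).
Proof.
move=> hu; have L1 := L2_symb (symb_Dx 1) (H2_H1 hu).
have L2' := L2_symb (symb_Dx 2) hu.
have hd : H 1 (Dx 1 u) := symb_multiplier (symb_Dx 1) (hu : H (1 + 1) u).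
have Ld := L2_symb (symb_Dx 1) hd.
apply: aeq_fourier_inj; [exact: L2_multiplier|exact: L2_multiplier|].
apply: aeq_trans (fourier_multiplier L2') _.
apply: aeq_trans (aeq_sym (fourier_multiplier Ld)).
by apply: aeS (fourier_multiplier L1) => x E; rewrite /pmul E /pmul expr2 !expr1 mulrA.
Qed.

Lemma aeq_refl_fun u v : L2 u -> L2 v -> aeq u v -> aeq (refl u) (refl v).
Proof.
move=> Lu Lv h; apply: nrm_eq0_ae; [exact: L2_refl|exact: L2_refl|].
by rewrite nrm_refl //; apply: ae_nrm_eq0 => //; exact: L2_cmeas.
Qed.

(** The two coordinates are bounded separately, which costs a factor 2 against
    the sharp constant 1 / (2 pi). *)
Lemma normc2_fint_le w xi : cintegr w -> integr (fun x => Num.sqrt (normc2 (w x))) ->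
  normc2 (fint w xi) <= pi^-1 * (\int[mu]_x Num.sqrt (normc2 (w x))) ^+ 2.
Proof.
move=> cw iw; set I := \int[mu]_x _.
have p0 : 0 < 2 * pi :> R by rewrite mulr_gt0 // pi_gt0.
have [a b] := cintegr_expNi xi cw.
have N x : normc2 (w x * expNi (x * xi)) = normc2 (w x) by rewrite normc2M normc2_expNi mulr1.
rewrite normc2M normc2_real exprVn sqr_sqrtr ?(ltW p0) // invfM mulrC mulrA -[leRHS]mulrC.
apply: ler_wpM2r; first by rewrite invr_ge0 pi_ge0.
have sq (t : R) : `|t| <= I -> t ^+ 2 <= I ^+ 2.
  by move=> h; rewrite -[t ^+ 2]real_normK ?num_real // lerXn2r // nnegrE; exact: le_trans h.
rewrite ler_pdivrMr // mulrC /normc2 mulr2n mulrDl mul1r; apply: lerD; apply: sq.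
  apply: le_trans (Rint_abs_le a) _; apply: Rint_le => //; first exact: integr_norm.
  by move=> x; rewrite -N; exact: absRe_le.
apply: le_trans (Rint_abs_le b) _; apply: Rint_le => //; first exact: integr_norm.
by move=> x; rewrite -N; exact: absIm_le.
Qed.

(** Cauchy-Schwarz between (1 + xi^2)^(-1/2), whose squared norm is pi, and (1
    + xi^2)^(1/2) |fourier u|. *)
Lemma H1_fourier_integr u : H 1 u ->
  integr (fun x => Num.sqrt (normc2 (fourier u x))) /\
  (\int[mu]_x Num.sqrt (normc2 (fourier u x))) ^+ 2 <= pi * hnorm2 1 u.
Proof.
move=> hu; have [Lu iu] := (HP 1 u).1 hu; have cf := L2_cmeas (L2_fourier Lu).
pose g : Cfun R := fun xi => (Num.sqrt ((1 + xi ^+ 2)^-1))%:C.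
pose h : Cfun R := fun xi => (Num.sqrt ((1 + xi ^+ 2) * normc2 (fourier u xi)))%:C.
have j0 (x : R) : 0 < 1 + x ^+ 2 by rewrite ltr_wpDr ?sqr_ge0.
have ms : measurable_fun setT (@Num.sqrt R) by apply: continuous_measurable_fun; exact: sqrt_continuous.
have ng x : normc2 (g x) = 2^-1 * cauchyw x.
  by rewrite normc2_real sqr_sqrtr ?invr_ge0 ?(ltW (j0 _)) // cauchywE mulrA mulVf ?mul1r.
have nh x : normc2 (h x) = (1 + x ^+ 2) ^+ 1 * normc2 (fourier u x).
  by rewrite normc2_real sqr_sqrtr ?expr1 // mulr_ge0 ?normc2_ge0 ?(ltW (j0 _)).
have ig := integrZ 2^-1 (@integr_cauchyw R).
have Lg : L2 g.
  apply/L2P; split; last by under eq_fun do rewrite ng.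
  apply: cmeas_real; apply: (measurableT_comp ms).
  rewrite (_ : (fun x : R => (1 + x ^+ 2)^-1) = (fun x => 2^-1 * cauchyw x)).
    exact: integr_meas ig.
  by apply/funext => x; rewrite cauchywE mulrA mulVf ?mul1r.
have Lh : L2 h.
  apply/L2P; split; last by under eq_fun do rewrite nh.
  apply: cmeas_real; apply: (measurableT_comp ms).
  by have := meas_jwn 1 cf; under eq_fun do rewrite expr1.
have E x : Re (g x * h x) = Num.sqrt (normc2 (fourier u x)).
  rewrite cReM /= mul0r subr0 -sqrtrM ?invr_ge0 ?(ltW (j0 _)) // mulrA mulVf ?mul1r //.
  by rewrite gt_eqF.
split; first by have := integr_ReM Lg Lh; under eq_fun do rewrite E.
have := Re_inner_le Lg Lh.
have -> : Re (inner g h) = \int[mu]_x Num.sqrt (normc2 (fourier u x)).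
  apply: eq_Rintegral => x _; rewrite -E; congr (Re (_ * _)); exact: conjc_real.
set I := \int[mu]_x _ => hI.
have I0 : 0 <= I by apply: Rintegral_ge0 => x _; exact: sqrtr_ge0.
have -> : pi * hnorm2 1 u = (nrm g * nrm h) ^+ 2.
  rewrite exprMn !nrm_sqr; congr (_ * _); last by apply: eq_Rintegral => x _; rewrite nh.
  transitivity (\int[mu]_x (2^-1 * cauchyw x)); last by apply: eq_Rintegral => x _; rewrite ng.
  rewrite RintZ; last exact: integr_cauchyw.
  by rewrite /Rintegral integral_cauchyw /= mulrA mulVf ?mul1r.
by apply: lerXn2r => //; rewrite nnegrE // mulr_ge0 // nrm_ge0.
Qed.

(** By inversion u is the Fourier integral of an integrable function, up to a
    reflection, so it is bounded by a multiple of the L^1 norm of that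
    function. *)
Lemma sobolev_sup u : H 1 u -> {ae mu, forall x, normc2 (u x) <= hnorm2 1 u}.
Proof.
move=> hu; have Lu := H_L2 hu; have Lf := L2_fourier Lu.
have [iw hI] := H1_fourier_integr hu; have cf := L2_cmeas Lf.
have cw : cintegr (fourier u).
  split; apply: (integr_le _ iw); [exact: cf.1|move=> x; exact: absRe_le|exact: cf.2|
    move=> x; exact: absIm_le].
have [Lw _] := plancherel_fint Lf cw.
have h1 : aeq (refl (fourier (fourier u))) (refl (fint (fourier u))).
  by apply: aeq_refl_fun; [exact: L2_fourier|exact: Lw|exact: fourier_fint].
apply: aeS (aeq_trans (aeq_sym (ifourierK Lu)) h1) => x ->.
apply: le_trans (normc2_fint_le _ cw iw) _.
by rewrite ler_pdivrMl ?pi_gt0.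
Qed.

End Sobolev.

Section RealCalculus.
Variable R : realType.
Local Notation mu := (@lebesgue_measure R).

Lemma is_derive_continuous (f df : R -> R) : (forall x : R, is_derive x (1 : R) f (df x)) -> continuous f.
Proof.
move=> h x; apply: differentiable_continuous; apply/derivable1_diffP.
by have [] := h x.
Qed.

Lemma derive_lipschitz (f df : R -> R) (B : R) : (forall x : R, is_derive x (1 : R) f (df x)) ->
  (forall x, `|df x| <= B) -> forall x y, `|f y - f x| <= B * `|y - x|.
Proof.
move=> h hB.
have key x y : x <= y -> `|f y - f x| <= B * `|y - x|.
  move=> xy; have cf : {within `[x, y], continuous f}.
    by apply: continuous_subspaceT; exact: is_derive_continuous h.
  have [c _ ->] := @MVT_segment _ f df x y xy (fun t _ => h t) cf.
  by rewrite normrM ler_wpM2r.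
move=> x y; have [xy|/ltW yx] := leP x y; first exact: key.
by rewrite distrC [`|y - x|]distrC; exact: key.
Qed.

Lemma sin_abs_le (t : R) : `|sin t| <= `|t|.
Proof.
have h := derive_lipschitz (f := @sin R) (df := @cos R) (B := 1) (fun x => is_derive_sin x) (fun x => cos_max x) 0 t.
by move: h; rewrite sin0 !subr0 mul1r.
Qed.

(** 2 - 2 cos t = 4 sin (t / 2)^2 and |sin| <= |id|. *)
Lemma cos_ge_parabola (t : R) : 2 - 2 * cos t <= t ^+ 2.
Proof.
have E : cos t = 1 - 2 * sin (t / 2) ^+ 2.
  have -> : cos t = cos (t / 2 + t / 2) by rewrite -splitr.
  by rewrite cosD -!expr2 cos2sin2; ring.
have := sin_abs_le (t / 2).
rewrite -(@ler_pXn2r _ 2) ?nnegrE // !real_normK ?num_real // E.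
rewrite expr_div_n; move: (sin _ ^+ 2) (t ^+ 2) => a b; lra.
Qed.

Definition hstep n : R := n.+1%:R^-1.

Lemma hstep_cvg : hstep n @[n --> \oo] --> 0^'.
Proof.
move=> P; rewrite /dnbhs /within /= => h.
have h0 : hstep n @[n --> \oo] --> (0 : R) by exact: cvg_harmonic.
have [N _ hN] := h0 _ h; exists N => // n Nn; apply: (hN n Nn).
by rewrite /hstep invr_eq0 pnatr_eq0.
Qed.

Lemma hstep_cvg0 : hstep n @[n --> \oo] --> 0.
Proof. exact: cvg_harmonic. Qed.

Lemma derive_seq (f : R -> R) (x d : R) : is_derive x (1 : R) f d ->
  n.+1%:R * (f (x + hstep n) - f x) @[n --> \oo] --> d.
Proof.
move=> [df <-]; have := df; rewrite /derivable => /cvg_lim h.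
have h2 : h^-1 *: (f (h *: 1 + x) - f x) @[h --> 0^'] --> 'D_1 f x by exact: df.
have := cvg_comp _ _ hstep_cvg h2; apply: cvg_trans; apply: near_eq_cvg; apply: nearW => n.
by rewrite /hstep /= [_%:A]mulr1 [_ + x]addrC -[LHS]/(_^-1 * _) invrK.
Qed.

Lemma ftc_le (F f : R -> R) (a b : R) : a <= b -> continuous f -> (forall x : R, is_derive x (1 : R) F (f x)) ->
  \int[mu]_(x in `[a, b]) f x = F b - F a.
Proof.
move=> ab cf dF; move: ab; rewrite le_eqVlt => /predU1P[->|ab].
  by rewrite set_itv1 Rintegral_set1 subrr.
have cF := is_derive_continuous dF.
have := @continuous_FTC2 R f F a b ab (continuous_subspaceT cf).
rewrite /Rintegral => -> //.
  split; first by move=> x _; have [] := dF x.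
    by apply: cvg_at_right_filter; exact: cF.
  by apply: cvg_at_left_filter; exact: cF.
move=> x _; rewrite derive1E; have [_ ->] := dF x; by [].
Qed.

(** A strict inequality at one point would hold on an interval, which is not
    negligible. *)
Lemma ae_continuous_le (f : R -> R) K : continuous f -> {ae mu, forall x, f x <= K} ->
  forall x, f x <= K.
Proof.
move=> cf [N [mN N0 hN]] x; rewrite leNgt; apply/negP => Kx.
have /cf : nbhs (f x) [set y | K < y] by exact: lt_nbhsr.
move=> [r /= r0 hr].
pose I : set R := `]x - r, x + r[%classic.
have sub : I `<=` N.
  move=> y; rewrite /I /= in_itv /= => /andP[y1 y2]; apply: hN => /=; apply/negP; rewrite -ltNge.
  by apply: hr; rewrite /ball /= ltr_distlC y1 y2.
have : (mu I <= mu N)%E by apply: le_measure; rewrite ?inE //; exact: measurable_itv.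
rewrite N0 lebesgue_measure_itv /= lte_fin ifT; last by rewrite ltrD2l; lra.
rewrite -EFinD lee_fin; lra.
Qed.

End RealCalculus.

Section Subsequences.
Variable R : realType.
Local Notation mu := (@lebesgue_measure R).
Implicit Types u v w : Cfun R.

Lemma cvg_sub (T : topologicalType) (a : nat -> T) (l : T) (phi : nat -> nat) :
  (forall k, (k <= phi k)%N) -> a n @[n --> \oo] --> l -> a (phi k) @[k --> \oo] --> l.
Proof.
move=> hp; apply: cvg_comp; move=> P [N _ hN]; exists N => // k Nk.
by apply: hN => /=; exact: leq_trans Nk (hp k).
Qed.

Lemma ccvg_sub (a : nat -> R[i]) l (phi : nat -> nat) :
  (forall k, (k <= phi k)%N) -> ccvg a l -> ccvg (fun k => a (phi k)) l.
Proof. by move=> hp [h k]; split; [exact: (cvg_sub hp h)|exact: (cvg_sub hp k)]. Qed.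

Lemma cvgL2_subseq (u_ : nat -> Cfun R) u : (forall n, L2 (u_ n)) -> L2 u -> cvgL2 u_ u ->
  exists2 phi : nat -> nat, (forall k, (k <= phi k)%N) &
    {ae mu, forall x, ccvg (fun k => u_ (phi k) x) (u x)}.
Proof.
move=> a b c; have [phi hp h] := cvg_subseq_ae (fun n => L2B (a n) b) c.
exists phi => //; apply: aeS h => x hx.
have := ccvgD hx (ccvg_cst (u x)); rewrite add0r.
by congr ccvg; apply/funext => k; exact: subrK.
Qed.

Lemma cvgL2_subseq2 (u_ v_ : nat -> Cfun R) u v :
  (forall n, L2 (u_ n)) -> L2 u -> (forall n, L2 (v_ n)) -> L2 v ->
  cvgL2 u_ u -> cvgL2 v_ v ->
  exists2 phi : nat -> nat, (forall k, (k <= phi k)%N) &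
    {ae mu, forall x, ccvg (fun k => u_ (phi k) x) (u x) /\
                      ccvg (fun k => v_ (phi k) x) (v x)}.
Proof.
move=> a b a' b' c c'; have [phi hp h] := cvgL2_subseq a b c.
have c2 : cvgL2 (fun k => v_ (phi k)) v.
  by rewrite /cvgL2; exact: (cvg_sub (a := fun n => nrm (v_ n - v)) hp c').
have [psi hq k] := cvgL2_subseq (fun n => a' (phi n)) b' c2.
exists (fun n => phi (psi n)); first by move=> n; exact: leq_trans (hq n) (hp _).
by apply: aeS2 h k => x h1 h2; split => //; exact: (ccvg_sub hq h1).
Qed.

End Subsequences.

(** * Difference quotients *)

Section DifferenceQuotients.
Variable R : realType.
Local Notation mu := (@lebesgue_measure R).
Implicit Types u v w : Cfun R.

Lemma normc2_im (x : R) : normc2 (x *i) = x ^+ 2.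
Proof. by rewrite /normc2 /= expr0n add0r. Qed.

Definition diffq n u : Cfun R := (n.+1%:R : R)%:C *: (tau (hstep R n) u - u).

(** The Fourier multiplier of the difference quotient; it tends to i xi and is
    bounded by |xi|, uniformly in n. *)
Definition diffq_symb n : Cfun R := fun xi => (n.+1%:R : R)%:C * ((expNi (hstep R n * xi))^*%C - 1).

Lemma L2_diffq n u : L2 u -> L2 (diffq n u).
Proof. by move=> Lu; apply: L2Z; apply: L2B => //; exact: L2_tau. Qed.

Lemma fourier_diffq n u : L2 u -> aeq (fourier (diffq n u)) (pmul (diffq_symb n) (fourier u)).
Proof.
move=> Lu; have Lt := L2_tau (hstep R n) Lu.
apply: aeq_trans (fourierZ _ (L2B Lt Lu)) _.
apply: aeq_trans (aeqZ _ (fourierB Lt Lu)) _.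
apply: aeS (fourier_tau (hstep R n) Lu) => x E.
rewrite -[LHS]/(_ * (fourier (tau (hstep R n) u) x - fourier u x)) E /pmul /diffq_symb.
by rewrite -mulrA; congr (_ * _); rewrite [RHS]mulrBl mul1r.
Qed.

Lemma cmeas_diffq_symb n : cmeas (diffq_symb n).
Proof.
exact: (cmeasZ (n.+1%:R)%:C (cmeasB (cmeas_expNiJ (hstep R n)) (cmeas_cst 1))).
Qed.

Lemma normc2_diffq_symb n xi : normc2 (diffq_symb n xi) <= xi ^+ 2.
Proof.
set t := hstep R n * xi.
have E : normc2 ((expNi t)^*%C - 1) = 2 - 2 * cos t.
  by rewrite /normc2 !ReImE /= !opprK oppr0 addr0 -[2 - _]/(1 + 1 - 2 * cos t) -{2}(cos2Dsin2 t); ring.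
rewrite /diffq_symb normc2M normc2_real -/t E.
apply: (@le_trans _ _ (n.+1%:R ^+ 2 * t ^+ 2)).
  by apply: ler_wpM2l; rewrite ?sqr_ge0 // cos_ge_parabola.
by rewrite /t /hstep exprMn mulrA -exprMn mulfV ?expr1n ?mul1r.
Qed.

Lemma ccvg_diffq_symb (xi : R) : ccvg (fun n => diffq_symb n xi) (xi *i).
Proof.
have dc : is_derive (0 : R) (1 : R) (fun t : R => cos (t * xi)) 0.
  have := is_derive_cosM xi (0 : R); rewrite mulr0 sin0 oppr0 mul0r.
  by under eq_fun do rewrite mulrC.
have ds : is_derive (0 : R) (1 : R) (fun t : R => sin (t * xi)) xi.
  have := is_derive_sinM xi (0 : R); rewrite mulr0 cos0 mul1r.
  by under eq_fun do rewrite mulrC.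
have h1 := derive_seq dc; have h2 := derive_seq ds.
split.
  rewrite /=; apply: cvg_trans h1; apply: near_eq_cvg; apply: nearW => n.
  by rewrite mul0r cos0 add0r mul0r subr0.
rewrite /=; apply: cvg_trans h2; apply: near_eq_cvg; apply: nearW => n.
by rewrite mul0r sin0 add0r opprK mul0r addr0 subr0.
Qed.

Lemma L2_diffq_symb n u : H 1 u -> L2 (pmul (diffq_symb n) (fourier u)).
Proof.
move=> hu; apply: (@L2_symb _ 1 _ 1) => //; split; first exact: cmeas_diffq_symb.
move=> x; apply: le_trans (normc2_diffq_symb _ _) _; by rewrite mul1r expr1 lerDr.
Qed.

(** Dominated convergence on the Fourier side, with 4 xi^2 |fourier u|^2 as a
    bound. *)
Lemma diffq_cvg u : H 1 u -> cvgL2 (fun n => diffq n u) (Dx 1 u).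
Proof.
move=> hu; have [Lu iu] := (HP 1 u).1 hu; have L1 := L2_symb (symb_Dx R 1) hu.
have Ld := L2_multiplier L1.
have cf := L2_cmeas (L2_fourier Lu).
have E n : nrm (diffq n u - Dx 1 u) =
    nrm (pmul (diffq_symb n) (fourier u) - pmul (fun xi : R => (xi *i) ^+ 1) (fourier u)).
  rewrite -(nrm_fourierB (L2_diffq n Lu) Ld); apply: nrm_ae.
  - by apply: L2_cmeas; apply: L2B; apply: L2_fourier => //; exact: L2_diffq.
  - by apply: L2_cmeas; apply: L2B => //; exact: L2_diffq_symb.
  - apply: aeS2 (fourier_diffq n Lu) (fourier_multiplier L1) => x e1 e2.
    by rewrite -[LHS]/(fourier (diffq n u) x - fourier (Dx 1 u) x) e1 e2.
rewrite /cvgL2; under eq_cvg => n do rewrite E.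
apply: (@dominated_cvgL2_0 _ _ (fun x => 4 * ((1 + x ^+ 2) ^+ 1 * normc2 (fourier u x)))).
- by move=> n; apply: cmeasB; apply: L2_cmeas => //; exact: L2_diffq_symb.
- exact: integrZ.
- apply: aeW => x; have := ccvgB (ccvgM (ccvg_diffq_symb x) (ccvg_cst (fourier u x))) (ccvg_cst (x *i ^+ 1 * fourier u x)).
  by rewrite expr1 subrr; congr ccvg; apply/funext => n.
- move=> n x.
  rewrite -[(_ - _) x]/(diffq_symb n x * fourier u x - x *i ^+ 1 * fourier u x) -mulrBl normc2M mulrA.
  apply: ler_wpM2r; first exact: normc2_ge0.
  apply: le_trans (normc2B_le _ _) _; have := normc2_diffq_symb n x.
  rewrite expr1 normc2_im; move: (normc2 _) (sqr_ge0 x) => a b c; lra.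
Qed.

Lemma n2_diffq_le n u : H 1 u -> n2 (diffq n u) <= n2 (Dx 1 u).
Proof.
move=> hu; have [Lu iu] := (HP 1 u).1 hu; have L1 := L2_symb (symb_Dx R 1) hu.
rewrite (n2_multiplier L1) -(n2_fourier (L2_diffq n Lu)).
rewrite (n2_ae _ _ (fourier_diffq n Lu)); first last.
- by apply: L2_cmeas; exact: L2_diffq_symb.
- by apply: L2_cmeas; apply: L2_fourier; exact: L2_diffq.
apply: Rint_le; [by apply: L2_integr; exact: L2_diffq_symb|exact: L2_integr|].
move=> x; rewrite [leLHS]normc2M [leRHS]normc2M; apply: ler_wpM2r; first exact: normc2_ge0.
by rewrite expr1 normc2_im normc2_diffq_symb.
Qed.

(** Fatou's lemma on the Fourier side: the multipliers [diffq_symb n] tend to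
    i xi pointwise. *)
Lemma H1_of_diffq u C : L2 u -> (forall n, n2 (diffq n u) <= C) -> H 1 u /\ n2 (Dx 1 u) <= C.
Proof.
move=> Lu hC; have Lf := L2_fourier Lu; have cf := L2_cmeas Lf.
have Lq n : L2 (pmul (diffq_symb n) (fourier u)).
  apply: (L2_ae _ (L2_fourier (L2_diffq n Lu)) (fourier_diffq n Lu)).
  by apply: cmeasM => //; exact: cmeas_diffq_symb.
have cD : cmeas (pmul (fun xi : R => (xi *i) ^+ 1) (fourier u)).
  by apply: cmeasM => //; have [] := symb_Dx R 1.
have [|n|LD nD] := fatou_n2 (C := C) Lq cD.
- apply: aeW => x; apply: ccvg_normc2; apply: ccvgM; last exact: ccvg_cst.
  by rewrite expr1; exact: ccvg_diffq_symb.
- rewrite -(n2_ae _ _ (fourier_diffq n Lu)); first last.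
  + exact: L2_cmeas.
  + by apply: L2_cmeas; apply: L2_fourier; exact: L2_diffq.
  by rewrite n2_fourier //; exact: L2_diffq.
split; last by rewrite n2_multiplier.
apply/HP; split; first exact: Lu.
apply: (integr_jwn_ae cf (integrD (L2_integr Lf) (L2_integr LD))).
apply: aeW => x; by rewrite [X in _ = _ + X]normc2M !expr1 normc2_im; ring.
Qed.

(** The difference quotients converge to the classical derivative at every
    point, and a subsequence converges to the weak one almost everywhere. *)
Lemma Dx_classical u (a b : R -> R) : H 1 u ->
  (forall x : R, is_derive x (1 : R) (fun y => Re (u y)) (a x)) ->
  (forall x : R, is_derive x (1 : R) (fun y => Im (u y)) (b x)) ->
  aeq (Dx 1 u) (fun x => a x +i* b x).
Proof.
move=> hu da db; have Lu := H_L2 hu; have Ld := L2_multiplier (L2_symb (symb_Dx R 1) hu).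
have [phi hp h] := cvgL2_subseq (fun n => L2_diffq n Lu) Ld (diffq_cvg hu).
apply: aeS h => x hx; apply: (ccvg_unique hx); apply: (ccvg_sub (a := fun n => diffq n u x) hp).
split.
  rewrite /=; apply: cvg_trans (derive_seq (da x)); apply: near_eq_cvg; apply: nearW => n.
  by rewrite -[diffq n u x]/(_ * (u (x + hstep R n) - u x)) !ReImE /= mul0r subr0.
rewrite /=; apply: cvg_trans (derive_seq (db x)); apply: near_eq_cvg; apply: nearW => n.
by rewrite -[diffq n u x]/(_ * (u (x + hstep R n) - u x)) !ReImE /= mul0r addr0.
Qed.

End DifferenceQuotients.

(** * Classical derivatives and the product rule *)

Section WeakDerivatives.
Variable R : realType.
Local Notation mu := (@lebesgue_measure R).
Implicit Types u v w : Cfun R.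

Lemma Rint_itv_lin (f g : R -> R) r (a b : R) : continuous f -> continuous g ->
  \int[mu]_(x in `[a, b]) (f x + r * g x) =
  \int[mu]_(x in `[a, b]) f x + r * \int[mu]_(x in `[a, b]) g x.
Proof.
move=> cf cg.
have ic (h : R -> R) : continuous h -> mu.-integrable `[a, b] (EFin \o h).
  move=> ch; apply: continuous_compact_integrable; first exact: segment_compact.
  exact: continuous_subspaceT.
have m : measurable (`[a, b]%classic : set R) by exact: measurable_itv.
rewrite RintegralD //; [|exact: ic|]; last first.
  by apply: ic => x; apply: cvgM; [exact: cvg_cst|exact: cg].
by rewrite RintegralZl //; exact: ic.
Qed.

Lemma trunc_by_parts (f df : R -> R) n xi :
  (forall x : R, is_derive x (1 : R) f (df x)) -> continuous df ->
  fourier_trunc (ofreal df) n xi - xi *i * fourier_trunc (ofreal f) n xi =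
  (Num.sqrt (2 * pi))^-1%:C *
  ((f n%:R)%:C * expNi (n%:R * xi) - (f (- n%:R))%:C * expNi (- n%:R * xi)).
Proof.
move=> dff cdf; have cf := is_derive_continuous dff.
rewrite /fourier_trunc mulrCA -mulrBr; congr (_ * _).
have lin : continuous (fun x : R => x * xi) by move=> x; apply: cvgM; [exact: cvg_id|exact: cvg_cst].
have ccos : continuous (fun x : R => cos (x * xi)).
  by move=> x; apply: (continuous_comp (lin x)); exact: continuous_cos.
have csin : continuous (fun x : R => sin (x * xi)).
  by move=> x; apply: (continuous_comp (lin x)); exact: continuous_sin.
have cM (g h : R -> R) : continuous g -> continuous h -> continuous (fun x => g x * h x).
  by move=> cg ch x; apply: cvgM; [exact: cg|exact: ch].
have nn : - n%:R <= n%:R :> R by rewrite ge0_cp ?ler0n.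
have dcos (x : R) : is_derive x (1 : R) (fun t => cos (t * xi)) (- (sin (x * xi) * xi)).
  by have := is_derive_cosM xi x; under eq_fun do rewrite mulrC; rewrite mulNr [xi * x]mulrC.
have dsin (x : R) : is_derive x (1 : R) (fun t => sin (t * xi)) (cos (x * xi) * xi).
  by have := is_derive_sinM xi x; under eq_fun do rewrite mulrC; rewrite [xi * x]mulrC.
have P1 : \int[mu]_(x in `[- n%:R, n%:R]) (df x * cos (x * xi) + (- xi) * (f x * sin (x * xi))) =
    f n%:R * cos (n%:R * xi) - f (- n%:R) * cos (- n%:R * xi).
  apply: (ftc_le (F := fun x => f x * cos (x * xi))) => //.
    move=> x; apply: cvgD; first exact: (cM _ _ cdf ccos).
    by apply: cvgM; [exact: cvg_cst|exact: (cM _ _ cf csin)].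
  move=> x; have h := is_deriveM (dff x) (dcos x).
  rewrite (_ : df x * _ + _ = f x *: - (sin (x * xi) * xi) + cos (x * xi) *: df x) //.
  by rewrite /GRing.scale /=; ring.
have P2 : \int[mu]_(x in `[- n%:R, n%:R]) (df x * sin (x * xi) + xi * (f x * cos (x * xi))) =
    f n%:R * sin (n%:R * xi) - f (- n%:R) * sin (- n%:R * xi).
  apply: (ftc_le (F := fun x => f x * sin (x * xi))) => //.
    move=> x; apply: cvgD; first exact: (cM _ _ cdf csin).
    by apply: cvgM; [exact: cvg_cst|exact: (cM _ _ cf ccos)].
  move=> x; have h := is_deriveM (dff x) (dsin x).
  rewrite (_ : df x * _ + _ = f x *: (cos (x * xi) * xi) + sin (x * xi) *: df x) //.
  by rewrite /GRing.scale /=; ring.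
move: P1 P2; rewrite !Rint_itv_lin; try exact: cM.
have ER (g : R -> R) : Re (Cintegral `[- n%:R, n%:R] (fun x => ofreal g x * expNi (x * xi))) =
    \int[mu]_(x in `[- n%:R, n%:R]) (g x * cos (x * xi)).
  by apply: eq_Rintegral => x _; rewrite cReM /= mul0r subr0.
have EI (g : R -> R) : continuous g -> Im (Cintegral `[- n%:R, n%:R] (fun x => ofreal g x * expNi (x * xi))) =
    - \int[mu]_(x in `[- n%:R, n%:R]) (g x * sin (x * xi)).
  move=> cg; have h := Rint_itv_lin (-1) (- n%:R) n%:R (fun x => cvg_cst (0 : R)) (cM _ _ cg csin).
  rewrite mulN1r in h; have := h; rewrite [X in _ = X - _](_ : _ = 0) ?sub0r.
    by move=> <-; apply: eq_Rintegral => x _; rewrite cImM /= mul0r addr0 mulrN mulN1r add0r.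
  by rewrite /Rintegral integral0.
move=> P1 P2; have E1 := ER df; have E2 := ER f; have E3 := EI _ cdf; have E4 := EI _ cf.
move: (Cintegral _ (fun x => ofreal df x * _)) (Cintegral _ (fun x => ofreal f x * _)) E1 E2 E3 E4.
move=> z w E1 E2 E3 E4.
apply: complexP.
  rewrite !cReD !cReN !cReM E1 E4 /=; apply: etrans (etrans P1 _); ring.
rewrite !cImD !cImN !cImM E3 E2 /=; apply: etrans (etrans (congr1 -%R P2) _); ring.
Qed.

Lemma expNi_bound (a b s t c : R) :
  normc2 (c%:C * (a%:C * expNi s - b%:C * expNi t)) <= 2 * c ^+ 2 * (a ^+ 2 + b ^+ 2).
Proof.
rewrite normc2M normc2_real -mulrA mulrCA; apply: ler_wpM2l; first exact: sqr_ge0.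
apply: le_trans (normc2B_le _ _) _.
by rewrite !normc2M !normc2_real !normc2_expNi !mulr1 mulrDr.
Qed.

Lemma n2D_le u v : L2 u -> L2 v -> n2 (u + v) <= 2 * n2 u + 2 * n2 v.
Proof.
move=> Lu Lv; have i1 := integrZ 2 (L2_integr Lu); have i2 := integrZ 2 (L2_integr Lv).
rewrite /n2 -!RintZ; [|exact: L2_integr|exact: L2_integr].
rewrite -RintD //; apply: Rint_le; first by apply: L2_integr; exact: L2D.
  exact: integrD.
by move=> x; exact: (normc2D_le (u x) (v x)).
Qed.

(** Integrating by parts on [-n, n] relates the truncated transforms of df and
    f up to boundary terms, which tend to 0; a common subsequence along which
    both truncated transforms converge almost everywhere identifies fourier df
    with i xi fourier f. Integrability of the latter then puts f in H^1. *)
Lemma H1_C1 (f df : R -> R) :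
  (forall x : R, is_derive x (1 : R) f (df x)) -> continuous df ->
  L2 (ofreal f) -> L2 (ofreal df) ->
  f n%:R @[n --> \oo] --> 0 -> f (- n%:R) @[n --> \oo] --> 0 ->
  H 1 (ofreal f) /\ aeq (Dx 1 (ofreal f)) (ofreal df).
Proof.
move=> dff cdf Lf Ld f1 f2.
have [Lff cff] := fourierP Lf; have [Lfd cfd] := fourierP Ld.
have [phi hp h] := cvgL2_subseq2 (fun n => L2_trunc n Lf) Lff (fun n => L2_trunc n Ld) Lfd cff cfd.
have E : aeq (pmul (fun xi : R => (xi *i) ^+ 1) (fourier (ofreal f))) (fourier (ofreal df)).
  apply: aeS h => xi [h1 h2]; rewrite /pmul expr1.
  have h3 := ccvgB h2 (ccvgM (ccvg_cst (xi *i)) h1).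
  apply/eqP; rewrite eq_sym -subr_eq0; apply/eqP; apply: (ccvg_unique h3).
  apply: (ccvg_sub (a := fun n => fourier_trunc (ofreal df) n xi - xi *i * fourier_trunc (ofreal f) n xi) hp).
  apply: ccvg_n2_0; rewrite /=.
  apply: (squeeze0 (b := fun n => 2 * (Num.sqrt (2 * pi))^-1 ^+ 2 * (f n%:R ^+ 2 + f (- n%:R) ^+ 2))).
    move=> n; rewrite normc2_ge0 subr0 (trunc_by_parts n xi dff cdf).
    exact: expNi_bound.
  have z : 2 * (Num.sqrt (2 * pi))^-1 ^+ 2 * (f n%:R * f n%:R + f (- n%:R) * f (- n%:R)) @[n --> \oo] -->
      2 * (Num.sqrt (2 * pi))^-1 ^+ 2 * (0 * 0 + 0 * 0 : R).
    by apply: cvgM; [exact: cvg_cst|apply: cvgD; exact: cvgM].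
  by rewrite mulr0 addr0 mulr0 in z; under eq_cvg => n do rewrite !expr2.
have cF := L2_cmeas Lff.
have cX : cmeas (pmul (fun xi : R => (xi *i) ^+ 1) (fourier (ofreal f))).
  by apply: cmeasM => //; have [] := symb_Dx R 1.
have LX := L2_ae cX Lfd (aeq_sym E).
split.
  apply/HP; split; first exact: Lf.
  apply: (integr_jwn_ae cF (integrD (L2_integr Lff) (L2_integr LX))).
  apply: aeW => x; rewrite [X in _ = _ + X]normc2M !expr1 normc2_im; ring.
apply: aeq_fourier_inj => //; first exact: L2_multiplier.
by apply: aeq_trans (fourier_multiplier LX) E.
Qed.

Lemma cmeas_pmulr (a : R -> R) u : meas a -> cmeas u -> cmeas (pmul (ofreal a) u).
Proof. by move=> ma cu; apply: cmeasM => //; exact: cmeas_real. Qed.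

Lemma normc2_pmulr_le (a : R -> R) A u x : (forall x, `|a x| <= A) ->
  normc2 (pmul (ofreal a) u x) <= A ^+ 2 * normc2 (u x).
Proof.
move=> aA; rewrite normc2M normc2_real; apply: ler_wpM2r; first exact: normc2_ge0.
rewrite -[a x ^+ 2]real_normK ?num_real // lerXn2r ?nnegrE //.
exact: le_trans (normr_ge0 _) (aA x).
Qed.

Lemma L2_pmulr (a : R -> R) A u : meas a -> (forall x, `|a x| <= A) -> L2 u -> L2 (pmul (ofreal a) u).
Proof.
move=> ma aA Lu; apply: (L2_dom _ Lu) (fun x => normc2_pmulr_le _ x aA).
by apply: cmeas_pmulr => //; exact: L2_cmeas.
Qed.

Lemma n2_pmulr (a : R -> R) A u : meas a -> (forall x, `|a x| <= A) -> L2 u ->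
  n2 (pmul (ofreal a) u) <= A ^+ 2 * n2 u.
Proof.
move=> ma aA Lu; apply: (n2_dom _ Lu) (fun x => normc2_pmulr_le _ x aA).
by apply: cmeas_pmulr => //; exact: L2_cmeas.
Qed.

Section ProductRule.
Variables (a da : R -> R) (A B : R).
Hypothesis ha : forall x : R, is_derive x (1 : R) a (da x).
Hypothesis cda : continuous da.
Hypothesis aA : forall x, `|a x| <= A.
Hypothesis daB : forall x, `|da x| <= B.

Let ma : meas a.
Proof. by apply: continuous_measurable_fun; exact: is_derive_continuous ha. Qed.

Let dqa n (x : R) : R := n.+1%:R * (a (x + hstep R n) - a x).

Let mdqa n : meas (dqa n).
Proof.
apply: measurable_funM => //; apply: measurable_funB => //.
by have := meas_affine 1 (hstep R n) ma; under eq_fun do rewrite mul1r.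
Qed.

Let dqa_le n x : `|dqa n x| <= B.
Proof.
rewrite normrM; have := derive_lipschitz ha daB x (x + hstep R n).
rewrite addrAC subrr add0r => h.
apply: (@le_trans _ _ (`|n.+1%:R| * (B * `|hstep R n|))); first exact: ler_wpM2l.
by rewrite mulrCA -normrM mulfV // normr1 mulr1.
Qed.

(* The discrete product rule. The values of a are taken at x + h with the
   quotient of u, so that the other factor is u itself. *)
Let dq_prod n u : diffq n (pmul (ofreal a) u) =
  pmul (ofreal (fun x => a (x + hstep R n))) (diffq n u) + pmul (ofreal (dqa n)) u.
Proof.
apply/funext => x.
rewrite -[LHS]/(_ * ((a (x + hstep R n))%:C * u (x + hstep R n) - (a x)%:C * u x)).
rewrite -[RHS]/((a (x + hstep R n))%:C * (_ * (u (x + hstep R n) - u x)) + (dqa n x)%:C * u x).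
by rewrite /dqa rmorphM rmorphB; ring.
Qed.

(** The discrete product rule bounds the difference quotients of a u
    uniformly. *)
Lemma H1_pmulr u : H 1 u -> H 1 (pmul (ofreal a) u) /\
  n2 (Dx 1 (pmul (ofreal a) u)) <= 2 * (A ^+ 2 * n2 (Dx 1 u)) + 2 * (B ^+ 2 * n2 u).
Proof.
move=> hu; have Lu := H_L2 hu; have La := L2_pmulr ma aA Lu.
apply: H1_of_diffq => // n; rewrite dq_prod.
have aAs x : `|a (x + hstep R n)| <= A by [].
have mas : meas (fun x => a (x + hstep R n)).
  by have := meas_affine 1 (hstep R n) ma; under eq_fun do rewrite mul1r.
have L1 := L2_pmulr mas aAs (L2_diffq n Lu); have L2' := L2_pmulr (mdqa n) (dqa_le n) Lu.
apply: (@le_trans _ _ (2 * n2 (pmul (ofreal (fun x => a (x + hstep R n))) (diffq n u)) + 2 * n2 (pmul (ofreal (dqa n)) u))).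
  exact: n2D_le.
apply: lerD; apply: ler_wpM2l => //; last exact: n2_pmulr.
apply: le_trans (n2_pmulr mas aAs (L2_diffq n Lu)) _.
by apply: ler_wpM2l; [exact: sqr_ge0|exact: n2_diffq_le].
Qed.

(** The discrete product rule, along a subsequence for which the difference
    quotients of u and of a u converge almost everywhere. *)
Lemma Dx_pmulr u : H 1 u ->
  aeq (Dx 1 (pmul (ofreal a) u)) (pmul (ofreal da) u + pmul (ofreal a) (Dx 1 u)).
Proof.
move=> hu; have [hau _] := H1_pmulr hu; have Lu := H_L2 hu; have La := H_L2 hau.
have Ld := L2_multiplier (L2_symb (symb_Dx R 1) hu).
have Lda := L2_multiplier (L2_symb (symb_Dx R 1) hau).
have [phi hp h] := cvgL2_subseq2 (fun n => L2_diffq n La) Lda (fun n => L2_diffq n Lu) Ld (diffq_cvg hau) (diffq_cvg hu).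
apply: aeS h => x [h1 h2]; apply: (ccvg_unique h1).
have ca : ccvg (fun n => (a (x + hstep R n))%:C) (a x)%:C.
  apply: ccvg_real; have ca := is_derive_continuous ha.
  have c0 : x + hstep R n @[n --> \oo] --> x + 0 by apply: cvgD; [exact: cvg_cst|exact: hstep_cvg0].
  by rewrite addr0 in c0; exact: (cvg_comp _ _ c0 (ca x)).
have cd : ccvg (fun n => (dqa n x)%:C) (da x)%:C by apply: ccvg_real; exact: derive_seq.
have h3 := ccvgD (ccvgM (ccvg_sub hp cd) (ccvg_cst (u x))) (ccvgM (ccvg_sub hp ca) h2).
move: h3; congr ccvg; apply/funext => k; rewrite dq_prod addrC.
by [].
Qed.

End ProductRule.

End WeakDerivatives.

Section MultiplierAlgebra.
Variable R : realType.
Local Notation mu := (@lebesgue_measure R).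
Implicit Types u v w m p : Cfun R.

Lemma multiplier_comm m p u : L2 (pmul m (fourier u)) -> L2 (pmul p (fourier u)) ->
  L2 (pmul p (fourier (multiplier m u))) -> L2 (pmul m (fourier (multiplier p u))) ->
  aeq (multiplier p (multiplier m u)) (multiplier m (multiplier p u)).
Proof.
move=> a b c d; apply: aeq_fourier_inj; [exact: L2_multiplier|exact: L2_multiplier|].
apply: aeq_trans (fourier_multiplier c) _; apply: aeq_trans (aeq_sym (fourier_multiplier d)).
apply: aeS2 (fourier_multiplier a) (fourier_multiplier b) => x h1 h2.
apply: etrans (congr1 (fun t => p x * t) h1) _.
by apply: etrans (mulrCA _ _ _) (esym (congr1 (fun t => m x * t) h2)).
Qed.

Lemma symbD k m K u v : symb k m K -> H k u -> H k v ->
  aeq (multiplier m (u + v)) (multiplier m u + multiplier m v).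
Proof.
move=> sm hu hv; apply: multiplierD; [exact: H_L2 hu|exact: H_L2 hv|exact: L2_symb sm hu|
  exact: L2_symb sm hv|exact: L2_symb sm (HD hu hv)].
Qed.

Lemma symbZ k m K z u : symb k m K -> H k u ->
  aeq (multiplier m (z *: u)) (z *: multiplier m u).
Proof.
move=> sm hu; apply: multiplierZ; [exact: H_L2 hu|exact: L2_symb sm hu|
  exact: L2_symb sm (HZ z hu)].
Qed.

Lemma symb_aeq k m K u v : symb k m K -> H k u -> H k v -> aeq u v ->
  aeq (multiplier m u) (multiplier m v).
Proof.
move=> sm hu hv h; apply: multiplier_aeq; [exact: H_L2 hu|exact: H_L2 hv|exact: h|
  exact: L2_symb sm hu|exact: L2_symb sm hv].
Qed.

Lemma symb_L2 k m K u : symb k m K -> H k u -> L2 (multiplier m u).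
Proof. by move=> sm hu; apply: L2_multiplier; exact: L2_symb sm hu. Qed.

Lemma symb_n2 k m K u : symb k m K -> H k u -> n2 (multiplier m u) <= K * hnorm2 k u.
Proof.
move=> sm hu; rewrite n2_multiplier; first exact: n2_symb sm hu.
exact: L2_symb sm hu.
Qed.

Lemma conjc_im0 (z : R[i]) : Im z = 0 -> z^*%C = z.
Proof. by case: z => c d /= ->; rewrite oppr0. Qed.

(** A real symbol multiplies both transforms alike in Plancherel's identity. *)
Lemma symb_selfadjoint k m K u v : symb k m K -> (forall x, Im (m x) = 0) -> H k u -> H k v ->
  inner (multiplier m u) v = inner u (multiplier m v).
Proof.
move=> sm rm hu hv; have Lu := H_L2 hu; have Lv := H_L2 hv.
have La := L2_symb sm hu; have Lb := L2_symb sm hv.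
rewrite (inner_multiplier La Lv) (inner_sym (L2_multiplier Lb) Lu) (inner_multiplier Lb Lu).
rewrite -(inner_sym Lb (L2_fourier Lu)); congr Cintegral; apply/funext => x.
rewrite /pmul [X in _ = _ * X]conjcM mulrCA mulrA; congr (_ * _).
by congr (_ * _); rewrite (conjc_im0 (rm x)).
Qed.

End MultiplierAlgebra.

(** * The Neel wall *)

Section Wall.
Variables (R : realType) (theta : R -> R).
Local Notation mu := (@lebesgue_measure R).
Hypothesis wall : static_neel_wall theta.
Hypothesis theta_smooth : smooth theta.
Hypothesis theta_incr : forall x : R, 0 < derive1 theta x.
Hypothesis dtheta_H2 : H 2 (ofreal (derive1 theta)).
Hypothesis theta_EL : euler_lagrange theta.

Local Notation e := (derive1 theta).
Local Notation E := (ofreal (derive1 theta)).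
Local Notation S := (sin_wall theta).
Local Notation C := (cos_wall theta).

Lemma smooth_is_derive n (x : R) : is_derive x (1 : R) (derive1n n theta) (derive1n n.+1 theta x).
Proof. by split; [exact: theta_smooth|rewrite derive1nS derive1E]. Qed.

Lemma theta_is_derive (x : R) : is_derive x (1 : R) theta (e x).
Proof. exact: (smooth_is_derive 0). Qed.

Lemma dtheta_is_derive (x : R) : is_derive x (1 : R) e (derive1n 2 theta x).
Proof. exact: (smooth_is_derive 1). Qed.

Lemma cont_theta : continuous theta. Proof. exact: is_derive_continuous theta_is_derive. Qed.
Lemma cont_dtheta : continuous e. Proof. exact: is_derive_continuous dtheta_is_derive. Qed.

Lemma cont_sin_theta : continuous (fun x => sin (theta x)).
Proof. by move=> x; exact: (cvg_comp _ _ (@cont_theta x) (@continuous_sin R (theta x))). Qed.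
Lemma cont_cos_theta : continuous (fun x => cos (theta x)).
Proof. by move=> x; exact: (cvg_comp _ _ (@cont_theta x) (@continuous_cos R (theta x))). Qed.

Lemma sin_theta_is_derive (x : R) : is_derive x (1 : R) (fun y => sin (theta y)) (cos (theta x) * e x).
Proof. by apply: is_derive1_comp; exact: theta_is_derive. Qed.

Lemma cos_theta_is_derive (x : R) : is_derive x (1 : R) (fun y => cos (theta y)) (- sin (theta x) * e x).
Proof. by apply: is_derive1_comp; exact: theta_is_derive. Qed.

Definition dtheta_bound : R := Num.sqrt (hnorm2 1 E).

(** The Sobolev bound holds almost everywhere, hence everywhere by continuity. *)
Lemma dtheta_bounded x : `|e x| <= dtheta_bound.
Proof.
have h : {ae mu, forall x, e x * e x <= hnorm2 1 E}.
  by apply: aeS (sobolev_sup (H2_H1 dtheta_H2)) => y; rewrite normc2_real expr2.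
have ce2 : continuous (fun x => e x * e x) by move=> y; apply: cvgM; exact: cont_dtheta.
have := ae_continuous_le ce2 h x; rewrite -expr2 -[e x ^+ 2]real_normK ?num_real // => k.
by rewrite -[leLHS]sqrtr_sqr; apply: ler_wsqrtr; rewrite -real_normK ?num_real.
Qed.

Lemma abs_cos_dtheta x : `|cos (theta x) * e x| <= dtheta_bound.
Proof.
rewrite normrM; apply: le_trans (dtheta_bounded x); rewrite ler_piMl ?normr_ge0 //.
exact: cos_max.
Qed.

Lemma sin_abs1 x : `|sin (theta x)| <= 1. Proof. exact: sin_max. Qed.
Lemma cos_abs1 x : `|cos (theta x)| <= 1. Proof. exact: cos_max. Qed.

Lemma meas_sin_theta : meas (fun x => sin (theta x)).
Proof. by apply: continuous_measurable_fun; exact: cont_sin_theta. Qed.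
Lemma meas_cos_theta : meas (fun x => cos (theta x)).
Proof. by apply: continuous_measurable_fun; exact: cont_cos_theta. Qed.

(** One of the three nonnegative terms of a finite energy. *)
Lemma L2_cos : L2 C.
Proof.
have [_ en _ _] := wall.
split; [exact: meas_cos_theta|exact: measurable_cst|].
move: en; rewrite /energy; set a := dirichlet _; set b := wnorm2 _ _; set c := norm2 _ => en.
have a0 : (0 <= a)%E.
  apply: le_ereal_inf_tmp => _ [g _ <-]; apply: integral_ge0 => x _.
  by rewrite lee_fin sqr_ge0.
have b0 : (0 <= b)%E.
  by apply: integral_ge0 => x _; rewrite lee_fin mulr_ge0 ?normc2_ge0.
have c0 : (0 <= c)%E.
  by apply: integral_ge0 => x _; rewrite lee_fin mul1r normc2_ge0.
have h : (2^-1%:E * c < +oo)%E.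
  apply: le_lt_trans en; apply: lee_wpmul2l; first by rewrite lee_fin invr_ge0.
  by rewrite leeDr // adde_ge0.
have key (d : \bar R) : (0 <= d -> 2^-1%:E * d < +oo -> d < +oo)%E.
  case: d => [r _ _|_|]; [exact: ltry| |by []].
  by rewrite gt0_muley // lte_fin invr_gt0.
exact: key c0 h.
Qed.

Lemma cos_cvgy : cos (theta n%:R) @[n --> \oo] --> 0.
Proof.
have [[_ _ h _] _ _ _] := wall.
have h1 : theta n%:R @[n --> \oo] --> pi / 2 by exact: (cvg_comp _ _ cvgr_idn h).
by have := cvg_comp _ _ h1 (@continuous_cos R (pi / 2)); rewrite cos_pihalf.
Qed.

Lemma cos_cvgNy : cos (theta (- n%:R)) @[n --> \oo] --> 0.
Proof.
have [[_ _ _ h] _ _ _] := wall.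
have hN : (- n%:R : R) @[n --> \oo] --> -oo.
  apply/cvgNry; rewrite (_ : - _ = (fun n => n%:R)); first exact: cvgr_idn.
  by apply/funext => n; exact: opprK.
have h1 : theta (- n%:R) @[n --> \oo] --> - (pi / 2) by exact: (cvg_comp _ _ hN h).
by have := cvg_comp _ _ h1 (@continuous_cos R (- (pi / 2))); rewrite cosN cos_pihalf.
Qed.

Local Notation SE := (pmul S E).

Lemma H1_S u : H 1 u -> H 1 (pmul S u).
Proof. by move=> hu; have [] := H1_pmulr sin_theta_is_derive sin_abs1 abs_cos_dtheta hu. Qed.

Lemma hnorm2_S u : H 1 u -> hnorm2 1 (pmul S u) <= (2 + 2 * dtheta_bound ^+ 2) * hnorm2 1 u.
Proof.
move=> hu; have [h1 h2] := H1_pmulr sin_theta_is_derive sin_abs1 abs_cos_dtheta hu.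
rewrite (hnorm2_1 h1) (hnorm2_1 hu); have := n2_pmulr meas_sin_theta sin_abs1 (H_L2 hu).
rewrite expr1n mul1r => h3.
move: h2; rewrite expr1n mul1r => h2.
apply: le_trans (lerD h3 h2) _.
have b0 := sqr_ge0 dtheta_bound.
rewrite [leRHS](_ : _ = n2 u + (2 * n2 (Dx 1 u) + 2 * (dtheta_bound ^+ 2 * n2 u)) +
  (n2 u + 2 * (dtheta_bound ^+ 2 * n2 (Dx 1 u)))); last by ring.
by rewrite lerDl addr_ge0 ?n2_ge0 // mulr_ge0 // mulr_ge0 ?n2_ge0.
Qed.

(** The chain rule, justified by [H1_C1]: cos theta tends to 0 at both ends
    because theta tends to pi / 2 and - pi / 2. *)
Lemma Dx_cos : H 1 C /\ aeq (Dx 1 C) (- SE).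
Proof.
have LE := H_L2 dtheta_H2.
have LSE : L2 SE := L2_pmulr meas_sin_theta sin_abs1 LE.
have Ee : ofreal (fun x => - sin (theta x) * e x) = - SE.
  apply/funext => x; rewrite -[RHS]/(- ((sin (theta x))%:C * (e x)%:C)).
  by rewrite -mulNr /ofreal rmorphM rmorphN.
have := @H1_C1 R (fun x => cos (theta x)) (fun x => - sin (theta x) * e x) cos_theta_is_derive.
rewrite Ee; apply.
- move=> x; apply: cvgM; last exact: cont_dtheta.
  by apply: cvgN; exact: cont_sin_theta.
- exact: L2_cos.
- exact: L2N.
- exact: cos_cvgy.
- exact: cos_cvgNy.
Qed.

Lemma H1_SE : H 1 SE. Proof. exact: H1_S (H2_H1 dtheta_H2). Qed.

(** The derivative of cos theta is - theta' sin theta, and sin theta, being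
    bounded with a bounded derivative, multiplies H^1 into itself. *)
Lemma H2_cos : H 2 C.
Proof.
have [h1 h2] := Dx_cos; apply: (H2_Dx h1).
apply: (H_aeq _ _ (aeq_sym h2)).
  by apply: L2_cmeas; exact: symb_L2 (symb_Dx R 1) h1.
by rewrite -scaleN1r; apply: HZ; exact: H1_SE.
Qed.

(** The factor (1 + (- Delta)^(1/2)) cos theta of the Euler-Lagrange equation;
    c_theta is cos theta times it. *)
Definition wall_field : Cfun R := C + halflap C.

Lemma H1_halflap_cos : H 1 (halflap C).
Proof. exact: (symb_multiplier (@symb_abs R) (H2_cos : H (1 + 1) C)). Qed.

Lemma H1_wall_field : H 1 wall_field.
Proof. by apply: HD; [exact: H2_H1 H2_cos|exact: H1_halflap_cos]. Qed.

Lemma Dx_wall_field : aeq (Dx 1 wall_field) (- (SE + halflap SE)).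
Proof.
have [h1 h2] := Dx_cos; have hl := H1_halflap_cos; have h3 := H2_cos.
have hd : H 1 (Dx 1 C) := symb_multiplier (symb_Dx R 1) (h3 : H (1 + 1) C).
apply: aeq_trans (symbD (symb_Dx R 1) h1 hl) _.
have hN : H 1 (- SE) by rewrite -scaleN1r; apply: HZ; exact: H1_SE.
have k1 : aeq (Dx 1 (halflap C)) (halflap (Dx 1 C)).
  apply: multiplier_comm; [exact: L2_symb (@symb_abs R) h1|exact: L2_symb (symb_Dx R 1) h1|
    exact: L2_symb (symb_Dx R 1) hl|exact: L2_symb (@symb_abs R) hd].
have k2 := symb_aeq (@symb_abs R) hd hN h2.
have k3 : aeq (halflap (- SE)) (- halflap SE).
  by rewrite -scaleN1r -[- halflap _]scaleN1r; exact: symbZ (@symb_abs R) H1_SE.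
rewrite opprD; apply: aeqD h2 _.
exact: aeq_trans k1 (aeq_trans k2 k3).
Qed.

Lemma ae_neq0 : {ae mu, forall x : R, x != 0}.
Proof.
exists [set 0]; split; [exact: measurable_set1|exact: lebesgue_measure_set1|].
by move=> x /= /negP; rewrite negbK => /eqP.
Qed.

Lemma theta_lt x y : x < y -> theta x < theta y.
Proof.
move=> xy; have cf : {within `[x, y], continuous theta}.
  by apply: continuous_subspaceT; exact: cont_theta.
have [c _] := @MVT _ theta e x y xy (fun t _ => theta_is_derive t) cf.
by move=> h; rewrite -subr_gt0 h mulr_gt0 // subr_gt0.
Qed.

(** theta is increasing with theta 0 = 0 and values in (- pi / 2, pi / 2). *)
Lemma sin_theta_neq0 x : x != 0 -> sin (theta x) != 0.
Proof.
have [[_ bd _ _] _ _ t0] := wall => x0.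
have /andP[b1 b2] := bd x.
case: (ltgtP x 0) x0 => // [xn|xp] _.
  have := theta_lt xn; rewrite t0 => tn.
  by rewrite -oppr_eq0 -sinN gt_eqF // sin_gt0_pihalf // oppr_gt0 tn ltrNl.
have := theta_lt xp; rewrite t0 => tp.
by rewrite gt_eqF // sin_gt0_pihalf // tp b2.
Qed.

Lemma EL_wall_field : aeq (ofreal (derive1n 2 theta)) (- pmul S wall_field).
Proof.
by apply: aeS theta_EL => x /eqP; rewrite addr_eq0 => /eqP.
Qed.

(** In the Euler-Lagrange equation theta'' is real, so sin theta times
    [wall_field] is real, and one can divide by sin theta off the origin. This
    replaces a discussion of the conjugation symmetry of the half-Laplacian. *)
Lemma wall_field_real : {ae mu, forall x, Im (wall_field x) = 0}.
Proof.
apply: aeS2 EL_wall_field ae_neq0 => x h /sin_theta_neq0 s0.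
have := congr1 (@complex.Im R) h; rewrite -[(- pmul S wall_field) x]/(- ((sin (theta x))%:C * wall_field x)).
rewrite cImN cImM /= mul0r addr0 => /esym/eqP; rewrite oppr_eq0 mulf_eq0 (negbTE s0) /=.
by move/eqP.
Qed.

Lemma c_thetaE : c_theta theta = pmul C wall_field. Proof. by []. Qed.

Lemma L2_c_theta : L2 (c_theta theta).
Proof. exact: (L2_pmulr meas_cos_theta cos_abs1 (H_L2 H1_wall_field)). Qed.

Lemma c_theta_real : {ae mu, forall x, Im (c_theta theta x) = 0}.
Proof.
apply: aeS wall_field_real => x h; rewrite c_thetaE /pmul cImM.
by rewrite -/(wall_field x) h mulr0 mul0r addr0.
Qed.

(** The derivative of the Euler-Lagrange equation. With G = [wall_field] it
    reads theta''' + cos theta theta' G + sin theta G' = 0, and G' = - (1 + (-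
    Delta)^(1/2)) (sin theta theta') by [Dx_wall_field]. *)
Lemma linop_dtheta : aeq (linop theta E) 0.
Proof.
have hE := H2_H1 dtheta_H2; have hd : H 1 (Dx 1 E) := symb_multiplier (symb_Dx R 1) (dtheta_H2 : H (1 + 1) E).
have hSG := H1_S H1_wall_field.
have a1 : aeq (Dx 1 E) (- pmul S wall_field).
  apply: aeq_trans EL_wall_field.
  have := @Dx_classical R E (derive1n 2 theta) (fun=> 0) hE dtheta_is_derive.
  by apply=> x; exact: is_derive_cst.
have hN : H 1 (- pmul S wall_field) by rewrite -scaleN1r; exact: HZ.
have a2 : aeq (Dx 2 E) (- Dx 1 (pmul S wall_field)).
  apply: aeq_trans (Dx2 dtheta_H2) _; apply: aeq_trans (symb_aeq (symb_Dx R 1) hd hN a1) _.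
  by rewrite -scaleN1r -[- Dx 1 _]scaleN1r; exact: symbZ (symb_Dx R 1) hSG.
have a3 := Dx_pmulr sin_theta_is_derive sin_abs1 abs_cos_dtheta H1_wall_field.
have a4 : aeq (Dx 2 E) (- (pmul (ofreal (fun x => cos (theta x) * e x)) wall_field + pmul S (Dx 1 wall_field))).
  apply: aeq_trans a2 _; apply: aeS a3 => x h.
  by rewrite -[LHS]/(- Dx 1 (pmul S wall_field) x) h.
apply: aeS2 a4 Dx_wall_field => x b2 b3.
rewrite -[linop theta E x]/(- Dx 2 E x + S x * (pmul S E x + halflap (pmul S E) x) - c_theta theta x * E x) b2.
rewrite -[(- (pmul _ _ + pmul _ _)) x]/(- ((cos (theta x) * e x)%:C * wall_field x + S x * Dx 1 wall_field x)) b3.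
rewrite -[(- (SE + halflap SE)) x]/(- (SE x + halflap SE x)).
rewrite c_thetaE /pmul -[C x]/((cos (theta x))%:C) -[E x]/((e x)%:C) rmorphM.
by rewrite opprK; rewrite -[RHS]/(0 : R[i]); ring.
Qed.

End Wall.

Section FixedPoint.
Variable R : realType.
Local Notation mu := (@lebesgue_measure R).
Implicit Types u v w : Cfun R.

Lemma addcE u v x : (u + v) x = u x + v x. Proof. by []. Qed.
Lemma oppcE u x : (- u) x = - u x. Proof. by []. Qed.
Lemma scalecE z u x : (z *: u) x = z * u x. Proof. by []. Qed.
Lemma zerocE x : (0 : Cfun R) x = 0. Proof. by []. Qed.

(** The limit of the iterates of 0. As nrm is a seminorm on representatives,
    the fixed point is one up to null sets. *)
Lemma banach_fixed_point (F : Cfun R -> Cfun R) q : 0 <= q < 1 ->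
  (forall u, L2 u -> L2 (F u)) ->
  (forall u v, L2 u -> L2 v -> nrm (F u - F v) <= q * nrm (u - v)) ->
  exists2 u, L2 u & aeq (F u) u.
Proof.
move=> /andP[q0 q1] FL Fq; pose x_ n := iter n F 0.
have Lx n : L2 (x_ n) by elim: n => [|n IH]; [exact: L2_0|exact: FL].
pose c := nrm (x_ 1 - x_ 0).
have step n : nrm (x_ n.+1 - x_ n) <= q ^+ n * c.
  elim: n => [|n IH]; first by rewrite expr0 mul1r.
  apply: le_trans (Fq _ _ (Lx n.+1) (Lx n)) _.
  by rewrite exprS -mulrA; exact: ler_wpM2l.
have q10 : 0 < 1 - q by rewrite subr_gt0.
have dist n k : (1 - q) * nrm (x_ (n + k)%N - x_ n) <= q ^+ n * c.
  have : (1 - q) * nrm (x_ (n + k)%N - x_ n) <= (q ^+ n - q ^+ (n + k)) * c.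
    elim: k => [|k IH]; first by rewrite addn0 !subrr nrm_0 mulr0 mul0r.
    apply: (@le_trans _ _ ((1 - q) * (nrm (x_ (n + k).+1 - x_ (n + k)%N) + nrm (x_ (n + k)%N - x_ n)))).
      rewrite addnS; apply: ler_wpM2l; first exact: ltW.
      exact: nrm_tri.
    rewrite mulrDr; apply: le_trans (lerD (ler_wpM2l (ltW q10) (step _)) IH) _.
    by rewrite addnS exprS; rewrite le_eqVlt; apply/orP; left; apply/eqP; ring.
  move=> h; apply: le_trans h _; apply: ler_wpM2r; first exact: nrm_ge0.
  by rewrite gerBl exprn_ge0.
have qn : q ^+ n @[n --> \oo] --> 0.
  by apply: cvg_expr; rewrite ger0_norm.
have cau e : 0 < e -> exists N, forall m n, (N <= m)%N -> (N <= n)%N -> nrm (x_ m - x_ n) <= e.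
  move=> e0; have qc : q ^+ n * c @[n --> \oo] --> 0 * c by apply: cvgM => //; exact: cvg_cst.
  rewrite mul0r in qc; have e1 : 0 < (1 - q) * e by rewrite mulr_gt0.
  move/cvgrPdist_le: qc => /(_ _ e1)[N _ hN]; exists N.
  have key m n : (N <= n)%N -> (n <= m)%N -> nrm (x_ m - x_ n) <= e.
    move=> Nn nm; rewrite -(ler_pM2l q10); rewrite -(subnKC nm).
    apply: le_trans (dist _ _) _; have := hN n Nn; rewrite sub0r normrN.
    exact: le_trans (ler_norm _).
  move=> m n Nm Nn; have [nm|/ltnW mn] := leqP n m; first exact: key.
  by rewrite nrmBC; exact: key.
have [u Lu cu] := L2_complete Lx cau; exists u => //.
have c1 : cvgL2 (fun n => x_ n.+1) u.
  by rewrite /cvgL2; exact: (cvg_sub (a := fun n => nrm (x_ n - u)) (phi := S) (fun k => leqnSn k) cu).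
have c2 : cvgL2 (fun n => x_ n.+1) (F u).
  apply: (squeeze0 (b := fun n => q * nrm (x_ n - u))).
    by move=> n; rewrite nrm_ge0; exact: Fq.
  have h : q * nrm (x_ n - u) @[n --> \oo] --> q * 0 by apply: cvgM => //; exact: cvg_cst.
  by rewrite mulr0 in h; exact: h.
exact: (cvgL2_unique (fun n => Lx n.+1) (FL _ Lu) Lu c2 c1).
Qed.

End FixedPoint.

(** * The free resolvent *)

Section FreeResolvent.
Variable R : realType.
Local Notation mu := (@lebesgue_measure R).
Implicit Types u v w : Cfun R.
Variable M : R.
Hypothesis M1 : 1 <= M.

Let M0 : 0 < M. Proof. exact: lt_le_trans ltr01 M1. Qed.
Let xM (x : R) : 0 < x ^+ 2 + M. Proof. by rewrite ltr_wpDl ?sqr_ge0. Qed.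

Lemma DxD k u v : H k u -> H k v -> aeq (Dx k (u + v)) (Dx k u + Dx k v).
Proof. exact: symbD (symb_Dx R k). Qed.

Lemma DxZ k z u : H k u -> aeq (Dx k (z *: u)) (z *: Dx k u).
Proof. exact: symbZ (symb_Dx R k). Qed.

Lemma L2_Dx k u : H k u -> L2 (Dx k u).
Proof. exact: symb_L2 (symb_Dx R k). Qed.

Definition freeop u : Cfun R := - Dx 2 u + M%:C *: u.

Lemma L2_freeop u : H 2 u -> L2 (freeop u).
Proof.
move=> hu; apply: L2D; first by apply: L2N; exact: symb_L2 (symb_Dx R 2) hu.
by apply: L2Z; exact: H_L2 hu.
Qed.

Lemma fourier_freeop u : H 2 u ->
  aeq (fourier (freeop u)) (fun x => (x ^+ 2 + M)%:C * fourier u x).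
Proof.
move=> hu; have Lu := H_L2 hu; have LD := symb_L2 (symb_Dx R 2) hu.
apply: aeq_trans (fourierD (L2N LD) (L2Z _ Lu)) _.
have a1 : aeq (fourier (- Dx 2 u)) (- pmul (fun x : R => (x *i) ^+ 2) (fourier u)).
  rewrite -scaleN1r -[- pmul _ _]scaleN1r; apply: aeq_trans (fourierZ _ LD) _; apply: aeqZ.
  exact: fourier_multiplier (L2_symb (symb_Dx R 2) hu).
apply: aeS2 a1 (fourierZ M%:C Lu) => x e1 e2.
rewrite addcE e1 e2 oppcE scalecE /pmul -mulNr -mulrDl; congr (_ * _).
by apply: complexP; rewrite cReD || rewrite cImD; rewrite !ReImE /=; ring.
Qed.

(** (xi^2 + M)^2 >= M (1 + xi^2), which makes the H^1 norm small against
    [freeop] when M is large. *)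
Lemma freeop_bound u : H 2 u -> M * hnorm2 1 u <= n2 (freeop u).
Proof.
move=> hu; have [Lu iu] := (HP 1 u).1 (H2_H1 hu); have LA := L2_freeop hu.
rewrite -(n2_fourier LA).
have cR : cmeas (fun x => (x ^+ 2 + M)%:C * fourier u x).
  apply: cmeasM; last exact: L2_cmeas (L2_fourier Lu).
  by apply: cmeas_real; apply: measurable_funD => //; exact: (@measurable_funX _ _ _ _ _ 2).
rewrite (n2_ae (L2_cmeas (L2_fourier LA)) cR (fourier_freeop hu)).
have LR := L2_ae cR (L2_fourier LA) (fourier_freeop hu).
rewrite /hnorm2 -RintZ //; apply: Rint_le; [exact: integrZ|exact: L2_integr|].
move=> x; rewrite normc2M normc2_real mulrA; apply: ler_wpM2r; first exact: normc2_ge0.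
rewrite expr1 expr2; apply: ler_pM => //; [exact: ltW|by rewrite addr_ge0 ?sqr_ge0| |].
  by rewrite lerDr sqr_ge0.
by rewrite addrC lerD2l.
Qed.

(** A solution is the multiplier by 1 / (xi^2 + M), a symbol that gains two
    derivatives because M >= 1. *)
Lemma freeop_surj w : L2 w -> exists2 u, H 2 u & aeq (freeop u) w.
Proof.
move=> Lw; pose m : Cfun R := fun x => ((x ^+ 2 + M)^-1)%:C.
have cm : cmeas m.
  apply: cmeas_real; apply: continuous_measurable_fun => x.
  apply: cvgV; first by rewrite gt_eqF.
  by apply: cvgD; [exact: exprn_continuous|exact: cvg_cst].
have mle x : (1 + x ^+ 2) ^+ 2 * normc2 (m x) <= 1.
  rewrite normc2_real exprVn ler_pdivrMr ?exprn_gt0 // mul1r.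
  apply: lerXn2r; rewrite ?nnegrE ?(ltW (xM _)) ?addr_ge0 ?sqr_ge0 //.
  by rewrite addrC lerD2l.
have Lf := L2_fourier Lw; have cf := L2_cmeas Lf.
have cmf : cmeas (pmul m (fourier w)) by exact: cmeasM.
have Lm : L2 (pmul m (fourier w)).
  apply: (L2_dom (K := 1) cmf Lf) => x; rewrite normc2M; apply: ler_wpM2r; first exact: normc2_ge0.
  apply: le_trans (mle x); rewrite ler_peMl ?normc2_ge0 //; exact: jw_ge1.
have Lu := L2_multiplier Lm; have cFu := L2_cmeas (L2_fourier Lu).
have iw : integr (fun x => (1 + x ^+ 2) ^+ 2 * normc2 (pmul m (fourier w) x)).
  apply: (integr_le _ (L2_integr Lf)); first exact: meas_jwn.
  move=> x; rewrite ger0_norm ?jwn_ge0 // normc2M mulrA ler_piMl ?normc2_ge0 //.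
have hu : H 2 (multiplier m w).
  apply/HP; split; first exact: Lu.
  by apply: (integr_jwn_ae cFu iw); apply: aeS (fourier_multiplier Lm) => x ->.
exists (multiplier m w) => //.
apply: aeq_fourier_inj => //; first exact: L2_freeop.
apply: aeq_trans (fourier_freeop hu) _; apply: aeS (fourier_multiplier Lm) => x ->.
by rewrite /pmul mulrA -rmorphM mulfV ?mul1r // gt_eqF.
Qed.

End FreeResolvent.

Local Opaque Dx multiplier.

(** * Spectral theory of symmetric perturbations of the Laplacian *)

Section Operator.
Variable R : realType.
Local Notation mu := (@lebesgue_measure R).
Implicit Types u v w f g : Cfun R.

(* V is a symmetric perturbation of order one: bounded from H^1 to L^2.
   Linearity is only asked up to null sets, the functions being
   representatives of their classes. *)
Variables (V : Cfun R -> Cfun R) (K : R).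
Hypothesis V_L2 : forall u, H 1 u -> L2 (V u).
Hypothesis V_bound : forall u, H 1 u -> n2 (V u) <= K * hnorm2 1 u.
Hypothesis V_D : forall u v, H 1 u -> H 1 v -> aeq (V (u + v)) (V u + V v).
Hypothesis V_Z : forall (z : R[i]) u, H 1 u -> aeq (V (z *: u)) (z *: V u).
Hypothesis V_sym : forall u v, H 1 u -> H 1 v -> inner (V u) v = inner u (V v).

Definition schrodinger u : Cfun R := - Dx 2 u + V u.
Definition minus_spectral (z : R[i]) u : Cfun R := schrodinger u - z *: u.

Lemma L2_schrodinger u : H 2 u -> L2 (schrodinger u).
Proof.
move=> hu; apply: L2D; last exact/V_L2/H2_H1.
by apply: L2N; exact: L2_Dx hu.
Qed.

Lemma schrodingerD u v : H 2 u -> H 2 v -> aeq (schrodinger (u + v)) (schrodinger u + schrodinger v).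
Proof.
move=> hu hv; apply: aeS2 (DxD hu hv) (V_D (H2_H1 hu) (H2_H1 hv)) => x e1 e2.
rewrite -[LHS]/(- Dx 2 (u + v) x + V (u + v) x).
apply: etrans (congr2 (fun a b => - a + b) e1 e2) _.
rewrite -[LHS]/(- (Dx 2 u x + Dx 2 v x) + (V u x + V v x)).
rewrite -[RHS]/(- Dx 2 u x + V u x + (- Dx 2 v x + V v x)).
by move: (Dx 2 u x) (Dx 2 v x) (V u x) (V v x) => a b c d; ring.
Qed.

Lemma schrodingerZ z u : H 2 u -> aeq (schrodinger (z *: u)) (z *: schrodinger u).
Proof.
move=> hu; apply: aeS2 (DxZ z hu) (V_Z z (H2_H1 hu)) => x e1 e2.
rewrite -[LHS]/(- Dx 2 (z *: u) x + V (z *: u) x).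
apply: etrans (congr2 (fun a b => - a + b) e1 e2) _.
rewrite -[LHS]/(- (z * Dx 2 u x) + z * V u x) -[RHS]/(z * (- Dx 2 u x + V u x)).
by move: (Dx 2 u x) (V u x) => a b; ring.
Qed.

Lemma schrodingerB u v : H 2 u -> H 2 v -> aeq (schrodinger (u - v)) (schrodinger u - schrodinger v).
Proof.
move=> hu hv; rewrite -scaleN1r -[- schrodinger v]scaleN1r.
apply: aeq_trans (schrodingerD hu (HZ _ hv)) _.
by apply: aeqD; [exact: aeq_refl|exact: schrodingerZ].
Qed.

Lemma schrodinger_sym u v : H 2 u -> H 2 v -> inner (schrodinger u) v = inner u (schrodinger v).
Proof.
move=> hu hv; have Lu := H_L2 hu; have Lv := H_L2 hv.
have Du := L2_Dx hu; have Dv := L2_Dx hv.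
have Vu := V_L2 (H2_H1 hu); have Vv := V_L2 (H2_H1 hv).
rewrite (innerDl (L2N Du) Vu Lv) (innerDr (L2N Dv) Vv Lu).
rewrite (innerNl Du Lv) (innerNr Dv Lu) (V_sym (H2_H1 hu) (H2_H1 hv)); congr (- _ + _).
apply: (symb_selfadjoint (symb_Dx R 2)) hu hv => x.
by rewrite expr2 cImM /= mul0r mulr0 addr0.
Qed.

Lemma L2_minus_spectral z u : H 2 u -> L2 (minus_spectral z u).
Proof. by move=> hu; apply: L2B; [exact: L2_schrodinger|apply: L2Z; exact: H_L2 hu]. Qed.

Lemma minus_spectralB z u v : H 2 u -> H 2 v -> aeq (minus_spectral z (u - v)) (minus_spectral z u - minus_spectral z v).
Proof.
move=> hu hv; apply: aeS (schrodingerB hu hv) => x e.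
by rewrite /minus_spectral !(addcE, oppcE, scalecE) e !(addcE, oppcE); ring.
Qed.

Variables (ev : Cfun R) (Lambda : R).
Hypothesis ev_H2 : H 2 ev.
Hypothesis ev_ker : aeq (schrodinger ev) 0.
Hypothesis ev_n0 : n2 ev != 0.
Hypothesis coercive : forall u, H 2 u -> inner u ev = 0 ->
  Lambda * n2 u <= Re (inner (schrodinger u) u).

Lemma inner_schrodinger_real u : H 2 u -> Im (inner (schrodinger u) u) = 0.
Proof.
move=> hu; have := congr1 (@complex.Im R) (schrodinger_sym hu hu).
rewrite (inner_sym (L2_schrodinger hu) (H_L2 hu)) cImJ; move: (Im _) => a h; lra.
Qed.

Lemma inner_minus_spectral z u : H 2 u ->
  Re (inner (minus_spectral z u) u) = Re (inner (schrodinger u) u) - Re z * n2 u /\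
  Im (inner (minus_spectral z u) u) = - (Im z * n2 u).
Proof.
move=> hu; have Lu := H_L2 hu.
rewrite (innerBl (L2_schrodinger hu) (L2Z z Lu) Lu) (innerZl z Lu Lu) inner_self.
rewrite cReD cReN cImD cImN cReM cImM (inner_schrodinger_real hu).
rewrite -[Re (n2 u)%:C]/(n2 u) -[Im (n2 u)%:C]/(0 : R).
by split; [rewrite mulr0 subr0|rewrite mulr0 !add0r].
Qed.

(** Cauchy-Schwarz bounds both the real and the imaginary part of the inner
    product of minus_spectral z u with u by the product of the norms. *)
Lemma perp_bound z u d : H 2 u -> inner u ev = 0 ->
  d <= Lambda - Re z \/ d <= `|Im z| -> d * nrm u <= nrm (minus_spectral z u).
Proof.
move=> hu orth hd; have Lu := H_L2 hu; have Ls := L2_minus_spectral z hu.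
have [hr hi] := inner_minus_spectral z hu.
have cs := cauchy_schwarz Ls Lu.
have key : d * (nrm u * nrm u) <= nrm (minus_spectral z u) * nrm u.
  rewrite -expr2 nrm_sqr; apply: le_trans cs.
  case: hd => hd.
    apply: le_trans (le_trans (ler_norm _) (absRe_le _)); rewrite hr.
    have := coercive hu orth; have := ler_wpM2r (n2_ge0 u) hd.
    by rewrite mulrBl; move: (n2 u) (Re (inner _ _)) => a b; lra.
  apply: le_trans (absIm_le _); rewrite hi normrN normrM [X in _ <= _ * X]ger0_norm ?n2_ge0 //.
  by apply: ler_wpM2r hd; exact: n2_ge0.
have [->|n0] := eqVneq (nrm u) 0; first by rewrite mulr0 nrm_ge0.
have np : 0 < nrm u by rewrite lt_neqAle eq_sym n0 nrm_ge0.
by rewrite mulrA ler_pM2r in key.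
Qed.

(** The operator respects the decomposition along ev and its orthogonal
    complement, by symmetry and because it sends ev to - z ev. On the line of
    ev it has norm |z| >= d, on the complement it is bounded below by
    [perp_bound], and the two parts add up by Pythagoras on both sides. *)
Lemma minus_spectral_bound z d u : 0 <= d -> d ^+ 2 <= normc2 z ->
  d <= Lambda - Re z \/ d <= `|Im z| -> H 2 u -> d * nrm u <= nrm (minus_spectral z u).
Proof.
move=> d0 dz hd hu; have Lu := H_L2 hu; have Le := H_L2 ev_H2.
have nC : (n2 ev)%:C != 0 :> R[i] by rewrite -(rmorph0 (@real_complex R)) (inj_eq (@complexI R)).
pose a : R[i] := inner u ev / (n2 ev)%:C.
pose w := u - a *: ev.
have hw : H 2 w := HB hu (HZ a ev_H2).
have Lw := H_L2 hw; have Lae := L2Z a Le.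
have orth : inner w ev = 0.
  by rewrite /w innerBl // innerZl // inner_self /a mulfVK // subrr.
have orth2 : inner (minus_spectral z w) ev = 0.
  rewrite (innerBl (L2_schrodinger hw) (L2Z z Lw) Le) (innerZl z Lw Le) orth mulr0 subr0.
  rewrite (schrodinger_sym hw ev_H2).
  rewrite (inner_ae (L2_cmeas Lw) (L2_cmeas Lw) (L2_cmeas (L2_schrodinger ev_H2)) (L2_cmeas (L2_0 R)) (aeq_refl w) ev_ker).
  by rewrite -(scale0r ev) innerZr // rmorph0 mul0r.
have pyth (p q : Cfun R) c : L2 p -> L2 q -> inner p q = 0 -> n2 (p + c *: q) = n2 p + normc2 c * n2 q.
  by move=> Lp Lq h; rewrite n2D ?n2Z // ?innerZr // ?h ?mulr0 ?addr0 //; exact: L2Z.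
have uw : u = w + a *: ev by rewrite /w subrK.
have E : aeq (minus_spectral z u) (minus_spectral z w + (- z * a) *: ev).
  have ha := HZ a ev_H2.
  rewrite {1}uw; apply: aeS2 (schrodingerD hw ha) (aeS2 (fun x => @conj _ _) (schrodingerZ a ev_H2) ev_ker) => x e1 [e2 e3].
  rewrite /minus_spectral !(addcE, oppcE, scalecE) in e1 e2 e3 *.
  by rewrite e1 e2 e3 zerocE; ring.
have Ls := L2_minus_spectral z hw.
have n2u : n2 u = n2 w + normc2 a * n2 ev by rewrite {1}uw pyth.
have n2s : n2 (minus_spectral z u) = n2 (minus_spectral z w) + normc2 z * (normc2 a * n2 ev).
  rewrite (n2_ae (L2_cmeas (L2_minus_spectral z hu)) (L2_cmeas (L2D Ls (L2Z _ Le))) E).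
  by rewrite pyth // normc2M normc2N mulrA.
rewrite -(@ler_pXn2r _ 2) ?nnegrE ?mulr_ge0 ?nrm_ge0 // exprMn !nrm_sqr n2u n2s mulrDr.
apply: lerD; last by apply: ler_wpM2r => //; rewrite mulr_ge0 ?normc2_ge0 ?n2_ge0.
have := perp_bound hw orth hd.
rewrite -(@ler_pXn2r _ 2) ?nnegrE ?mulr_ge0 ?nrm_ge0 // exprMn !nrm_sqr.
by [].
Qed.

Definition surj z := forall g, L2 g -> exists2 u, H 2 u & aeq (minus_spectral z u) g.

(** A solution at z is a fixed point of u |-> S (g + (z - z0) u), where S is a
    right inverse at z0; S contracts by 1 / d, so this map contracts by |z -
    z0| / d < 1. *)
Lemma surj_step z0 z d : surj z0 -> 0 < d ->
  (forall u, H 2 u -> d * nrm u <= nrm (minus_spectral z0 u)) ->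
  normc2 (z - z0) < d ^+ 2 -> surj z.
Proof.
move=> s0 d0 hd hz g Lg.
(* The right inverse is chosen pointwise and is not linear; the lower bound
   still makes its differences contract, as it applies to differences of
   solutions. *)
have /choice[S hS] f : exists u, L2 f -> H 2 u /\ aeq (minus_spectral z0 u) f.
  have [Lf|nLf] := pselect (L2 f); last by exists 0 => /nLf.
  by have [u h1 h2] := s0 _ Lf; exists u.
pose q := Num.sqrt (normc2 (z - z0)) / d.
have sd : Num.sqrt (normc2 (z - z0)) < d.
  by rewrite -[ltRHS](ger0_norm (ltW d0)) -sqrtr_sqr ltr_sqrt // exprn_gt0.
have q01 : 0 <= q < 1 by rewrite /q divr_ge0 ?sqrtr_ge0 ?(ltW d0) //= ltr_pdivrMr // mul1r.
have LG u : L2 u -> L2 (g + (z - z0) *: u) by move=> Lu; apply: L2D => //; exact: L2Z.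
have [||u Lu hu] := banach_fixed_point (F := fun u => S (g + (z - z0) *: u)) q01.
- by move=> u Lu; have [h _] := hS _ (LG _ Lu); exact: H_L2 h.
- move=> u v Lu Lv; have [h1 k1] := hS _ (LG _ Lu); have [h2 k2] := hS _ (LG _ Lv).
  set su := S _ in h1 k1 *; set sv := S _ in h2 k2 *.
  have h := hd _ (HB h1 h2).
  have E : nrm (minus_spectral z0 (su - sv)) = Num.sqrt (normc2 (z - z0)) * nrm (u - v).
    rewrite -nrmZ; last exact: L2B.
    apply: nrm_ae.
    - by apply: L2_cmeas; apply: L2_minus_spectral; exact: HB.
    - by apply: L2_cmeas; apply: L2Z; exact: L2B.
    - apply: aeS2 (minus_spectralB z0 h1 h2) (aeS2 (fun x => @conj _ _) k1 k2) => x e1 [e2 e3].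
      by rewrite e1 !(addcE, oppcE, scalecE) e2 e3 !(addcE, oppcE, scalecE); ring.
  by rewrite /q mulrAC ler_pdivlMr // mulrC -E.
have [h1 k1] := hS _ (LG _ Lu); exists (S (g + (z - z0) *: u)) => //.
apply: aeS2 hu k1 => x e1; rewrite /minus_spectral !(addcE, oppcE, scalecE) e1 => e2.
by rewrite -[LHS](addrK ((z0 - z) * u x)); rewrite -[RHS]addr0 -[X in _ = _ + X](subrr (z0 * u x)); move: e2 => /eqP; rewrite subr_eq => /eqP ->; ring.
Qed.

(** The segment is cut into N pieces shorter than d, each of which is one
    [surj_step]. *)
Lemma surj_line z0 z1 d : surj z0 -> 0 < d ->
  (forall t u, 0 <= t <= 1 -> H 2 u -> d * nrm u <= nrm (minus_spectral (z0 + t%:C * (z1 - z0)) u)) ->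
  surj z1.
Proof.
move=> s0 d0 hd.
pose N := (Num.truncn (Num.sqrt (normc2 (z1 - z0)) / d)).+1.
have N0 : 0 < N%:R :> R by rewrite ltr0n.
have hN : Num.sqrt (normc2 (z1 - z0)) < d * N%:R.
  by rewrite mulrC -ltr_pdivrMr //; exact: truncnS_gt.
have key k : (k <= N)%N -> surj (z0 + (k%:R / N%:R)%:C * (z1 - z0)).
  elim: k => [_|k IH kN]; first by rewrite mul0r mul0r addr0.
  apply: (surj_step (IH (ltnW kN)) d0).
    move=> u hu; apply: hd => //; rewrite divr_ge0 //= ler_pdivrMr // mul1r ler_nat.
    exact: ltnW.
  rewrite (_ : _ - _ = (N%:R^-1)%:C * (z1 - z0)); last first.
    by rewrite -addn1 natrD mulrDl mul1r rmorphD /=; ring.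
  rewrite normc2M normc2_real exprVn mulrC ltr_pdivrMr ?exprn_gt0 // -exprMn.
  rewrite -[ltLHS]sqr_sqrtr ?normc2_ge0 //.
  by rewrite ltr_pXn2r // ?nnegrE ?sqrtr_ge0 // mulr_ge0 // ltW.
by have := key N (leqnn N); rewrite divff ?gt_eqF // mul1r addrC subrK.
Qed.

(** M so large that V is small against - d^2/dx^2 + M ([V_small]). *)
Definition bigM : R := 4 * `|K| + 1.

Lemma bigM1 : 1 <= bigM. Proof. by rewrite lerDr mulr_ge0. Qed.

Lemma V_small u : H 2 u -> 4 * n2 (V u) <= n2 (freeop bigM u).
Proof.
move=> hu; apply: le_trans (freeop_bound bigM1 hu).
have h := V_bound (H2_H1 hu); have h0 := hnorm2_ge0 1 u.
apply: (@le_trans _ _ (4 * (`|K| * hnorm2 1 u))).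
  rewrite ler_pM2l //; apply: le_trans h _; apply: ler_wpM2r => //; exact: ler_norm.
by rewrite mulrA; apply: ler_wpM2r => //; rewrite lerDl.
Qed.

Lemma freeopB M u v : H 2 u -> H 2 v -> aeq (freeop M (u - v)) (freeop M u - freeop M v).
Proof.
move=> hu hv; apply: aeS2 (DxD hu (HZ (-1) hv)) (DxZ (-1) hv) => x e1 e2.
have E : Dx 2 (u - v) x = Dx 2 u x + -1 * Dx 2 v x.
  by rewrite -[- v]scaleN1r; apply: etrans e1 _; exact: congr1 e2.
rewrite -[LHS]/(- Dx 2 (u - v) x + M%:C * (u x - v x)) E.
rewrite -[RHS]/(- Dx 2 u x + M%:C * u x - (- Dx 2 v x + M%:C * v x)).
by move: (Dx 2 u x) (Dx 2 v x) (u x) (v x) => a b c d; ring.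
Qed.

(** With w = (- d^2/dx^2 + M) u the equation reads w = g - V (S w), S being a
    right inverse of - d^2/dx^2 + M; by [V_small] the right side contracts by
    1 / 2. *)
Lemma surj_base : surj (- bigM%:C).
Proof.
move=> g Lg.
have /choice[S hS] w : exists u, L2 w -> H 2 u /\ aeq (freeop bigM u) w.
  have [Lf|nLf] := pselect (L2 w); last by exists 0 => /nLf.
  by have [u h1 h2] := freeop_surj bigM1 Lf; exists u.
have [|||w Lw hw] := banach_fixed_point (F := fun w => g - V (S w)) (q := 2^-1).
- by rewrite invr_ge0 ler0n invf_lt1 // ltr1n.
- by move=> w Lw; apply: L2B => //; apply/V_L2/H2_H1; have [] := hS _ Lw.
- move=> u v Lu Lv; have [h1 k1] := hS _ Lu; have [h2 k2] := hS _ Lv.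
  have hB := HB h1 h2.
  have E1 : nrm (g - V (S u) - (g - V (S v))) = nrm (V (S u - S v)).
    rewrite -[RHS]nrmN; apply: nrm_ae.
    - by apply: L2_cmeas; apply: L2B; apply: L2B => //; apply/V_L2/H2_H1.
    - by apply: L2_cmeas; apply: L2N; apply/V_L2/H2_H1.
    - rewrite -[- S v]scaleN1r.
      apply: aeS2 (V_D (H2_H1 h1) (HZ (-1) (H2_H1 h2))) (V_Z (-1) (H2_H1 h2)) => x.
      rewrite !(addcE, oppcE, scalecE) => e1 e2; rewrite e1 e2; ring.
  have E2 : nrm (freeop bigM (S u - S v)) = nrm (u - v).
    apply: nrm_ae; try apply: L2_cmeas; [exact: L2_freeop|exact: L2B|].
    apply: aeS2 (freeopB bigM h1 h2) (aeS2 (fun x => @conj _ _) k1 k2) => x e1 [e2 e3].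
    by rewrite e1 !(addcE, oppcE) e2 e3.
  rewrite E1 -E2 -(@ler_pXn2r _ 2) ?nnegrE ?mulr_ge0 ?nrm_ge0 ?invr_ge0 // exprMn !nrm_sqr.
  by have := V_small hB; move: (n2 _) (n2 _) => a b; rewrite expr2; lra.
have [h1 k1] := hS _ Lw; exists (S w) => //.
apply: aeS2 hw k1 => x; rewrite /minus_spectral /schrodinger /freeop !(addcE, oppcE, scalecE) => e1 e2.
have -> : g x = w x + V (S w) x by rewrite -e1 subrK.
by rewrite -e2; ring.
Qed.

(** From - M one moves vertically to - M + i y: the real part stays at - M,
    where the lower bound is at least M. Then one moves horizontally to z,
    where the imaginary part stays at y and the lower bound is at least |y|.
    Neither segment meets the spectrum, which is real and contained in {0}
    union [Lambda, +oo). *)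
Lemma surj_nonreal z : Im z != 0 -> 0 < Lambda -> surj z.
Proof.
move=> yn0 L0; set y := Im z in yn0 *; set M := bigM.
have M0 : 0 < M := lt_le_trans ltr01 bigM1.
have y0 : 0 < `|y| by rewrite normr_gt0.
have s1 : surj ((- M) +i* y).
  apply: (surj_line surj_base M0) => t u /andP[t0 t1] hu.
  set zz := _ + _ * _.
  have rz : Re zz = - M by rewrite /zz !ReImE /= -/M; ring.
  apply: minus_spectral_bound hu; first exact: ltW.
    by rewrite /normc2 rz sqrrN lerDl sqr_ge0.
  by left; rewrite rz opprK lerDr ltW.
apply: (surj_line s1 y0) => t u /andP[t0 t1] hu.
set zz := _ + _ * _.
have iz : Im zz = y by rewrite /zz !ReImE /= -/y -/M; ring.
apply: minus_spectral_bound hu; first exact: ltW.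
  by rewrite /normc2 iz real_normK ?num_real // lerDr sqr_ge0.
by right; rewrite iz.
Qed.

(** A nonreal z is [surj_nonreal]. A real z in the gap is at distance d / 2
    from the nonreal z + i d / 2, where the lower bound is still at least d,
    so a single [surj_step] reaches it. *)
Lemma minus_spectral_resolvent z : 0 < Lambda -> z != 0 -> (Im z != 0 \/ Re z < Lambda) ->
  surj z /\ exists2 d, 0 < d & forall u, H 2 u -> d * nrm u <= nrm (minus_spectral z u).
Proof.
move=> L0 zn0 hz.
have nz : 0 < normc2 z.
  rewrite lt_neqAle normc2_ge0 andbT eq_sym; apply: contra zn0 => /eqP h.
  by rewrite (normc2_eq0 h).
have [y0|yn0] := eqVneq (Im z) 0; last first.
  split; first exact: surj_nonreal.
  have y0 : 0 < `|Im z| by rewrite normr_gt0.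
  exists `|Im z| => // u hu; apply: minus_spectral_bound hu; first exact: ltW.
    by rewrite /normc2 real_normK ?num_real // lerDr sqr_ge0.
  by right.
have xL : Re z < Lambda by case: hz => //; rewrite y0 eqxx.
pose d := Num.min (Lambda - Re z) (Num.sqrt (normc2 z)).
have d0 : 0 < d by rewrite lt_min subr_gt0 xL sqrtr_gt0 nz.
have dl : d <= Lambda - Re z by rewrite ge_min lexx.
have dz : d ^+ 2 <= normc2 z.
  rewrite -[leRHS]sqr_sqrtr ?normc2_ge0 //; apply: lerXn2r; rewrite ?nnegrE ?(ltW d0) ?sqrtr_ge0 //.
  by rewrite ge_min lexx orbT.
split; last first.
  by exists d => // u hu; apply: minus_spectral_bound hu => //; [exact: ltW|left].
pose z0 : R[i] := Re z +i* (d / 2).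
have d2 : 0 < d / 2 by rewrite divr_gt0.
have s0 : surj z0 by apply: surj_nonreal => //=; rewrite gt_eqF.
apply: (surj_step s0 d0).
  move=> u hu; apply: minus_spectral_bound hu; [exact: ltW| |by left].
  by apply: le_trans dz _; rewrite /normc2 /= y0 expr0n lerD2l sqr_ge0.
have -> : normc2 (z - z0) = (d / 2) ^+ 2.
  by rewrite /normc2 cReD cReN cImD cImN /= subrr expr0n add0r y0 sub0r sqrrN.
rewrite exprMn; have := exprn_gt0 2 d0; move: (d ^+ 2) => a; rewrite expr2; lra.
Qed.

(** Elliptic regularity: - u'' + M u equals (L - z) u + (M + z) u - V u. The
    second term is controlled by the L^2 lower bound and the last one is
    absorbed in the left side by [V_small]. *)
Lemma minus_spectral_H1_bound z d : 0 < d -> (forall u, H 2 u -> d * nrm u <= nrm (minus_spectral z u)) ->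
  exists2 C : R, 0 <= C & forall u, H 2 u -> hnorm2 1 u <= C * n2 (minus_spectral z u).
Proof.
move=> d0 hd; set c : R[i] := bigM%:C + z.
exists (8 * (1 + normc2 c / d ^+ 2)).
  by rewrite mulr_ge0 // addr_ge0 // divr_ge0 ?normc2_ge0 // sqr_ge0.
have aux (x1 x2 x3 x4 x5 h N k : R) : x1 <= 2 * x2 + 2 * x3 -> x2 <= 2 * N + 2 * x4 ->
  4 * x3 <= x1 -> x4 <= k -> x5 <= x1 -> h <= x5 -> h <= 8 * (N + k) by lra.
move=> u hu; have Lu := H_L2 hu; have Vu := V_L2 (H2_H1 hu); have Ls := L2_minus_spectral z hu.
have L3 := L2D Ls (L2Z c Lu).
have E : freeop bigM u = (minus_spectral z u + c *: u) + - V u.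
  apply/funext => x; rewrite /freeop /minus_spectral /schrodinger !(addcE, oppcE, scalecE) /c; ring.
have b1 : n2 (freeop bigM u) <= 2 * n2 (minus_spectral z u + c *: u) + 2 * n2 (V u).
  by rewrite E -[n2 (V u)]n2N; apply: n2D_le => //; exact: L2N.
have b2 := n2D_le Ls (L2Z c Lu).
have b3 := V_small hu.
have b4 : n2 (c *: u) <= normc2 c / d ^+ 2 * n2 (minus_spectral z u).
  rewrite n2Z // -mulrA; apply: ler_wpM2l; first exact: normc2_ge0.
  rewrite mulrC ler_pdivlMr ?exprn_gt0 // -!nrm_sqr -exprMn.
  apply: lerXn2r; rewrite ?nnegrE ?mulr_ge0 ?nrm_ge0 ?(ltW d0) //.
  by rewrite mulrC; exact: hd.
have b5 := freeop_bound bigM1 hu.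
have b6 : hnorm2 1 u <= bigM * hnorm2 1 u by rewrite ler_peMl ?hnorm2_ge0 ?bigM1.
rewrite -mulrA [(1 + _) * _]mulrDl mul1r.
exact: aux b1 b2 b3 b4 b5 b6.
Qed.

End Operator.

Local Transparent Dx multiplier.

Section SupNorm.
Variable R : realType.
Local Notation mu := (@lebesgue_measure R).
Implicit Types c u : Cfun R.

(** With c = c_theta this makes the last term of the linearized operator
    bounded from H^1 to L^2: the Sobolev bound applies to u and leaves the L^2
    norm of c. *)
Lemma L2_pmul_sup c u : L2 c -> H 1 u ->
  L2 (pmul c u) /\ n2 (pmul c u) <= hnorm2 1 u * n2 c.
Proof.
move=> Lc hu; have Lu := H_L2 hu; have cm := cmeasM (L2_cmeas Lc) (L2_cmeas Lu).
have ic := integrZ (hnorm2 1 u) (L2_integr Lc).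
have le : (\int[mu]_x (normc2 (pmul c u x))%:E <= \int[mu]_x (hnorm2 1 u * normc2 (c x))%:E)%E.
  apply: ae_ge0_le_integral => //.
  - by move=> x _; rewrite lee_fin normc2_ge0.
  - by apply: meas_EFin; exact: meas_normc2.
  - by move=> x _; rewrite lee_fin mulr_ge0 ?hnorm2_ge0 ?normc2_ge0.
  - by apply: meas_EFin; exact: integr_meas.
  - apply: aeS (sobolev_sup hu) => x h _; rewrite lee_fin normc2M mulrC.
    by apply: ler_wpM2r h; exact: normc2_ge0.
have L : L2 (pmul c u).
  apply/L2P; split; first exact: cm.
  apply: integr_ge0P; [exact: meas_normc2|by move=> x; exact: normc2_ge0|].
  by apply: le_lt_trans le _; exact: integr_fin.
split; first exact: L.
move: le; rewrite RintE; last exact: L2_integr.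
by rewrite RintE // lee_fin RintZ //; exact: L2_integr.
Qed.

Lemma halflapD u v : H 1 u -> H 1 v -> aeq (halflap (u + v)) (halflap u + halflap v).
Proof. exact: symbD (@symb_abs R). Qed.

Lemma halflapZ z u : H 1 u -> aeq (halflap (z *: u)) (z *: halflap u).
Proof. exact: symbZ (@symb_abs R). Qed.

Lemma L2_halflap u : H 1 u -> L2 (halflap u).
Proof. exact: symb_L2 (@symb_abs R). Qed.

Lemma n2_halflap u : H 1 u -> n2 (halflap u) <= hnorm2 1 u.
Proof. by move=> hu; have := symb_n2 (@symb_abs R) hu; rewrite mul1r. Qed.

Lemma halflap_sym u v : H 1 u -> H 1 v -> inner (halflap u) v = inner u (halflap v).
Proof. exact: symb_selfadjoint (@symb_abs R) (fun=> erefl). Qed.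

Lemma pmulD c u v : pmul c (u + v) = pmul c u + pmul c v.
Proof. by apply/funext => x; rewrite addcE /pmul addcE mulrDr. Qed.

Lemma pmulZ c z u : pmul c (z *: u) = z *: pmul c u.
Proof. by apply/funext => x; rewrite scalecE /pmul scalecE mulrCA. Qed.

Lemma ReMr (z : R[i]) (r : R) : Re (z * r%:C) = Re z * r.
Proof. by rewrite cReM /= mulr0 subr0. Qed.

Lemma inner_pmulr (a : R -> R) u v : inner (pmul (ofreal a) u) v = inner u (pmul (ofreal a) v).
Proof.
congr Cintegral; apply/funext => x; rewrite /pmul [X in _ = _ * X]conjcM mulrCA mulrA.
by congr (_ * _); rewrite mulrC [in RHS]mulrC; congr (_ * _); exact/esym/conjc_real.
Qed.

Lemma inner_pmul_real c u v : cmeas c -> {ae mu, forall x, Im (c x) = 0} -> cmeas u -> cmeas v ->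
  inner (pmul c u) v = inner u (pmul c v).
Proof.
move=> mc hc mu_ mv; pose a x := Re (c x); have ma : meas a by case: mc.
have E w : aeq (pmul c w) (pmul (ofreal a) w).
  by apply: aeS hc => x h; rewrite /pmul; congr (_ * _); apply: complexP.
have m1 w : cmeas w -> cmeas (pmul (ofreal a) w) := cmeas_pmulr ma.
have m2 w : cmeas w -> cmeas (pmul c w) := cmeasM mc.
rewrite (inner_ae (m2 u mu_) (m1 u mu_) mv mv (E u) (aeq_refl v)) inner_pmulr.
exact: (inner_ae mu_ mu_ (m1 v mv) (m2 v mv) (aeq_refl u) (aeq_sym (E v))).
Qed.

(** Integration by parts, as xi^2 = - (i xi)^2 on the Fourier side. *)
Lemma n2_Dx1 u : H 2 u -> n2 (Dx 1 u) = - Re (inner (Dx 2 u) u).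
Proof.
move=> hu; have Lu := H_L2 hu; have L1 := L2_symb (symb_Dx R 1) (H2_H1 hu).
have L2_ := L2_symb (symb_Dx R 2) hu.
rewrite (n2_multiplier L1) (inner_multiplier L2_ Lu) /n2 -[Re _]/(\int[mu]_x _).
rewrite -RintN; last by apply: integr_ReM => //; apply: L2J; exact: L2_fourier.
apply: eq_Rintegral => x _; rewrite /pmul -mulrA normc2_mulJ normc2M expr1 normc2_im expr2 cReM.
by rewrite ReImE /=; ring.
Qed.

Lemma Re_inner_halflap u : H 1 u ->
  Re (inner (u + halflap u) u) = \int[mu]_xi ((1 + `|xi|) * normc2 (fourier u xi)).
Proof.
move=> hu; have Lu := H_L2 hu; have Lh := L2_halflap hu; have Lf := L2_fourier Lu.
have La := L2_symb (@symb_abs R) hu.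
rewrite innerDl // cReD inner_self (inner_multiplier La Lu) -[Re (n2 u)%:C]/(n2 u) -(n2_fourier Lu).
rewrite -[Re _]/(\int[mu]_x _) /n2 -RintD; first last.
- by apply: integr_ReM => //; apply: L2J.
- exact: L2_integr.
apply: eq_Rintegral => x _; rewrite /pmul -mulrA normc2_mulJ cReM /=; ring.
Qed.

End SupNorm.

(** * The linearized operator *)

Section NeelOperator.
Variables (R : realType) (theta : R -> R).
Local Notation mu := (@lebesgue_measure R).
Hypothesis wall : static_neel_wall theta.
Hypothesis theta_smooth : smooth theta.
Hypothesis theta_incr : forall x : R, 0 < derive1 theta x.
Hypothesis dtheta_H2 : H 2 (ofreal (derive1 theta)).
Hypothesis theta_EL : euler_lagrange theta.

Local Notation E := (ofreal (derive1 theta)).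
Local Notation S := (sin_wall theta).

Definition potential (u : Cfun R) : Cfun R :=
  pmul S (pmul S u + halflap (pmul S u)) - pmul (c_theta theta) u.

Lemma linopE u : linop theta u = schrodinger potential u.
Proof. by apply/funext => x; exact: esym (addrA _ _ _). Qed.

Let hS u : H 1 u -> H 1 (pmul S u). Proof. exact: H1_S. Qed.
Let Lc : L2 (c_theta theta). Proof. exact: L2_c_theta. Qed.
Let ms : meas (fun x => sin (theta x)). Proof. exact: meas_sin_theta. Qed.

Let LX u : H 1 u -> L2 (pmul S u + halflap (pmul S u)).
Proof. by move=> /hS h; apply: L2D; [exact: H_L2 h|exact: L2_halflap]. Qed.

Lemma potential_L2 u : H 1 u -> L2 (potential u).
Proof.
move=> hu; apply: L2B; last by have [] := L2_pmul_sup Lc hu.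
exact: (L2_pmulr ms (@sin_abs1 R theta) (LX hu)).
Qed.

Definition potential_bd : R := 8 * (2 + 2 * dtheta_bound theta ^+ 2) + 2 * n2 (c_theta theta).

Lemma potential_bound u : H 1 u -> n2 (potential u) <= potential_bd * hnorm2 1 u.
Proof.
have aux (x y p q c k h c0 hS' : R) : x <= y -> y <= 2 * p + 2 * q -> q <= hS' -> p <= hS' ->
    hS' <= k * h -> c <= h * c0 -> 2 * x + 2 * c <= (8 * k + 2 * c0) * h.
  rewrite (_ : (8 * k + 2 * c0) * h = 8 * (k * h) + 2 * (h * c0)); last by ring.
  by move: (k * h) (h * c0) => a b; lra.
move=> hu; have [L1 b1] := L2_pmul_sup Lc hu; have LXu := LX hu; have h := hS hu.
have L2_ := L2_pmulr ms (@sin_abs1 R theta) LXu.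
have b2 := n2_pmulr ms (@sin_abs1 R theta) LXu; rewrite expr1n mul1r in b2.
have b3 := n2D_le (H_L2 h) (L2_halflap h).
have b4 := n2_halflap h; have b5 := n2_le_hnorm2 h.
have b6 := hnorm2_S theta_smooth dtheta_H2 hu.
have b7 := n2D_le L2_ (L2N L1); rewrite n2N in b7.
apply: le_trans b7 _; rewrite /potential_bd.
exact: aux b2 b3 b4 b5 b6 b1.
Qed.

Lemma potentialD u v : H 1 u -> H 1 v -> aeq (potential (u + v)) (potential u + potential v).
Proof.
move=> hu hv; have h : aeq (halflap (pmul S (u + v))) (halflap (pmul S u) + halflap (pmul S v)).
  by rewrite (pmulD S u v); apply: halflapD; exact: hS.
apply: aeS h => x h.
rewrite -[LHS]/(S x * (S x * (u x + v x) + halflap (pmul S (u + v)) x) - c_theta theta x * (u x + v x)) h.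
rewrite -[RHS]/((S x * (S x * u x + halflap (pmul S u) x) - c_theta theta x * u x) +
  (S x * (S x * v x + halflap (pmul S v) x) - c_theta theta x * v x)) addcE.
by move: (halflap _ x) (halflap _ x) (S x) (u x) (v x) (c_theta _ x) => a b c d e f; ring.
Qed.

Lemma potentialZ z u : H 1 u -> aeq (potential (z *: u)) (z *: potential u).
Proof.
move=> hu; have h : aeq (halflap (pmul S (z *: u))) (z *: halflap (pmul S u)).
  by rewrite (pmulZ S z u); apply: halflapZ; exact: hS.
apply: aeS h => x h.
rewrite -[LHS]/(S x * (S x * (z * u x) + halflap (pmul S (z *: u)) x) - c_theta theta x * (z * u x)) h.
rewrite -[RHS]/(z * (S x * (S x * u x + halflap (pmul S u) x) - c_theta theta x * u x)) scalecE.
by move: (halflap _ x) (S x) (u x) (c_theta _ x) => a b c d; ring.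
Qed.

(** Multiplication by sin theta and by c_theta is symmetric as these functions
    are real almost everywhere, and the half-Laplacian has a real symbol. *)
Lemma potential_sym u v : H 1 u -> H 1 v -> inner (potential u) v = inner u (potential v).
Proof.
move=> hu hv; have Lu := H_L2 hu; have Lv := H_L2 hv.
have [Lcu _] := L2_pmul_sup Lc hu; have [Lcv _] := L2_pmul_sup Lc hv.
have Xu := LX hu; have Xv := LX hv.
have SXu := L2_pmulr ms (@sin_abs1 R theta) Xu; have SXv := L2_pmulr ms (@sin_abs1 R theta) Xv.
have hu' := hS hu; have hv' := hS hv.
have LSu := H_L2 hu'; have LSv := H_L2 hv'.
rewrite (innerBl SXu Lcu Lv) (innerBr SXv Lcv Lu).
have hc := c_theta_real wall theta_smooth theta_incr theta_EL.
rewrite (inner_pmul_real (L2_cmeas Lc) hc (L2_cmeas Lu) (L2_cmeas Lv)).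
rewrite (inner_pmulr _ (pmul S u + _) v) -(inner_pmulr _ u (pmul S v + _)).
rewrite (innerDl LSu (L2_halflap hu') LSv) (innerDr LSv (L2_halflap hv') LSu).
by rewrite (halflap_sym hu' hv').
Qed.

(** On H^2 the quadratic form of the coercivity hypothesis is that of the
    operator, so the hypothesis gives the lower bound on the complement of
    theta'. *)
Lemma linform_inner u : H 2 u -> linform theta u = Re (inner (linop theta u) u).
Proof.
move=> hu2; have hu := H2_H1 hu2; have Lu := H_L2 hu; have h := hS hu.
have [Lcu _] := L2_pmul_sup Lc hu; have Xu := LX hu.
have SXu := L2_pmulr ms (@sin_abs1 R theta) Xu.
have LD := L2_Dx hu2.
rewrite linopE (innerDl (L2N LD) (potential_L2 hu) Lu) (innerNl LD Lu) cReD cReN -(n2_Dx1 hu2).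
rewrite (innerBl SXu Lcu Lu) cReD cReN (inner_pmulr _ (pmul S u + _) u) (Re_inner_halflap h) addrA.
congr (_ - _).
  by congr (_ + _); rewrite fine_norm2.
rewrite -[RHS]/(\int[mu]_x _); apply: eq_Rintegral => x _.
by rewrite -[pmul _ u x]/(c_theta theta x * u x) -mulrA normc2_mulJ ReMr.
Qed.

Lemma dtheta_neq0 : n2 E != 0.
Proof.
apply/eqP => h; have := n2_eq0_ae (H_L2 dtheta_H2) h.
move=> [N [mN N0 hN]].
pose I : set R := `[0, 1]%classic.
have : (mu I <= mu N)%E.
  apply: le_measure; [by rewrite inE; exact: measurable_itv|by rewrite inE|].
  move=> x _; apply: hN => /= /(congr1 (@complex.Re R)) /= e0.
  by have := theta_incr x; rewrite e0 ltxx.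
by rewrite N0 lebesgue_measure_itv /= lte_fin ltr01 oppr0 adde0 lee_fin ler10.
Qed.

(** The abstract spectral theory applied with ev = theta'. *)
Lemma linop_resolvent Lambda0 z : coercivity_constant theta Lambda0 ->
  z != 0 -> (Im z != 0 \/ Re z < Lambda0) ->
  (forall g, L2 g -> exists2 u, H 2 u & aeq (linop theta u - z *: u) g) /\
  exists2 C : R, 0 <= C & forall u, H 2 u -> hnorm2 1 u <= C * n2 (linop theta u - z *: u).
Proof.
move=> [L0 co] z0 hz.
have ek : aeq (schrodinger potential E) 0 by rewrite -linopE; exact: linop_dtheta.
have co' u : H 2 u -> inner u E = 0 -> Lambda0 * n2 u <= Re (inner (schrodinger potential u) u).
  move=> hu hE; rewrite -linopE -(linform_inner hu) -fine_norm2.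
  exact: (co u (H2_H1 hu) hE).
have [s [d d0 hd]] := minus_spectral_resolvent potential_L2 potential_bound potentialD potentialZ potential_sym
  dtheta_H2 ek dtheta_neq0 co' L0 z0 hz.
have [C C0 hC] := minus_spectral_H1_bound potential_L2 potential_bound d0 hd.
split.
  by move=> g Lg; have [u hu e] := s g Lg; exists u => //; rewrite linopE.
by exists C => // u hu; rewrite linopE; exact: hC.
Qed.

End NeelOperator.

(** * From the spectrum of L to that of the generator *)

Section Dispersion.
Variable R : realType.

(** Both terms of the maximum in zeta0 have this form, the first with L = 1. *)
Lemma zeta0_terms (L nu : R) : 0 < L -> 0 < nu ->
  2^-1 * \1_`[2 * Num.sqrt L, +oo[ nu * Num.sqrt (nu ^+ 2 - 4 * L) < nu / 2.
Proof.
move=> L0 nu0.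
have s : Num.sqrt (nu ^+ 2 - 4 * L) < nu.
  rewrite -[ltRHS](ger0_norm (ltW nu0)) -sqrtr_sqr ltr_sqrt ?exprn_gt0 //.
  by rewrite ltrBlDr ltrDl mulr_gt0.
rewrite indicE; case: (_ \in _); last by rewrite mulr0 mul0r divr_gt0.
by rewrite mulr1 mulrC ltr_pM2r ?invr_gt0.
Qed.

Lemma zeta0_gt0 (L nu : R) : 0 < L -> 0 < nu -> 0 < zeta0 L nu.
Proof.
move=> L0 nu0; rewrite /zeta0 subr_gt0 gt_max (zeta0_terms L0 nu0) andbT.
have := zeta0_terms ltr01 nu0; rewrite sqrtr1 !mulr1.
by [].
Qed.

(** With b = Re lambda + nu / 2 one has Im z = - 2 b Im lambda and, for real
    lambda, z = nu^2 / 4 - b^2. Here b > 0, so lambda + nu <> 0, and z is real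
    only for real lambda; then z < L says b^2 > nu^2 / 4 - L, which is the
    second term of the maximum. *)
Lemma dispersion (L nu : R) (lam : R[i]) : 0 < L -> 0 < nu ->
  lam != 0 -> - zeta0 L nu < Re lam ->
  let z := - (lam * (lam + nu%:C)) in z != 0 /\ (Im z != 0 \/ Re z < L).
Proof.
move=> L0 nu0 lam0 hl z.
pose m := Num.max (2^-1 * \1_`[2, +oo[ nu * Num.sqrt (nu ^+ 2 - 4))
    (2^-1 * \1_`[2 * Num.sqrt L, +oo[ nu * Num.sqrt (nu ^+ 2 - 4 * L)).
have hm : m < Re lam + nu / 2 by move: hl; rewrite /zeta0 -/m; lra.
have i0 (D : set R) : 0 <= (\1_D nu : R) by rewrite indicE.
have m0 : 0 <= m by rewrite le_max mulr_ge0 ?sqrtr_ge0 // mulr_ge0 ?invr_ge0.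
have b0 : 0 < Re lam + nu / 2 := le_lt_trans m0 hm.
have zI : Im z = - (2 * (Im lam * (Re lam + nu / 2))).
  by rewrite /z cImN cImM !ReImE /=; field.
have zR : Re z = Im lam ^+ 2 - ((Re lam + nu / 2) ^+ 2 - nu ^+ 2 / 4).
  by rewrite /z cReN cReM !ReImE /=; field.
split.
  rewrite oppr_eq0 mulf_neq0 //; apply/eqP => h.
  have := congr1 (@complex.Re R) h; rewrite ReImE /= => h'; move: b0 nu0; lra.
have [y0|yn0] := eqVneq (Im lam) 0; last first.
  by left; rewrite zI oppr_eq0 !mulf_neq0 // gt_eqF.
right; rewrite zR y0 expr0n sub0r opprB ltrBlDr -ltrBlDl.
have hm2 : 2^-1 * \1_`[2 * Num.sqrt L, +oo[ nu * Num.sqrt (nu ^+ 2 - 4 * L) < Re lam + nu / 2.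
  by apply: le_lt_trans hm; rewrite le_max lexx orbT.
have [nl|nl] := leP (2 * Num.sqrt L) nu.
  rewrite indicE mem_set ?mulr1 /= ?in_itv /= ?nl // in hm2.
  have n4 : 4 * L <= nu ^+ 2.
    have : (2 * Num.sqrt L) ^+ 2 <= nu ^+ 2.
      by apply: lerXn2r; rewrite ?nnegrE ?mulr_ge0 ?sqrtr_ge0 ?(ltW nu0).
    by rewrite exprMn sqr_sqrtr ?(ltW L0) // expr2 -natrM.
  have : (2^-1 * Num.sqrt (nu ^+ 2 - 4 * L)) ^+ 2 < (Re lam + nu / 2) ^+ 2.
    by rewrite ltr_pXn2r // nnegrE ?mulr_ge0 ?sqrtr_ge0 ?invr_ge0 // ltW.
  rewrite exprMn sqr_sqrtr ?subr_ge0 // exprVn.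
  by move: ((Re lam + nu / 2) ^+ 2) (nu ^+ 2) => a b; rewrite expr2; lra.
apply: (@lt_trans _ _ 0); last exact: exprn_gt0.
have : nu ^+ 2 < (2 * Num.sqrt L) ^+ 2.
  by rewrite ltr_pXn2r // nnegrE ?mulr_ge0 ?sqrtr_ge0 ?(ltW nu0).
rewrite exprMn sqr_sqrtr ?(ltW L0) // expr2; move: (nu ^+ 2) => a; lra.
Qed.

End Dispersion.

Section PhaseSpace.
Variable R : realType.
Implicit Types (u v : Cfun R) (p : Cfun R * Cfun R).

Lemma phase_normE p : phase_norm p = Num.sqrt (hnorm2 1 p.1 + n2 p.2).
Proof. by rewrite /phase_norm fine_Hnorm2 fine_norm2. Qed.

(** The bookkeeping of constants in [generator_resolvent]: h, u and v stand
    for the squared norms of u in H^1 and L^2 and of v in L^2, g for that of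
    (L - z) u in L^2, h1 and f1 for those of f1 in H^1 and L^2, and f2 for
    that of f2. *)
Lemma phase_bound_arith (a b C f1 h1 f2 u h v g : R) : 0 <= a -> 0 <= b -> 0 <= C -> 0 <= f2 -> 0 <= h1 ->
  h <= C * g -> g <= 2 * f2 + 2 * (a * f1) -> f1 <= h1 -> u <= h -> v <= 2 * f1 + 2 * (b * u) ->
  h + v <= ((1 + 2 * b) * (C * (2 + 2 * a)) + 2) * (h1 + f2).
Proof.
move=> a0 b0 C0 f20 h10 c1 c2 c3 c4 c5.
have b1 : 0 <= 1 + 2 * b by rewrite addr_ge0 ?mulr_ge0.
have af : a * f1 <= a * h1 by exact: ler_wpM2l.
have af2 : 0 <= a * f2 by exact: mulr_ge0.
have gle : g <= (2 + 2 * a) * (h1 + f2) by rewrite mulrDl -mulrA mulrDr; lra.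
have hle : h <= C * ((2 + 2 * a) * (h1 + f2)) by apply: le_trans c1 _; exact: ler_wpM2l.
have bu : b * u <= b * h by exact: ler_wpM2l.
rewrite [leRHS](_ : _ = (1 + 2 * b) * (C * ((2 + 2 * a) * (h1 + f2))) + 2 * (h1 + f2)); last by ring.
apply: le_trans (lerD (ler_wpM2l b1 hle) (lexx _)).
by rewrite mulrDl mul1r -mulrA; move: (b * h) (b * u) bu c5 => y1 y2; lra.
Qed.

Lemma hnorm2_0 : hnorm2 1 (0 : Cfun R) = 0.
Proof.
have L0 := @L2_0 R; have Lf := L2_fourier L0.
have z : aeq (fourier (0 : Cfun R)) 0.
  apply: nrm_eq0_ae; [exact: Lf|exact: L0|].
  by rewrite subr0 (nrm_fourier L0) nrm_0.
have h0 : H 1 (0 : Cfun R).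
  apply/HP; split; first exact: L0.
  apply: (integr_jwn_ae (L2_cmeas Lf) (L2_integr L0)).
  by apply: aeS z => x ->; rewrite zerocE !normc2_0 mulr0.
by rewrite -(scale0r (0 : Cfun R)) (hnorm2Z 0 h0) normc2_0 mul0r.
Qed.

End PhaseSpace.

Section GeneratorResolvent.
Variables (R : realType) (theta : R -> R) (Lambda0 nu : R).
Hypothesis wall : static_neel_wall theta.
Hypothesis theta_smooth : smooth theta.
Hypothesis theta_incr : forall x : R, 0 < derive1 theta x.
Hypothesis dtheta_H2 : H 2 (ofreal (derive1 theta)).
Hypothesis theta_EL : euler_lagrange theta.
Hypothesis Lambda0P : coercivity_constant theta Lambda0.
Hypothesis nu_gt0 : 0 < nu.

(** Eliminating v = f1 + lambda u leaves the equation (L - z) u = - f2 -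
    (lambda + nu) f1, which is solved and estimated by [linop_resolvent]. The
    bound gives injectivity and the continuity of the inverse together. *)
Lemma generator_resolvent (lam : R[i]) : lam != 0 -> - zeta0 Lambda0 nu < Re lam ->
  resolvent_set (@phase R) (@phase_norm R) (@dom_generator R) (generator theta nu) lam.
Proof.
move=> lam0 hlam; have [L0 _] := Lambda0P.
have [z0 hz] := dispersion L0 nu_gt0 lam0 hlam.
set z := - (lam * (lam + nu%:C)) in z0 hz.
have [surjz [C C0 hC]] := linop_resolvent wall theta_smooth theta_incr dtheta_H2 theta_EL Lambda0P z0 hz.
pose k : R[i] := lam + nu%:C.
pose N2 (p : Cfun R * Cfun R) := hnorm2 1 p.1 + n2 p.2.
have N2_ge0 p : 0 <= N2 p by rewrite addr_ge0 ?hnorm2_ge0 ?n2_ge0.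
pose D p := generator theta nu p - lam *: p.
have bound : exists2 B : R, 0 <= B & forall p, dom_generator p -> N2 p <= B * N2 (D p).
  pose a := normc2 k; pose b := normc2 lam.
  have a0 : 0 <= a := normc2_ge0 _; have b0 : 0 <= b := normc2_ge0 _.
  exists ((1 + 2 * b) * (C * (2 + 2 * a)) + 2).
    by apply: addr_ge0 => //; apply: mulr_ge0; [|apply: mulr_ge0 => //]; apply: addr_ge0 => //; exact: mulr_ge0.
  move=> [u v] [/= hu hv].
  have h1 : H 1 (v - lam *: u) := HB hv (HZ lam (H2_H1 hu)).
  have Lu := H_L2 hu; have Lv := H_L2 hv; have L1 := H_L2 h1.
  set f1 := v - lam *: u in h1 L1.
  pose f2 : Cfun R := - linop theta u - nu%:C *: v - lam *: v.
  have EN : N2 (D (u, v)) = hnorm2 1 f1 + n2 f2 by [].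
  have LL : L2 (linop theta u).
    by rewrite linopE; apply: L2_schrodinger hu; exact: potential_L2.
  have Lf2 : L2 f2 := L2B (L2B (L2N LL) (L2Z _ Lv)) (L2Z _ Lv).
  have E : linop theta u - z *: u = - f2 - k *: f1.
    apply/funext => x; rewrite /f2 /f1 !(addcE, oppcE, scalecE) /z /k.
    by move: (linop _ _ x) (u x) (v x) (nu%:C) => c d e g; ring.
  have c1 := hC u hu; rewrite E in c1.
  have c2 := n2D_le (L2N Lf2) (L2N (L2Z k L1)).
  rewrite !n2N (n2Z k L1) -/a in c2.
  have c3 := n2_le_hnorm2 h1; have c4 := n2_le_hnorm2 (H2_H1 hu).
  have c5 : n2 v <= 2 * n2 f1 + 2 * (b * n2 u).
    have -> : v = f1 + lam *: u by rewrite /f1 subrK.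
    by rewrite -(n2Z lam Lu); exact: n2D_le L1 (L2Z lam Lu).
  rewrite EN /N2 /=.
  exact: (phase_bound_arith a0 b0 C0 (n2_ge0 f2) (hnorm2_ge0 1 f1) c1 c2 c3 c4 c5).
have [B B0 hB] := bound.
split.
- move=> p hp; rewrite !phase_normE => /eqP; rewrite sqrtr_eq0 => h0.
  apply/eqP; rewrite sqrtr_eq0; apply: le_trans (hB p hp) _.
  by rewrite mulr_ge0_le0.
- move=> [f1 f2] [/= h1 L2_].
  have L1 := H_L2 h1.
  have [u hu e] := surjz (- f2 - k *: f1) (L2B (L2N L2_) (L2Z k L1)).
  pose v := f1 + lam *: u.
  have hv : H 1 v := HD h1 (HZ lam (H2_H1 hu)).
  exists (u, v); first exact: (conj hu hv).
  have Lu := H_L2 hu; have Lv := H_L2 hv.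
  have LL : L2 (linop theta u).
    by rewrite linopE; apply: L2_schrodinger hu; exact: potential_L2.
  pose r : Cfun R := - linop theta u - nu%:C *: v - lam *: v - f2.
  have e1 : v - lam *: u - f1 = 0 by rewrite /v addrK subrr.
  have Lr : L2 r := L2B (L2B (L2B (L2N LL) (L2Z _ Lv)) (L2Z _ Lv)) L2_.
  have e2 : n2 r = 0.
    apply: ae_n2_eq0; first exact: L2_cmeas.
    apply: aeS e => x; rewrite /r /v /z /k !(addcE, oppcE, scalecE).
    move: (linop _ _ x) (u x) (f1 x) (f2 x) (nu%:C) => a b c d g h.
    have -> : a = - (lam * (lam + g)) * b + (- d - (lam + g) * c) by rewrite -h; ring.
    by ring.
  rewrite phase_normE -[_.1]/(v - lam *: u - f1) -[_.2]/r e1 e2 hnorm2_0 addr0.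
  exact: sqrtr0.
- exists (Num.sqrt B) => p hp; rewrite !phase_normE -sqrtrM //.
  by apply: ler_wsqrtr; exact: hB.
Qed.

End GeneratorResolvent.

Theorem theorem5p1 (R : realType) (theta : R -> R) (Lambda0 nu : R)
    (wall : static_neel_wall theta)
    (theta_smooth : smooth theta)
    (theta_incr : forall x : R, 0 < derive1 theta x)
    (dtheta_H2 : H 2 (ofreal (derive1 theta)))
    (theta_EL : euler_lagrange theta)
    (Lambda0P : coercivity_constant theta Lambda0)
    (nu_gt0 : 0 < nu) :
  0 < zeta0 Lambda0 nu /\
  spectrum (@phase R) (@phase_norm R) (@dom_generator R) (generator theta nu)
    `<=` [set 0] `|` [set lambda | complex.Re lambda <= - zeta0 Lambda0 nu].
Proof.
have [L0 _] := Lambda0P; split; first exact: zeta0_gt0.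
move=> lam hs; have [->|lam0] := eqVneq lam 0; first by left.
right => /=; rewrite leNgt; apply/negP => hlam; apply: hs.
exact: (generator_resolvent wall theta_smooth theta_incr dtheta_H2 theta_EL Lambda0P nu_gt0 lam0 hlam).
Qed.
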